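(* Let $\mathrm{G}$ be a compact quantum group, let $V$ be a finite-dimensional representation of $\mathrm{G}$, and let $0\le d\le \dim V$ be an integer. For $W\in\mathbb{G}(d,V)$ let $\mathrm{G}_W\le \mathrm{G}$ be the isotropy quantum subgroup of $W$. Then each of the following four subsets of $\mathbb{G}(d,V)$ is open in the Zariski topology on $\mathrm{Res}_{\mathbb{C}/\mathbb{R}}\mathbb{G}(d,V)$, and hence dense in the standard (Hausdorff) topology if it is non-empty: \begin{itemize} \item $\{W\in\mathbb{G}(d,V) : \mathrm{G}_W \text{ acts trivially on } W\}$; \item $\{W\in\mathbb{G}(d,V) : \mathrm{G}_W \text{ acts trivially on } V\}$; \item $\{W\in\mathbb{G}(d,V) : \text{the } \mathrm{G}_W\text{-action on } W \text{ factors through the abelianization } (\mathrm{G}_W)_{ab}\}$; \item $\{W\in\mathbb{G}(d,V) : \text{the } \mathrm{G}_W\text{-action on } V \text{ factors through the abelianization } (\mathrm{G}_W)_{ab}\}$. \end{itemize}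
   Context: A compact quantum group $\mathrm{G}$ is (contravariantly) the same thing as a CQG algebra $H=\mathcal{O}(\mathrm{G})$: a complex Hopf $*$-algebra all of whose finite-dimensional right comodules $V\to V\otimes H$, $v\mapsto v_0\otimes v_1$ (Sweedler notation), are unitarizable, i.e. admit an inner product with $\langle v_0\mid w\rangle v_1^*=\langle v\mid w_0\rangle S(w_1)$ for all $v,w\in V$, where $S$ is the antipode. Morphisms of CQG algebras are Hopf $*$-algebra morphisms. A finite-dimensional representation of $\mathrm{G}$ is a finite-dimensional right $\mathcal{O}(\mathrm{G})$-comodule. $\mathbb{G}(d,V)$ is the Grassmannian of $d$-dimensional complex linear subspaces of $V$. Isotropy quantum subgroup: for a finite-dimensional right $H$-comodule $V$ and a linear subspace $W\le V$ there is a morphism of CQG algebras $H\to H_{W\le V}$ that is initial among CQG algebra morphisms $H\to H'$ for which $W$ is an $H'$-subcomodule of $V$ (with $V$ regarded as an $H'$-comodule along $H\to H'$). It is a quotient of $H$. The isotropy quantum subgroup $\mathrm{G}_W$ is the compact quantum group with $\mathcal{O}(\mathrm{G}_W)=H_{W\le V}$. ''$\mathrm{G}_W$ acts trivially on $X$'' (for $X=W$ or $V$) means that the coaction of $H_{W\le V}$ on $X$ is $x\mapsto x\otimes 1$. Abelianization: a compact quantum group is abelian if its CQG algebra is cocommutative. $\mathrm{G}_{ab}$ is the compact quantum group whose CQG algebra is the largest cocommutative subcoalgebra $\mathcal{O}(\mathrm{G})_{coc}$ of $\mathcal{O}(\mathrm{G})$ (automatically a CQG subalgebra). The action on $X$ factors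 through $(\mathrm{G}_W)_{ab}$ if the coaction $X\to X\otimes H_{W\le V}$ takes values in $X\otimes (H_{W\le V})_{coc}$. $\mathrm{Res}_{\mathbb{C}/\mathbb{R}}$ denotes Weil restriction: $\mathrm{Res}_{\mathbb{C}/\mathbb{R}}\mathbb{G}(d,V)$ is the real algebraic variety whose real points are the complex points of $\mathbb{G}(d,V)$. Its Zariski topology on the set $\mathbb{G}(d,V)$ is the one whose closed sets are locally cut out by real polynomials in the real and imaginary parts of the coordinates. *)

(* Defs.v *)
From HB Require Import structures.
From mathcomp Require Import all_boot all_order all_algebra.
From mathcomp Require Import all_classical all_reals all_analysis.
From mathcomp.real_closed Require Import complex.
From mathcomp.multinomials Require mpoly.

Set Implicit Arguments.
Unset Strict Implicit.
Unset Printing Implicit Defensive.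

Import Order.TTheory GRing.Theory Num.Theory.
Import numFieldNormedType.Exports.

Local Open Scope complex_scope.
Local Open Scope quotient_scope.
Local Open Scope classical_set_scope.
Local Open Scope ring_scope.

Section Tensor.
Variables (K : comNzRingType) (U W : lmodType K).

Definition balanced (M : zmodType) (f : U -> W -> M) : Prop :=
  [/\ forall w, {morph f^~ w : x y / x + y},
      forall u, {morph f u : x y / x + y}
    & forall a u w, f (a *: u) w = f u (a *: w)].

Definition formal_sum (M : zmodType) (f : U -> W -> M) (s : seq (U * W)) : M :=
  \sum_(p <- s) f p.1 p.2.

(* Two formal sums of pairs denote the same tensor when no balanced map
   separates them; scalars are absorbed in the first components. *)
Definition tensor_equiv (s t : seq (U * W)) : Prop :=
  forall (M : zmodType) (f : U -> W -> M),
    balanced f -> formal_sum f s = formal_sum f t.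

Definition tensor_eqb (s t : seq (U * W)) : bool := `[< tensor_equiv s t >].

Lemma tensor_eqb_refl : reflexive tensor_eqb.
Proof. by move=> s; apply/asboolP. Qed.

Lemma tensor_eqb_sym : symmetric tensor_eqb.
Proof.
by move=> s t; apply/asboolP/asboolP => h M f bf; rewrite (h M f bf).
Qed.

Lemma tensor_eqb_trans : transitive tensor_eqb.
Proof.
move=> s t u /asboolP h /asboolP h'; apply/asboolP => M f bf.
by rewrite (h M f bf) (h' M f bf).
Qed.

Canonical tensor_equivRel :=
  EquivRel tensor_eqb tensor_eqb_refl tensor_eqb_sym tensor_eqb_trans.

Definition tensor : Type := {eq_quot tensor_equivRel}.

HB.instance Definition _ := Choice.on tensor.
HB.instance Definition _ := EqQuotient.on tensor.

(* For a balanced f this is the additive map u ⊗ w |-> f u w, i.e. Sweedler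
   notation: the sum of f t_0 t_1 when t is written t_0 ⊗ t_1.  It depends on
   the chosen representative when f is not balanced. *)
Definition tsum (M : zmodType) (f : U -> W -> M) (t : tensor) : M :=
  formal_sum f (repr t).

Definition tens (u : U) (w : W) : tensor := \pi_tensor [:: (u, w)].

Lemma tsum_pi (M : zmodType) (f : U -> W -> M) s :
  balanced f -> tsum f (\pi_tensor s) = formal_sum f s.
Proof.
move=> bf; rewrite /tsum.
have /eqmodP /asboolP : \pi_tensor (repr (\pi_tensor s)) = \pi_tensor s.
  by rewrite reprK.
exact.
Qed.

Lemma tensorP (x y : tensor) :
  (forall (M : zmodType) (f : U -> W -> M), balanced f -> tsum f x = tsum f y) ->
  x = y.
Proof. by move=> h; rewrite -(reprK x) -(reprK y); apply/eqmodP/asboolP. Qed.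

Lemma tsum_tens (M : zmodType) (f : U -> W -> M) u w :
  balanced f -> tsum f (tens u w) = f u w.
Proof. by move=> bf; rewrite tsum_pi// /formal_sum big_seq1. Qed.

Definition tzero : tensor := \pi_tensor [::].
Definition tadd (x y : tensor) : tensor := \pi_tensor (repr x ++ repr y).
Definition topp (x : tensor) : tensor :=
  \pi_tensor [seq (- p.1, p.2) | p <- repr x].
Definition tscale (a : K) (x : tensor) : tensor :=
  \pi_tensor [seq (a *: p.1, p.2) | p <- repr x].

Lemma balanced0l (M : zmodType) (f : U -> W -> M) w : balanced f -> f 0 w = 0.
Proof.
by case=> /(_ w 0 0) /= h _ _; apply: (addIr (f 0 w)); rewrite -h addr0 add0r.
Qed.

Lemma balancedNl (M : zmodType) (f : U -> W -> M) u w :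
  balanced f -> f (- u) w = - f u w.
Proof.
move=> bf; apply: (addIr (f u w)); rewrite addNr.
by case: (bf) => /(_ w (- u) u) /= <- _ _; rewrite addNr balanced0l.
Qed.

Lemma balancedZ (M : zmodType) (f : U -> W -> M) a :
  balanced f -> balanced (fun u => f (a *: u)).
Proof.
case=> h1 h2 h3; split=> [w x y|u x y|b u w].
- by rewrite scalerDr h1.
- by rewrite h2.
- by rewrite scalerA mulrC -scalerA h3.
Qed.

Lemma tsum_zero (M : zmodType) (f : U -> W -> M) :
  balanced f -> tsum f tzero = 0.
Proof. by move=> bf; rewrite tsum_pi// /formal_sum big_nil. Qed.

Lemma tsum_add (M : zmodType) (f : U -> W -> M) x y :
  balanced f -> tsum f (tadd x y) = tsum f x + tsum f y.
Proof. by move=> bf; rewrite tsum_pi// /formal_sum big_cat. Qed.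

Lemma tsum_opp (M : zmodType) (f : U -> W -> M) x :
  balanced f -> tsum f (topp x) = - tsum f x.
Proof.
move=> bf; rewrite tsum_pi// /tsum /formal_sum big_map -sumrN.
by apply: eq_bigr => p _; rewrite balancedNl.
Qed.

Lemma tsum_scale (M : zmodType) (f : U -> W -> M) a x :
  balanced f -> tsum f (tscale a x) = tsum (fun u => f (a *: u)) x.
Proof. by move=> bf; rewrite tsum_pi// /tsum /formal_sum big_map. Qed.

Lemma taddA : associative tadd.
Proof. by move=> x y z; apply: tensorP => M f bf; rewrite !tsum_add// addrA. Qed.
Lemma taddC : commutative tadd.
Proof. by move=> x y; apply: tensorP => M f bf; rewrite !tsum_add// addrC. Qed.
Lemma tadd0 : left_id tzero tadd.
Proof.
by move=> x; apply: tensorP => M f bf; rewrite tsum_add// tsum_zero// add0r.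
Qed.
Lemma taddN : left_inverse tzero topp tadd.
Proof.
move=> x; apply: tensorP => M f bf.
by rewrite tsum_add// tsum_opp// tsum_zero// addNr.
Qed.

HB.instance Definition _ := GRing.isZmodule.Build tensor taddA taddC tadd0 taddN.

Lemma tsumD (M : zmodType) (f : U -> W -> M) x y :
  balanced f -> tsum f (x + y) = tsum f x + tsum f y.
Proof. exact: tsum_add. Qed.

Lemma tsum0 (M : zmodType) (f : U -> W -> M) : balanced f -> tsum f 0 = 0.
Proof. exact: tsum_zero. Qed.

Lemma tsum_addf (M : zmodType) (f g h : U -> W -> M) x :
  (forall u w, h u w = f u w + g u w) -> tsum h x = tsum f x + tsum g x.
Proof.
by move=> e; rewrite /tsum /formal_sum -big_split; apply: eq_bigr => p _.
Qed.

Lemma eq_tsum (M : zmodType) (f g : U -> W -> M) x :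
  (forall u w, f u w = g u w) -> tsum f x = tsum g x.
Proof. by move=> e; apply: eq_bigr => p _. Qed.

Lemma raddf_tsum (M N : zmodType) (g : {additive M -> N}) (f : U -> W -> M) x :
  g (tsum f x) = tsum (fun u w => g (f u w)) x.
Proof. exact: raddf_sum. Qed.

Lemma tscaleA a b x : tscale a (tscale b x) = tscale (a * b) x.
Proof.
apply: tensorP => M f bf; have bfa := balancedZ a bf.
by rewrite !tsum_scale//; apply: eq_tsum => u w; rewrite scalerA.
Qed.
Lemma tscale1 : left_id 1 tscale.
Proof.
move=> x; apply: tensorP => M f bf; rewrite tsum_scale//.
by apply: eq_tsum => u w; rewrite scale1r.
Qed.
Lemma tscaleDr : right_distributive tscale +%R.
Proof.
move=> a x y; apply: tensorP => M f bf; have bfa := balancedZ a bf.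
by rewrite tsumD// !tsum_scale// tsumD.
Qed.
Lemma tscaleDl x : {morph tscale^~ x : a b / a + b}.
Proof.
move=> a b; apply: tensorP => M f bf; rewrite tsumD// !tsum_scale//.
by apply: tsum_addf => u w; rewrite scalerDl; case: bf => ->.
Qed.

HB.instance Definition _ := GRing.Zmodule_isLmodule.Build K tensor
  tscaleA tscale1 tscaleDr tscaleDl.

Lemma tsumZ (M : lmodType K) (f : U -> W -> M) a x :
  balanced f -> (forall b u w, f (b *: u) w = b *: f u w) ->
  tsum f (a *: x) = a *: tsum f x.
Proof.
move=> bf h; rewrite [LHS]tsum_scale// /tsum /formal_sum scaler_sumr.
by apply: eq_bigr => p _; rewrite h.
Qed.

Lemma tens_balanced : balanced tens.
Proof.
split=> [w x y|u x y|a u w]; apply: tensorP => M f bf;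
  rewrite ?tsumD// !tsum_tens//; case: bf => h1 h2 h3;
  [exact: h1|exact: h2|exact: h3].
Qed.

Lemma tensZl a u w : tens (a *: u) w = a *: tens u w.
Proof.
apply: tensorP => M f bf; rewrite [RHS]tsum_scale// !tsum_tens//.
exact: balancedZ.
Qed.

Lemma tensE (x : tensor) : x = tsum tens x.
Proof.
apply: tensorP => M f bf; rewrite [X in _ = tsum f X]/tsum /formal_sum.
rewrite (big_morph (tsum f) (fun x y => tsumD x y bf) (tsum0 bf)).
by apply: eq_bigr => p _; rewrite tsum_tens.
Qed.

Lemma tens_ind (P : tensor -> Prop) :
  P 0 -> (forall x y, P x -> P y -> P (x + y)) -> (forall u w, P (tens u w)) ->
  forall x, P x.
Proof.
move=> P0 PD Pt x; rewrite [x]tensE /tsum /formal_sum.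
by elim/big_ind : _ => // p _; exact: Pt.
Qed.

(* The linear span, inside the tensor product, of the a ⊗ b with a in A and
   b in B.  Over a field, for subspaces A and B, it is the image of the
   injection A ⊗ B -> U ⊗ W. *)
Definition in_tensor (A : set U) (B : set W) : set tensor :=
  [set t | exists2 s : seq (U * W),
     (forall p, p \in s -> A p.1 /\ B p.2) & t = \sum_(p <- s) tens p.1 p.2].

End Tensor.

Notation "U ⊗ W" := (tensor U W) (at level 40, left associativity) : type_scope.

Section TensorMaps.
Variable K : comNzRingType.

Definition tmap (U W U' W' : lmodType K) (f : U -> U') (g : W -> W')
  (t : U ⊗ W) : U' ⊗ W' := tsum (fun u w => tens (f u) (g w)) t.

Definition tswap (U W : lmodType K) (t : U ⊗ W) : W ⊗ U :=
  tsum (fun u w => tens w u) t.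

Definition tassoc (U V W : lmodType K) (t : (U ⊗ V) ⊗ W) : U ⊗ (V ⊗ W) :=
  tsum (fun x w => tsum (fun u v => tens u (tens v w)) x) t.

Definition tmul (A B : algType K) (x y : A ⊗ B) : A ⊗ B :=
  tsum (fun a b => tsum (fun a' b' => tens (a * a') (b * b')) y) x.

Lemma tensDl (U W : lmodType K) (x y : U) (w : W) :
  tens (x + y) w = tens x w + tens y w.
Proof. by case: (tens_balanced U W) => ->. Qed.
Lemma tensDr (U W : lmodType K) (u : U) (x y : W) :
  tens u (x + y) = tens u x + tens u y.
Proof. by case: (tens_balanced U W) => _ ->. Qed.
Lemma tensZr (U W : lmodType K) a (u : U) (w : W) :
  tens u (a *: w) = a *: tens u w.
Proof. by rewrite -tensZl; case: (tens_balanced U W) => _ _ ->. Qed.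

Lemma tmap_balanced (U W U' W' : lmodType K)
  (f : {linear U -> U'}) (g : {linear W -> W'}) :
  balanced (fun u w => tens (f u) (g w)).
Proof.
by split=> [w x y|u x y|a u w]; rewrite ?linearD ?tensDl ?tensDr ?linearZ
  ?[a%R *: _]/= ?tensZl ?tensZr.
Qed.

Lemma tmap_tens (U W U' W' : lmodType K)
  (f : {linear U -> U'}) (g : {linear W -> W'}) u w :
  tmap f g (tens u w) = tens (f u) (g w).
Proof. by rewrite /tmap tsum_tens//; exact: tmap_balanced. Qed.

Lemma tmap_linear (U W U' W' : lmodType K)
  (f : {linear U -> U'}) (g : {linear W -> W'}) : linear (tmap f g).
Proof.
move=> a x y; rewrite /tmap tsumD; last exact: tmap_balanced.
rewrite tsumZ//; first exact: tmap_balanced.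
by move=> b u w; rewrite linearZ /= tensZl.
Qed.

Section TmapLinear.
Variables (U W U' W' : lmodType K) (f : {linear U -> U'}) (g : {linear W -> W'}).

HB.instance Definition _ := GRing.isLinear.Build K (U ⊗ W) (U' ⊗ W') _
  (tmap f g) (tmap_linear f g).

Lemma tmap_linear0 : tmap f g 0 = 0. Proof. exact: linear0. Qed.

Lemma tmap_linearD : {morph tmap f g : x y / x + y}.
Proof. exact: linearD. Qed.

End TmapLinear.

Lemma tens0l (U W : lmodType K) (w : W) : tens (0 : U) w = 0.
Proof. exact: balanced0l (tens_balanced U W). Qed.

Lemma tassoc_inner_balanced (U V W : lmodType K) (w : W) :
  balanced (fun (u : U) (v : V) => tens u (tens v w)).
Proof.
split=> [v x y|u x y|a u v]; first by rewrite tensDl.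
  by rewrite tensDl tensDr.
by rewrite !tensZl tensZr.
Qed.

Lemma tassoc_balanced (U V W : lmodType K) :
  balanced (fun (x : U ⊗ V) (w : W) => tsum (fun u v => tens u (tens v w)) x).
Proof.
have ib w := @tassoc_inner_balanced U V W w.
split=> [w x y|x w w'|a x w].
- by rewrite (tsumD _ _ (ib w)).
- by apply: tsum_addf => u v; rewrite tensDr tensDr.
- rewrite (tsumZ _ _ (ib w)); last by move=> b u v; rewrite tensZl.
  rewrite -[LHS]/(a *: \sum_(p <- repr x) _) scaler_sumr.
  by apply: eq_bigr => p _; rewrite !tensZr.
Qed.

Lemma tassoc_tens (U V W : lmodType K) (u : U) (v : V) (w : W) :
  tassoc (tens (tens u v) w) = tens u (tens v w).
Proof.
rewrite /tassoc tsum_tens; last exact: tassoc_balanced.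
by rewrite tsum_tens//; exact: tassoc_inner_balanced.
Qed.

Lemma tassocD (U V W : lmodType K) (x y : (U ⊗ V) ⊗ W) :
  tassoc (x + y) = tassoc x + tassoc y.
Proof. by rewrite /tassoc tsumD//; exact: tassoc_balanced. Qed.

Lemma tassoc0 (U V W : lmodType K) : tassoc (0 : (U ⊗ V) ⊗ W) = 0.
Proof. by rewrite /tassoc tsum0//; exact: tassoc_balanced. Qed.

Section TensorAlgebra.
Variables A B : algType K.

Lemma tmul_inner_balanced (a : A) (b : B) :
  balanced (fun a' b' => tens (a * a') (b * b')).
Proof.
split=> [w x y|u x y|k u w]; rewrite ?mulrDr ?tensDl ?tensDr//.
by rewrite -!scalerAr tensZl tensZr.
Qed.

Lemma tmul_balanced (y : A ⊗ B) :
  balanced (fun a b => tsum (fun a' b' => tens (a * a') (b * b')) y).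
Proof.
split=> [w x x'|u x x'|k u w].
- by apply: tsum_addf => a b; rewrite mulrDl tensDl.
- by apply: tsum_addf => a b; rewrite mulrDl tensDr.
- by apply: eq_tsum => a b; rewrite -!scalerAl tensZl tensZr.
Qed.

Lemma tmul_tens a b a' b' :
  tmul (tens a b : A ⊗ B) (tens a' b') = tens (a * a') (b * b').
Proof.
rewrite /tmul tsum_tens; last exact: tmul_balanced.
by rewrite tsum_tens//; exact: tmul_inner_balanced.
Qed.

Lemma tmulDl : left_distributive (@tmul A B) +%R.
Proof. by move=> x y z; rewrite /tmul tsumD//; exact: tmul_balanced. Qed.

Lemma tmulDr : right_distributive (@tmul A B) +%R.
Proof.
move=> x y z; apply: tsum_addf => a b.
by rewrite tsumD//; exact: tmul_inner_balanced.
Qed.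

Lemma tmul0l x : tmul (0 : A ⊗ B) x = 0.
Proof. by rewrite /tmul tsum0//; exact: tmul_balanced. Qed.

Lemma tmul0r x : tmul x (0 : A ⊗ B) = 0.
Proof. by apply: (addIr (tmul x 0)); rewrite -tmulDr !add0r. Qed.

Lemma tmulA : associative (@tmul A B).
Proof.
move=> x y z; elim/tens_ind: x => [|x x' h h'|a b].
- by rewrite !tmul0l.
- by rewrite !tmulDl h h'.
elim/tens_ind: y => [|y y' h h'|a' b'].
- by rewrite !(tmul0l, tmul0r).
- by rewrite !(tmulDl, tmulDr) h h'.
elim/tens_ind: z => [|z z' h h'|a'' b''].
- by rewrite !tmul0r.
- by rewrite !tmulDr h h'.
by rewrite !tmul_tens !mulrA.
Qed.

Lemma tmul1 : left_id (tens 1 1) (@tmul A B).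
Proof.
elim/tens_ind => [|x y h h'|a b]; first by rewrite tmul0r.
  by rewrite tmulDr h h'.
by rewrite tmul_tens !mul1r.
Qed.

Lemma tmulr1 : right_id (tens 1 1) (@tmul A B).
Proof.
elim/tens_ind => [|x y h h'|a b]; first by rewrite tmul0l.
  by rewrite tmulDl h h'.
by rewrite tmul_tens !mulr1.
Qed.

HB.instance Definition _ := GRing.Zmodule_isPzRing.Build (A ⊗ B)
  tmulA tmul1 tmulr1 tmulDl tmulDr.

End TensorAlgebra.
End TensorMaps.

Record hopf_star_algebra (R : realType) := HopfStarAlgebra {
  hopf_carrier :> algType R[i];
  comul : {linear hopf_carrier -> hopf_carrier ⊗ hopf_carrier};
  counit : {scalar hopf_carrier};
  antipode : {linear hopf_carrier -> hopf_carrier};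
  star : hopf_carrier -> hopf_carrier;
  comul_monoid_morphism : monoid_morphism comul;
  counit_monoid_morphism : monoid_morphism counit;
  comul_coassoc : forall x,
    tassoc (tmap comul idfun (comul x)) = tmap idfun comul (comul x);
  counit_comull : forall x, tsum (fun a b => counit a *: b) (comul x) = x;
  counit_comulr : forall x, tsum (fun a b => counit b *: a) (comul x) = x;
  antipode_comull : forall x,
    tsum (fun a b => antipode a * b) (comul x) = counit x *: 1;
  antipode_comulr : forall x,
    tsum (fun a b => a * antipode b) (comul x) = counit x *: 1;
  starD : {morph star : x y / x + y};
  starZ : forall a x, star (a *: x) = conjc a *: star x;
  starM : forall x y, star (x * y) = star y * star x;
  starK : involutive star;
  comul_star : forall x, comul (star x) = tmap star star (comul x)
}.

Arguments comul {R h}.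
Arguments counit {R h}.
Arguments antipode {R h}.

Record comodule (R : realType) (H : hopf_star_algebra R) (V : vectType R[i]) :=
  Comodule {
  coaction :> {linear V -> V ⊗ H};
  coaction_counit : forall v,
    tsum (fun v0 (v1 : H) => counit v1 *: v0) (coaction v) = v;
  coaction_coassoc : forall v,
    tassoc (tmap coaction idfun (coaction v)) =
    tmap idfun comul (coaction v)
}.

Definition inner_product (R : realType) (V : vectType R[i]) (ip : V -> V -> R[i])
  : Prop :=
  [/\ forall v a x y, ip v (a *: x + y) = a * ip v x + ip v y,
      forall v w, ip w v = conjc (ip v w)
    & forall v, v != 0 -> 0 < ip v v].

(* As an inner product is conjugate-linear on the left, both integrands are
   balanced. *)
Definition unitarizable (R : realType) (H : hopf_star_algebra R)
  (V : vectType R[i]) (rho : comodule H V) : Prop :=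
  exists2 ip : V -> V -> R[i], inner_product ip &
    forall v w,
      tsum (fun v0 (v1 : H) => ip v0 w *: star v1) (rho v) =
      tsum (fun w0 (w1 : H) => ip v w0 *: antipode w1) (rho w).

Record cqg_algebra (R : realType) := CqgAlgebra {
  cqg_hopf :> hopf_star_algebra R;
  cqg_unitarizable : forall (V : vectType R[i]) (rho : comodule cqg_hopf V),
    unitarizable rho
}.

Record hopf_star_morphism (R : realType) (H H' : hopf_star_algebra R) :=
  HopfStarMorphism {
  hopf_fun :> {lrmorphism H -> H'};
  hopf_fun_comul : forall x, comul (hopf_fun x) = tmap hopf_fun hopf_fun (comul x);
  hopf_fun_counit : forall x, counit (hopf_fun x) = counit x;
  hopf_fun_antipode : forall x, hopf_fun (antipode x) = antipode (hopf_fun x);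
  hopf_fun_star : forall x, hopf_fun (star x) = star (hopf_fun x)
}.

Section ComoduleAlong.
Variables (R : realType) (H H' : hopf_star_algebra R) (V : vectType R[i]).
Variables (q : hopf_star_morphism H H') (rho : comodule H V).

Definition push_coaction (v : V) : V ⊗ H' := tmap idfun q (rho v).

Lemma push_coaction_linear : linear push_coaction.
Proof. by move=> a x y; rewrite /push_coaction linearP tmap_linear. Qed.

HB.instance Definition _ := GRing.isLinear.Build R[i] V (V ⊗ H') _ push_coaction
  push_coaction_linear.

Lemma counit_balanced (L : hopf_star_algebra R) :
  balanced (fun (v : V) (h : L) => counit h *: v).
Proof.
split=> [w x y|u x y|a u w]; first by rewrite scalerDr.
  by rewrite linearD scalerDl.
by rewrite scalarZ scalerA mulrC.
Qed.

Lemma push_coaction_counit v :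
  tsum (fun v0 (v1 : H') => counit v1 *: v0) (push_coaction v) = v.
Proof.
rewrite -[RHS](coaction_counit rho) /push_coaction.
have cb L := counit_balanced L.
elim/tens_ind: (rho v) => [|x y hx hy|u h].
- by rewrite tmap_linear0 !(tsum0 (cb _)).
- by rewrite tmap_linearD !(tsumD _ _ (cb _)) hx hy.
- by rewrite tmap_tens !(tsum_tens _ _ (cb _)) hopf_fun_counit.
Qed.

Lemma push_coaction_coassoc v :
  tassoc (tmap push_coaction idfun (push_coaction v)) =
  tmap idfun comul (push_coaction v).
Proof.
pose Q (x : V ⊗ (H ⊗ H)) : V ⊗ (H' ⊗ H') := tmap idfun (tmap q q) x.
transitivity (Q (tassoc (tmap rho idfun (rho v)))).
  rewrite {2}/push_coaction.
  elim/tens_ind: (rho v) => [|x y hx hy|u h].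
  - by rewrite !(tmap_linear0, tassoc0) /Q tmap_linear0.
  - by rewrite !(tmap_linearD, tassocD) hx hy /Q tmap_linearD.
  rewrite !tmap_tens /= -[push_coaction u]/(tmap idfun q (rho u)).
  elim/tens_ind: (rho u) => [|x y hx hy|w a].
  - by rewrite tmap_linear0 !tens0l !tassoc0 /Q tmap_linear0.
  - by rewrite tmap_linearD !tensDl !tassocD hx hy /Q tmap_linearD.
  by rewrite tmap_tens !tassoc_tens /Q tmap_tens /= tmap_tens.
rewrite coaction_coassoc /push_coaction /Q.
elim/tens_ind: (rho v) => [|x y hx hy|u h].
- by rewrite !tmap_linear0.
- by rewrite !tmap_linearD hx hy.
by rewrite !tmap_tens hopf_fun_comul.
Qed.

Definition comodule_along : comodule H' V :=
  @Comodule R H' V push_coaction push_coaction_counit push_coaction_coassoc.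

End ComoduleAlong.

Section Subcomodules.
Variables (R : realType) (H : hopf_star_algebra R) (V : vectType R[i]).
Variable rho : comodule H V.

Definition subcomodule (W : {vspace V}) : Prop :=
  forall w, w \in W -> in_tensor [set x | x \in W] setT (rho w).

Definition acts_trivially (X : {vspace V}) : Prop :=
  forall x, x \in X -> rho x = tens x 1.

Definition subcoalgebra (D : set H) : Prop :=
  [/\ D 0, forall (a : R[i]) x y, D x -> D y -> D (a *: x + y)
    & forall x, D x -> in_tensor D D (comul x)].

Definition cocommutative_on (D : set H) : Prop :=
  forall x, D x -> tswap (comul x) = comul x.

(* The largest cocommutative subcoalgebra, see [cocommutative_part_largest]. *)
Definition cocommutative_part : set H :=
  \bigcup_(D in [set D | subcoalgebra D /\ cocommutative_on D]) D.

Definition factors_through_abelianization (X : {vspace V}) : Prop :=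
  forall x, x \in X -> in_tensor [set y | y \in X] cocommutative_part (rho x).

Lemma in_tensor_sub (A A' B B' : set H) :
  A `<=` A' -> B `<=` B' -> in_tensor A B `<=` in_tensor A' B'.
Proof.
by move=> sA sB t [s hs ->]; exists s => // p /hs[/sA ? /sB ?].
Qed.

Lemma in_tensorP (A B : set H) a x y :
  (forall (b : R[i]) z, A z -> A (b *: z)) ->
  in_tensor A B x -> in_tensor A B y -> in_tensor A B (a *: x + y).
Proof.
move=> hA [s hs ->] [s' hs' ->].
exists ([seq (a *: p.1, p.2) | p <- s] ++ s').
  move=> p; rewrite mem_cat => /orP[/mapP[p' /hs[? ?] ->]|/hs'//].
  by split=> //; exact: hA.
rewrite big_cat big_map scaler_sumr; congr (_ + _).
by apply: eq_bigr => p _; rewrite tensZl.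
Qed.

Lemma tswap_balanced : balanced (fun u w : H => tens w u).
Proof.
split=> [w x y|u x y|a u w]; first exact: tensDr.
  exact: tensDl.
by rewrite tensZl tensZr.
Qed.

Lemma tswap_linear : linear (@tswap _ H H).
Proof.
move=> a x y; rewrite /tswap (tsumD _ _ tswap_balanced).
by rewrite (tsumZ _ _ tswap_balanced)// => c u w; rewrite tensZr.
Qed.

Lemma cocommutative_part_largest :
  [/\ subcoalgebra cocommutative_part, cocommutative_on cocommutative_part
    & forall D, subcoalgebra D -> cocommutative_on D -> D `<=` cocommutative_part].
Proof.
have big D : subcoalgebra D -> cocommutative_on D -> D `<=` cocommutative_part.
  by move=> sD cD x Dx; exists D.
split=> //; last by move=> x [D [_ cD] Dx]; exact: cD.
split.
- exists [set 0] => //; split; last first.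
    by move=> x ->; rewrite linear0 /tswap (tsum0 tswap_balanced).
  split=> // [a x y -> ->|x ->]; first by rewrite scaler0 addr0.
  by exists [::] => //; rewrite big_nil linear0.
- move=> a x y [D [[D0 DL DC] cD] Dx] [E [[E0 EL EC] cE] Ey].
  pose F : set H := [set z | exists u v, [/\ D u, E v & z = u + v]].
  have DF : D `<=` F by move=> u Du; exists u, 0; rewrite addr0.
  have EF : E `<=` F by move=> v Ev; exists 0, v; rewrite add0r.
  have FL b u v : F u -> F v -> F (b *: u + v).
    move=> [u1 [u2 [? ? ->]]] [v1 [v2 [? ? ->]]].
    exists (b *: u1 + v1), (b *: u2 + v2).
    by rewrite scalerDr addrACA; split=> //; [exact: DL|exact: EL].
  have F0 : F 0 by exact: DF.
  exists F; last by apply: FL; [exact: DF|exact: EF].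
  split; first split=> // _ [u [v [Du Ev ->]]].
    rewrite linearD -[comul u]scale1r; apply: in_tensorP.
    + by move=> b z Fz; rewrite -[b *: z]addr0; exact: FL.
    + by apply: in_tensor_sub (DC _ Du).
    + by apply: in_tensor_sub (EC _ Ev).
  move=> _ [u [v [Du Ev ->]]]; rewrite linearD -[comul u]scale1r.
  by rewrite tswap_linear cD// cE.
- move=> x [D [sD cD] Dx]; case: (sD) => _ _ /(_ _ Dx).
  by apply: in_tensor_sub; exact: big.
Qed.

End Subcomodules.

(* [q : H -> Q] is initial among the CQG algebra morphisms out of [H] along
   which [W] becomes a subcomodule of [V]; such a [Q] is O(G_W). *)
Definition is_isotropy (R : realType) (H Q : cqg_algebra R) (V : vectType R[i])
  (rho : comodule H V) (W : {vspace V}) (q : hopf_star_morphism H Q) : Prop :=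
  subcomodule (comodule_along q rho) W /\
  forall (H' : cqg_algebra R) (f : hopf_star_morphism H H'),
    subcomodule (comodule_along f rho) W ->
    exists2 g : hopf_star_morphism Q H', (forall x, g (q x) = f x) &
      forall g' : hopf_star_morphism Q H',
        (forall x, g' (q x) = f x) -> forall y, g' y = g y.

Record grassmannian (R : realType) (d : nat) (V : vectType R[i]) := Grassmannian {
  grass_space :> {vspace V};
  grass_dim : \dim grass_space == d
}.

HB.instance Definition _ (R : realType) (d : nat) (V : vectType R[i]) :=
  [isSub for @grass_space R d V].
HB.instance Definition _ (R : realType) (d : nat) (V : vectType R[i]) :=
  [Choice of grassmannian d V by <:].

Section Charts.
Variables (R : realType) (d : nat) (V : vectType R[i]).

Definition chart_gen k (e : (d + k).-tuple V) (A : 'M[R[i]]_(d, k)) : d.-tuple V :=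
  [tuple tnth e (lshift k i) + \sum_j A i j *: tnth e (rshift d j) | i < d].

Lemma chart_gen_free k (e : (d + k).-tuple V) (A : 'M[R[i]]_(d, k)) :
  basis_of fullv e -> free (chart_gen e A).
Proof.
move=> /basis_free /freeP fe; apply/freeP => c.
under eq_bigr => i _.
  rewrite -tnth_nth tnth_mktuple scalerDr scaler_sumr.
  under eq_bigr do rewrite scalerA.
  over.
rewrite big_split exchange_big /=.
under [X in _ + X]eq_bigr => j _ do rewrite -scaler_suml.
move=> h i.
pose b (j : 'I_(d + k)) : R[i] :=
  match fintype.split j with inl l => c l | inr l => \sum_i c i * A i l end.
have /fe/(_ (lshift k i)) : \sum_j b j *: e`_j = 0.
  rewrite big_split_ord -[RHS]h /=; congr (_ + _); apply: eq_bigr => j _;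
  rewrite (tnth_nth 0) /b.
    by rewrite -[X in fintype.split X]/(unsplit (inl j)) unsplitK.
  by rewrite -[X in fintype.split X]/(unsplit (inr j)) unsplitK.
by rewrite /b -[X in fintype.split X]/(unsplit (inl i)) unsplitK.
Qed.

Lemma chart_dim k (e : (d + k).-tuple V) (A : 'M[R[i]]_(d, k)) :
  basis_of fullv e -> \dim <<chart_gen e A>> == d.
Proof. by move=> he; have := chart_gen_free A he; rewrite /free size_tuple. Qed.

(* The standard affine chart of an ordered basis e_1, ..., e_(d+k) of V: the
   matrix A is sent to the graph of the linear map
   <e_1, ..., e_d> -> <e_(d+1), ..., e_(d+k)> with matrix A.  Its image is the
   set of complements of <e_(d+1), ..., e_(d+k)>. *)
Definition chart k (e : (d + k).-tuple V) (he : basis_of fullv e)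
  (A : 'M[R[i]]_(d, k)) : grassmannian d V := Grassmannian (chart_dim A he).

Definition real_coords k (A : 'M[R[i]]_(d, k)) (l : 'I_(d * k + d * k)) : R :=
  match fintype.split l with
  | inl l => complex.Re (mxvec A 0 l)
  | inr l => complex.Im (mxvec A 0 l)
  end.

Definition real_algebraic_set k (Z : set 'M[R[i]]_(d, k)) : Prop :=
  exists P : set (mpoly.mpoly (d * k + d * k) R),
    Z = [set A | forall p, P p -> mpoly.meval (real_coords A) p = 0].

(* The charts of all ordered bases cover the Grassmannian, so this is the local
   condition that the complement of S be cut out by real polynomials. *)
Definition zariski_open (S : set (grassmannian d V)) : Prop :=
  forall k (e : (d + k).-tuple V) (he : basis_of fullv e),
    real_algebraic_set (chart he @^-1` (~` S)).

(* [R[i]^o] carries the topology of the complex modulus. *)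
Definition standard_open (S : set (grassmannian d V)) : Prop :=
  forall k (e : (d + k).-tuple V) (he : basis_of fullv e),
    open (chart he @^-1` S : set 'M[(R[i])^o]_(d, k)).

Lemma standard_openT : standard_open setT.
Proof. by move=> k e he; rewrite preimage_setT; exact: openT. Qed.

Lemma standard_openI : setI_closed standard_open.
Proof.
by move=> A B oA oB k e he; rewrite preimage_setI; apply: openI; [exact: oA|exact: oB].
Qed.

Lemma standard_open_bigU (I : Type) (f : I -> set (grassmannian d V)) :
  (forall i, standard_open (f i)) -> standard_open (\bigcup_i f i).
Proof.
move=> h k e he; rewrite preimage_bigcup; apply: bigcup_open => i _; exact: h.
Qed.

Import -(notations) mpoly.

Lemma zariski_openT : zariski_open setT.
Proof.
move=> k e he; exists [set 1]; rewrite setCT preimage_set0.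
apply/seteqP; split=> // A /(_ 1 erefl); rewrite meval1 => /eqP.
by rewrite oner_eq0.
Qed.

Lemma zariski_openI : setI_closed zariski_open.
Proof.
move=> A B oA oB k e he; have [P hP] := oA k e he; have [Q hQ] := oB k e he.
exists [set r | exists p q, [/\ P p, Q q & r = p * q]].
rewrite setCI preimage_setU hP hQ; apply/seteqP; split=> [M /= [h|h] r|M /= h].
- by move=> [p [q [Pp _ ->]]]; rewrite mevalM (h _ Pp) mul0r.
- by move=> [p [q [_ Qq ->]]]; rewrite mevalM (h _ Qq) mulr0.
- apply: contrapT => /not_orP[/existsNP[p hp] /existsNP[q hq]].
  have /not_implyP[Pp np] := hp; have /not_implyP[Qq nq] := hq.
  have /eqP := h _ (ex_intro _ p (ex_intro _ q (And3 Pp Qq erefl))).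
  by rewrite mevalM mulf_eq0 => /orP[/eqP|/eqP].
Qed.

Lemma zariski_open_bigU (I : Type) (f : I -> set (grassmannian d V)) :
  (forall i, zariski_open (f i)) -> zariski_open (\bigcup_i f i).
Proof.
move=> h k e he.
exists [set p | exists i, forall A, (chart he @^-1` ~` f i) A ->
                                    meval (real_coords A) p = 0].
rewrite setC_bigcup preimage_bigcap; apply/seteqP; split=> M /= hM.
  by move=> p [i hp]; apply: hp; exact: hM.
move=> i _; have [P hP] := h i k e he; suff : (chart he @^-1` ~` f i) M by [].
rewrite hP.
move=> p Pp; apply: hM; exists i => A hA.
have : (chart he @^-1` ~` f i) A by [].
by rewrite hP; apply.
Qed.

HB.instance Definition _ := @isOpenTopological.Build (grassmannian d V)
  standard_open standard_openT standard_openI standard_open_bigU.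

End Charts.

Section ZariskiGrassmannian.
Variables (R : realType) (d : nat) (V : vectType R[i]).

(* The real points of the Weil restriction of the Grassmannian, with the
   Zariski topology. *)
Definition zariski_grassmannian : Type := grassmannian d V.

HB.instance Definition _ := Choice.on zariski_grassmannian.
HB.instance Definition _ := @isOpenTopological.Build zariski_grassmannian
  (@zariski_open R d V) (@zariski_openT R d V) (@zariski_openI R d V)
  (@zariski_open_bigU R d V).

End ZariskiGrassmannian.

Arguments zariski_grassmannian {R} d V.

Definition zariski_open_and_dense (R : realType) (d : nat) (V : vectType R[i])
  (S : set (grassmannian d V)) : Prop :=
  open (S : set (zariski_grassmannian d V)) /\
  (S !=set0 -> dense (S : set (grassmannian d V))).

(* Main.v *)
(** The isotropy algebra at W is the quotient of O(G) by the Hopf *-ideal generated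
    by A(P)^+, where P is the orthogonal projection onto W in an invariant inner
    product, u the unitary matrix of V, and A(P) the *-subalgebra generated by the
    entries of u P u^* and stable under the adjoint action. The Haar functional h
    splits O(G) as A(P) + A(P)^perp, which identifies A(P) with the coinvariants of
    the quotient map. Hence a vector v is G_W-invariant iff the entries of u v lie in
    A(P), and T intertwines iff those of u T u^* do. Every element of A(P0) extends
    to an element a(P) of A(P) depending real-algebraically on P; applying h to
    u^* a(P), or to u^* a(P) u, gives an invariant vector or an intertwiner for every
    G_W which takes the prescribed value at P0. So each set is locally a union of
    non-vanishing loci of regular functions: determinants of tuples of invariant
    vectors for trivial actions, and of xi, xi M, xi M^2, ... for abelian actions,
    since an action on W is abelian iff some intertwiner M on W has a cyclic vector.
    For density, two subspaces have a common complement, hence lie in a common chart,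
    and a real polynomial not vanishing identically on the line joining them has
    non-roots near each point. *)
Require Import Defs.
From HB Require Import structures.
From mathcomp Require Import all_boot all_order all_algebra.
From mathcomp Require Import all_classical all_reals all_analysis.
From mathcomp.real_closed Require Import complex.
From mathcomp.multinomials Require mpoly.
From mathcomp Require Import ring.
Set Implicit Arguments.
Unset Strict Implicit.
Unset Printing Implicit Defensive.
Import Order.TTheory GRing.Theory Num.Theory.
Local Open Scope complex_scope.
Local Open Scope classical_set_scope.
Local Open Scope ring_scope.
Local Open Scope sesquilinear_scope.
Local Open Scope quotient_scope.

(** * Functionals and tensors *)

Section LinearBuild.
Variable K : comNzRingType.

(** The universal property of O(G_W) quantifies over CQG algebras only, so the quotient by the ideal
    of A(P)^+ may serve as a test object only once all its comodules are known to be unitarizable. A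
    comodule of a quotient need not lift, so this goes through an equivalent condition that visibly
    survives quotients: being spanned by coefficients of unitary corepresentations.

    Openness asks that no invariant of G_W be lost at nearby subspaces, although the space of
    invariants may jump. This is why A(P) is given by generators: a derivation of membership at P0
    can be re-read at every P, whereas a description as coinvariants gives no handle on the
    variation of P. The product of u^* with a(P) has entries in H; h makes them scalars, and
    invariance survives because A(P) is a left coideal.

    Cocommutativity is an equation and so looks like a closed condition; a cyclic intertwiner
    replaces it by the non-vanishing of a determinant.

    The orthogonal projection onto W involves complex conjugates of the coordinates, which is why
    the real Zariski topology appears. *)

Definition mk_linear (U V : lmodType K) (f : U -> V) (hf : linear f) :
  {linear U -> V} := HB.pack f (GRing.isLinear.Build K U V _ f hf).

Definition mk_scalar (U : lmodType K) (f : U -> K) (hf : scalar f) :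
  {scalar U} := HB.pack f (GRing.isLinear.Build K U K _ f hf).

End LinearBuild.

Section Functionals.
Variables (K : fieldType) (U : lmodType K).

(** Subspaces are sets here, since a CQG algebra is in general infinite-dimensional and carries no
    [vectType] structure. *)
Definition submodule (N : set U) : Prop :=
  N 0 /\ forall (a : K) x y, N x -> N y -> N (a *: x + y).

Lemma submoduleD N x y : submodule N -> N x -> N y -> N (x + y).
Proof. by case=> _ h hx hy; rewrite -[x]scale1r; exact: h. Qed.

Lemma submoduleZ N a x : submodule N -> N x -> N (a *: x).
Proof. by case=> h0 h hx; rewrite -[_ *: _]addr0; exact: h. Qed.

Lemma submoduleN N x : submodule N -> N x -> N (- x).
Proof. by move=> sN; rewrite -scaleN1r; exact: submoduleZ. Qed.

Lemma submoduleB N x y : submodule N -> N x -> N y -> N (x - y).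
Proof. by move=> sN hx hy; apply: submoduleD => //; exact: submoduleN. Qed.

Lemma submodule_sum N (I : Type) (r : seq I) (P : pred I) (F : I -> U) :
  submodule N -> (forall i, P i -> N (F i)) -> N (\sum_(i <- r | P i) F i).
Proof.
move=> sN h; elim/big_ind: _ => //; first by case: sN.
by move=> x y hx hy; exact: submoduleD.
Qed.

(* A hyperplane is a maximal subspace avoiding a vector. *)
Lemma separating_functional (N : set U) (b : U) :
  submodule N -> ~ N b ->
  exists f : {scalar U}, f b = 1 /\ forall x, N x -> f x = 0.
Proof.
move=> sN Nb.
pose P (X : set U) := X = set0 \/ [/\ submodule X, N `<=` X & ~ X b].
have [|A [PA maxA]] := @Zorn_bigcup U P.
  move=> F FP Ft; have [[X FX X0]|none] := pselect (exists2 X, F X & X <> set0).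
    right; have [[Xz Xl] NX Xb] : [/\ submodule X, N `<=` X & ~ X b].
      by case: (FP X FX).
    split; last by case=> Y FY Yb; case: (FP Y FY) => [Y0|[_ _ /(_ Yb)]//]; move: Yb; rewrite Y0.
    - split; first by exists X.
      move=> a x y [Y FY Yx] [Z FZ Zy].
      have aux T x' : F T -> T x' -> submodule T.
        by move=> FT Tx; case: (FP T FT) => [T0|[]]//; move: Tx; rewrite T0.
      case: (Ft _ _ FY FZ) => YZ.
        by exists Z => //; have [_] := aux _ _ FZ Zy; apply => //; exact: YZ.
      by exists Y => //; have [_] := aux _ _ FY Yx; apply => //; exact: YZ.
    - by move=> x Nx; exists X => //; exact: NX.
  left; apply/seteqP; split=> // x [X FX Xx]; apply: none; exists X => // X0.
  by move: Xx; rewrite X0.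
case: PA => [A0|[sA NA Ab]].
  exfalso; apply: (maxA N); last by right; split.
  by rewrite A0; split=> // /(_ 0 (proj1 sN)).
(* For x outside [A], maximality puts b in A + K x, with a non-zero coefficient of x because b is
   not in [A]; solving for x puts it in A + K b. *)
have dec x : exists c, A (x - c *: b).
  have [Ax|Ax] := pselect (A x); first by exists 0; rewrite scale0r subr0.
  pose B : set U := [set y | exists c, A (y - c *: x)].
  have AB : A `<=` B by move=> y Ay; exists 0; rewrite scale0r subr0.
  have sB : submodule B.
    split; first by apply: AB; case: sA.
    move=> a y z [c hc] [e he]; exists (a * c + e).
    rewrite scalerDl opprD addrACA -scalerA -scalerBr.
    by case: sA => _; apply.
  have Bb : B b.
    apply: contrapT => Bb; apply: (maxA B); last first.
      by right; split=> // y /NA/AB.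
    split=> // /(_ x) h; apply: Ax; apply: h.
    by exists 1; rewrite scale1r subrr; case: sA.
  have [c hc] := Bb; have c0 : c != 0.
    by apply/eqP => c0; apply: Ab; rewrite c0 scale0r subr0 in hc.
  exists c^-1; have := submoduleZ (- c^-1) sA hc.
  by rewrite scalerBr !scaleNr scalerA mulVf// scale1r opprK addrC.
(* [g] reads off the coefficient of b in U = A + K b; by [dec] the default value 0 is never
   taken. *)
pose g x := xget 0 [set c | A (x - c *: b)].
have gP x : A (x - g x *: b).
  by have [c hc] := dec x; exact: (xgetPex 0 (ex_intro [set c | A (x - c *: b)] c hc)).
have guniq x c : A (x - c *: b) -> g x = c.
  move=> hc; apply/eqP; rewrite -subr_eq0; apply/eqP; apply: contrapT => /eqP ne.
  apply: Ab; have := submoduleB sA hc (gP x).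
  rewrite opprB addrC addrA addrNK -scalerBl => /(submoduleZ (g x - c)^-1 sA).
  by rewrite scalerA mulVf// scale1r.
have glin : scalar g.
  move=> a x y; apply: guniq.
  rewrite scalerDl opprD addrACA -scalerA -scalerBr.
  by case: sA => _; apply.
exists (mk_scalar glin); split=> [|x Nx] /=; apply: guniq.
  by rewrite scale1r subrr; case: sA.
by rewrite scale0r subr0; exact: NA.
Qed.

(** Separation of x from the zero subspace. It lets identities in H be checked as identities of
    complex matrices, by applying all functionals entrywise. *)
Lemma functional_separates (x : U) : (forall f : {scalar U}, f x = 0) -> x = 0.
Proof.
move=> h; apply: contrapT => x0.
have [|f [f1 _]] := @separating_functional [set 0] x _ x0.
  by split=> // a y z -> ->; rewrite scaler0 addr0.
by have := h f; rewrite f1 => /eqP; rewrite oner_eq0.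
Qed.

Definition lin_indep n (a : 'I_n -> U) : Prop :=
  forall c : 'I_n -> K, \sum_i c i *: a i = 0 -> forall i, c i = 0.

Lemma dual_functional n (a : 'I_n -> U) i : lin_indep a ->
  exists f : {scalar U}, forall j, f (a j) = (j == i)%:R.
Proof.
(* [N] is the span of the a_j with j different from i; independence keeps a_i outside it. *)
move=> ha; pose N : set U := [set x | exists2 c, c i = 0 & x = \sum_j c j *: a j].
have [||f [f1 fN]] := @separating_functional N (a i).
- split; first by exists (fun=> 0) => //; rewrite big1// => j _; rewrite scale0r.
  move=> k x y [c ci ->] [e ei ->]; exists (fun j => k * c j + e j).
    by rewrite ci ei mulr0 addr0.
  rewrite scaler_sumr -big_split; apply: eq_bigr => j _ /=.
  by rewrite scalerDl scalerA.
- move=> [c ci h]; have := ha (fun j => c j - (j == i)%:R).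
  have -> : \sum_j (c j - (j == i)%:R) *: a j = 0.
    under eq_bigr do rewrite scalerBl.
    rewrite sumrB -h (bigD1 i)//= eqxx scale1r big1 ?addr0 ?subrr//.
    by move=> j /negPf->; rewrite scale0r.
  move=> /(_ erefl i); rewrite ci eqxx sub0r => /eqP.
  by rewrite oppr_eq0 oner_eq0.
exists f => j; case: (eqVneq j i) => [->//|ne]; apply: fN.
exists (fun k => (k == j)%:R); first by rewrite eq_sym (negPf ne).
rewrite (bigD1 j)//= eqxx scale1r big1 ?addr0// => k /negPf->.
by rewrite scale0r.
Qed.

End Functionals.

Section Contraction.
Variables (K : comNzRingType) (U W : lmodType K).

Lemma contractl_balanced (f : {scalar U}) :
  balanced (fun (u : U) (w : W) => f u *: w).
Proof.
split=> [w x y|u x y|a u w]; first by rewrite raddfD scalerDl.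
  by rewrite scalerDr.
by rewrite scalarZ scalerA mulrC.
Qed.

Lemma contractr_balanced (f : {scalar W}) :
  balanced (fun (u : U) (w : W) => f w *: u).
Proof.
split=> [w x y|u x y|a u w]; first by rewrite scalerDr.
  by rewrite raddfD scalerDl.
by rewrite scalarZ scalerA mulrC.
Qed.

(** The slice maps f ⊗ id and, below, id ⊗ f. *)
Definition contractl (f : {scalar U}) (t : U ⊗ W) : W :=
  tsum (fun u w => f u *: w) t.
Definition contractr (f : {scalar W}) (t : U ⊗ W) : U :=
  tsum (fun u w => f w *: u) t.

Lemma contractl_linear f : linear (contractl f).
Proof.
move=> a x y; rewrite /contractl (tsumD _ _ (contractl_balanced f)).
by rewrite (tsumZ _ _ (contractl_balanced f))// => b u w; rewrite scalarZ scalerA.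
Qed.

Lemma contractr_linear f : linear (contractr f).
Proof.
move=> a x y; rewrite /contractr (tsumD _ _ (contractr_balanced f)).
rewrite (tsumZ _ _ (contractr_balanced f))// => b u w.
by rewrite !scalerA mulrC.
Qed.

HB.instance Definition _ f := GRing.isLinear.Build K (U ⊗ W) W _ (contractl f)
  (contractl_linear f).
HB.instance Definition _ f := GRing.isLinear.Build K (U ⊗ W) U _ (contractr f)
  (contractr_linear f).

Lemma contractl_tens f u w : contractl f (tens u w) = f u *: w.
Proof. by rewrite /contractl tsum_tens//; exact: contractl_balanced. Qed.
Lemma contractr_tens f u w : contractr f (tens u w) = f w *: u.
Proof. by rewrite /contractr tsum_tens//; exact: contractr_balanced. Qed.

End Contraction.

Section Tensors.
Variable K : fieldType.

Lemma tens_suml (U W : lmodType K) (I : Type) (r : seq I) (P : pred I)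
  (F : I -> U) (w : W) :
  tens (\sum_(i <- r | P i) F i) w = \sum_(i <- r | P i) tens (F i) w.
Proof.
apply: (big_morph (fun u => tens u w)) => [x y|]; first exact: tensDl.
exact: tens0l.
Qed.

Lemma tens0r (U W : lmodType K) (u : U) : tens u (0 : W) = 0.
Proof. by rewrite -[0 : W](scale0r 0) tensZr scale0r. Qed.

Lemma tens_sumr (U W : lmodType K) (I : Type) (r : seq I) (P : pred I)
  (F : I -> W) (u : U) :
  tens u (\sum_(i <- r | P i) F i) = \sum_(i <- r | P i) tens u (F i).
Proof.
apply: (big_morph (fun w => tens u w)) => [x y|]; first exact: tensDr.
exact: tens0r.
Qed.

Lemma tensor_sum (U W : lmodType K) (t : U ⊗ W) :
  exists n, exists (a : 'I_n -> U) (b : 'I_n -> W), t = \sum_i tens (a i) (b i).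
Proof.
rewrite [t]tensE /tsum /formal_sum; move: (repr t) => s.
exists (size s), (fun i => (tnth (in_tuple s) i).1),
  (fun i => (tnth (in_tuple s) i).2).
by rewrite big_tnth.
Qed.

(* In an expression of minimal length both families are linearly independent. *)
Lemma tensor_sum_indep (U W : lmodType K) (t : U ⊗ W) :
  exists n, exists (a : 'I_n -> U) (b : 'I_n -> W),
    [/\ t = \sum_i tens (a i) (b i), lin_indep a & lin_indep b].
Proof.
pose P n := `[< exists (a : 'I_n -> U) (b : 'I_n -> W), t = \sum_i tens (a i) (b i) >].
have exP : exists n, P n.
  by have [n h] := tensor_sum t; exists n; exact/asboolP.
case: (ex_minnP exP) => n /asboolP [a [b e]] min; exists n, a, b.
case: n a b e min => [|n] a b e min; first by split=> // c _ [].
have red (i : 'I_n.+1) (a' : 'I_n -> U) (b' : 'I_n -> W) :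
    t <> \sum_i tens (a' i) (b' i).
  move=> h; suff /min : P n by rewrite ltnn.
  by apply/asboolP; exists a', b'.
split=> // c hc i; apply/eqP/negPn/negP => ci.
- have ai : a i = - \sum_(j < n) ((c i)^-1 * c (lift i j)) *: a (lift i j).
    move: hc; rewrite (bigD1_ord i)//= => /eqP; rewrite addr_eq0 => /eqP h.
    apply: (scalerI ci); rewrite h scalerN scaler_sumr; congr (- _).
    by apply: eq_bigr => j _; rewrite scalerA mulrA divff// mul1r.
  apply: (red i (fun j => a (lift i j))
    (fun j => b (lift i j) - ((c i)^-1 * c (lift i j)) *: b i)).
  rewrite e (bigD1_ord i)//= ai -sumrN tens_suml -big_split.
  apply: eq_bigr => j _ /=; rewrite tensDr addrC -scaleNr tensZl; congr (_ + _).
  by rewrite -scaleNr tensZr.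
- have bi : b i = - \sum_(j < n) ((c i)^-1 * c (lift i j)) *: b (lift i j).
    move: hc; rewrite (bigD1_ord i)//= => /eqP; rewrite addr_eq0 => /eqP h.
    apply: (scalerI ci); rewrite h scalerN scaler_sumr; congr (- _).
    by apply: eq_bigr => j _; rewrite scalerA mulrA divff// mul1r.
  apply: (red i (fun j => a (lift i j) - ((c i)^-1 * c (lift i j)) *: a i)
    (fun j => b (lift i j))).
  rewrite e (bigD1_ord i)//= bi -sumrN tens_sumr -big_split.
  apply: eq_bigr => j _ /=; rewrite tensDl addrC -scaleNr tensZr; congr (_ + _).
  by rewrite -scaleNr tensZl.
Qed.

End Tensors.

(** * Matrix coefficients of corepresentations *)

Section StarMatrices.
Variables (R : realType) (H : hopf_star_algebra R).
Local Notation C := R[i].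

Lemma star_is_additive : additive (@star R H).
Proof.
have s0 : star (0 : H) = 0.
  by apply: (addrI (star (0 : H))); rewrite -starD !addr0.
move=> x y; apply: (addIr (star y)); rewrite -starD !addrNK//.
Qed.
HB.instance Definition _ := GRing.isAdditive.Build H H (@star R H) star_is_additive.

Lemma star1 : star (1 : H) = 1.
Proof. by have := starM (star (1 : H)) 1; rewrite mulr1 starK mulr1. Qed.

Lemma antipode1 : antipode (1 : H) = 1.
Proof.
have := antipode_comull (1 : H).
rewrite (comul_monoid_morphism H).1 (counit_monoid_morphism H).1 scale1r.
rewrite -[X in tsum _ X]/(tens 1 1) tsum_tens ?mulr1//.
split=> [w x y|u x y|a u w]; rewrite ?linearD ?mulrDl ?mulrDr//.
by rewrite linearZ /= -scalerAl -scalerAr.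
Qed.

(** Star and transposition come together, since over a noncommutative algebra neither of them alone
    reverses matrix products. *)
Definition adj m n (A : 'M[H]_(m, n)) : 'M[H]_(n, m) := \matrix_(i, j) star (A j i).

Lemma adjE m n (A : 'M[H]_(m, n)) i j : adj A i j = star (A j i).
Proof. by rewrite mxE. Qed.

Lemma adjK m n (A : 'M[H]_(m, n)) : adj (adj A) = A.
Proof. by apply/matrixP => i j; rewrite !mxE starK. Qed.

Lemma adjM m n p (A : 'M[H]_(m, n)) (B : 'M[H]_(n, p)) :
  adj (A *m B) = adj B *m adj A.
Proof.
apply/matrixP => i j; rewrite !mxE raddf_sum; apply: eq_bigr => k _ /=.
by rewrite /= !mxE starM.
Qed.

Definition scmx m n (M : 'M[C]_(m, n)) : 'M[H]_(m, n) := map_mx (in_alg H) M.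

Lemma scmxM m n p (A : 'M[C]_(m, n)) (B : 'M[C]_(n, p)) :
  scmx (A *m B) = scmx A *m scmx B.
Proof. exact: map_mxM. Qed.

Lemma scmx1 n : scmx 1%:M = 1%:M :> 'M[H]_n.
Proof. exact: map_mx1. Qed.

Lemma scmx0 m n : scmx 0 = 0 :> 'M[H]_(m, n).
Proof. exact: map_mx0. Qed.

Lemma adj_scmx m n (A : 'M[C]_(m, n)) : adj (scmx A) = scmx (A ^t*).
Proof. by apply/matrixP => i j; rewrite !mxE starZ star1. Qed.

Lemma mulmx_sc m n p (w : 'M[H]_(m, n)) (A : 'M[C]_(n, p)) i j :
  (w *m scmx A) i j = \sum_k A k j *: w i k.
Proof. by rewrite mxE; apply: eq_bigr => k _; rewrite mxE /= -scalerAr mulr1. Qed.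

Lemma mulsc_mx m n p (A : 'M[C]_(m, n)) (w : 'M[H]_(n, p)) i j :
  (scmx A *m w) i j = \sum_k A i k *: w k j.
Proof. by rewrite mxE; apply: eq_bigr => k _; rewrite mxE /= -scalerAl mul1r. Qed.

Lemma linear_sc (V : lmodType C) (f : {linear H -> V}) m n p q
  (A : 'M[C]_(m, n)) (w : 'M[H]_(n, p)) (B : 'M[C]_(p, q)) i j :
  f ((scmx A *m w *m scmx B) i j) = \sum_k \sum_l (A i k * B l j) *: f (w k l).
Proof.
rewrite mulmx_sc raddf_sum exchange_big; apply: eq_bigr => l _ /=.
rewrite mulsc_mx linearZ /= raddf_sum scaler_sumr; apply: eq_bigr => k _ /=.
by rewrite linearZ /= scalerA mulrC.
Qed.

Lemma map_lin_sc (f : {linear H -> H}) m n p q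
  (A : 'M[C]_(m, n)) (w : 'M[H]_(n, p)) (B : 'M[C]_(p, q)) :
  map_mx f (scmx A *m w *m scmx B) = scmx A *m map_mx f w *m scmx B.
Proof.
apply/matrixP => i j; rewrite [LHS]mxE linear_sc mulmx_sc exchange_big.
apply: eq_bigr => l _ /=; rewrite mulsc_mx scaler_sumr; apply: eq_bigr => k _ /=.
by rewrite mxE scalerA mulrC.
Qed.

Lemma map_scalar_sc (f : {scalar H}) m n p q
  (A : 'M[C]_(m, n)) (w : 'M[H]_(n, p)) (B : 'M[C]_(p, q)) :
  map_mx f (scmx A *m w *m scmx B) = A *m map_mx f w *m B.
Proof.
apply/matrixP => i j; rewrite [LHS]mxE [RHS]mxE mulmx_sc raddf_sum.
apply: eq_bigr => l _ /=; rewrite scalarZ mulsc_mx raddf_sum mulrC mxE; congr (_ * _).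
by apply: eq_bigr => k _; rewrite /= scalarZ mxE.
Qed.

End StarMatrices.

Section Coreps.
Variables (R : realType) (H : hopf_star_algebra R).
Local Notation C := R[i].

Definition corep n (w : 'M[H]_n) : Prop :=
  (forall i j, comul (w i j) = \sum_k tens (w i k) (w k j)) /\
  (forall i j, counit (w i j) = (i == j)%:R).

(** Since S(w) is inverse to w for every corepresentation, this says that w is a unitary matrix; in
    this form it passes at once along Hopf *-morphisms. *)
Definition ucorep n (w : 'M[H]_n) : Prop :=
  corep w /\ forall i j, antipode (w i j) = star (w j i).

(** The convolution actions x -> f(x_1) x_2 and, below, x -> f(x_2) x_1 of the dual. A left coideal
    is stable under every [lact f]. *)
Definition lact (f : {scalar H}) (x : H) : H := contractl f (comul x).
Definition ract (f : {scalar H}) (x : H) : H := contractr f (comul x).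

Lemma lact_linear f : linear (lact f).
Proof. by move=> a x y; rewrite /lact !linearP. Qed.
Lemma ract_linear f : linear (ract f).
Proof. by move=> a x y; rewrite /ract !linearP. Qed.
HB.instance Definition _ f := GRing.isLinear.Build C H H _ (lact f) (lact_linear f).
HB.instance Definition _ f := GRing.isLinear.Build C H H _ (ract f) (ract_linear f).

Lemma lact_corep f n (w : 'M[H]_n) i j : corep w ->
  lact f (w i j) = \sum_k f (w i k) *: w k j.
Proof.
move=> [cw _]; rewrite /lact cw raddf_sum; apply: eq_bigr => k _ /=.
exact: contractl_tens.
Qed.

Lemma ract_corep f n (w : 'M[H]_n) i j : corep w ->
  ract f (w i j) = \sum_k f (w k j) *: w i k.
Proof.
move=> [cw _]; rewrite /ract cw raddf_sum; apply: eq_bigr => k _ /=.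
exact: contractr_tens.
Qed.

Lemma comul_lact f x : comul (lact f x) = tmap (lact f) idfun (comul x).
Proof.
transitivity (contractl f (tmap idfun comul (comul x))).
  rewrite /lact; elim/tens_ind: (comul x) => [|y z hy hz|a b].
  - by rewrite tmap_linear0 !linear0.
  - by rewrite tmap_linearD !linearD hy hz.
  - by rewrite tmap_tens !contractl_tens linearZ.
rewrite -comul_coassoc.
elim/tens_ind: (comul x) => [|y z hy hz|a b].
- by rewrite !tmap_linear0 tassoc0 linear0.
- by rewrite !tmap_linearD tassocD [LHS]linearD /= hy hz.
rewrite !tmap_tens /= /lact.
elim/tens_ind: (comul a) => [|y z hy hz|c d].
- by rewrite tens0l tassoc0 !linear0 tens0l.
- by rewrite tensDl tassocD [LHS]linearD /= hy hz -tensDl linearD.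
by rewrite tassoc_tens !contractl_tens tensZl.
Qed.

Lemma lact_counit x : lact counit x = x.
Proof. exact: counit_comull. Qed.
Lemma ract_counit x : ract counit x = x.
Proof. exact: counit_comulr. Qed.

Lemma counit_lact f x : counit (lact f x) = f x.
Proof.
rewrite -{2}[x]ract_counit /ract /lact.
elim/tens_ind: (comul x) => [|y z hy hz|a b].
- by rewrite !linear0.
- by rewrite !linearD hy hz.
by rewrite contractl_tens contractr_tens !scalarZ mulrC.
Qed.

(* Every element is a matrix coefficient of a finite-dimensional corepresentation;
   the vector (w eta) spans a left coideal generated by x. *)
Lemma corep_coefficient (x : H) : exists n (w : 'M[H]_n) (b : 'cV[H]_n)
    (xi : 'rV[C]_n) (f : 'I_n -> {scalar H}),
  [/\ corep w, forall i, b i 0 = lact (f i) x,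
      b = w *m scmx H (map_mx counit b) & x = (scmx H xi *m b) 0 0].
Proof.
have [n [a [b [e ha hb]]]] := tensor_sum_indep (comul x).
have [alpha alphaP] := choice (fun i => dual_functional i ha).
have [beta betaP] := choice (fun i => dual_functional i hb).
have bE i : b i = lact (alpha i) x.
  rewrite /lact e raddf_sum (bigD1 i)//= contractl_tens alphaP eqxx scale1r.
  rewrite big1 ?addr0// => j ne; rewrite contractl_tens alphaP (negPf ne).
  by rewrite scale0r.
(* Slicing Δ(x) = Σ a_t ⊗ b_t by alpha_s and using coassociativity gives Δ(b_s) = Σ_t w_st ⊗ b_t
   with this [w]; comparing coefficients of the independent b_t then shows that [w] is a
   corepresentation. *)
pose w : 'M[H]_n := \matrix_(s, t) lact (alpha s) (a t).
have comulb s : comul (b s) = \sum_t tens (w s t) (b t).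
  rewrite bE comul_lact e linear_sum; apply: eq_bigr => t _.
  by rewrite /= tmap_tens mxE.
have cw : corep w.
  split=> s t.
    have := comul_coassoc (b s); rewrite comulb !linear_sum /=.
    under eq_bigr do rewrite tmap_tens /=.
    under [X in _ = X -> _]eq_bigr do rewrite tmap_tens /= comulb tens_sumr.
    move=> /(congr1 (fun z => tmap idfun (contractr (beta t)) z)) /=.
    have key (y : H ⊗ H) c : tmap idfun (contractr (beta t)) (tassoc (tens y c)) =
        beta t c *: y.
      elim/tens_ind: y => [|y z hy hz|y z].
      - by rewrite tens0l tassoc0 linear0 scaler0.
      - by rewrite tensDl tassocD linearD /= hy hz scalerDr.
      - by rewrite tassoc_tens tmap_tens /= contractr_tens tensZr.
    rewrite (big_morph _ (@tassocD _ H H H) (@tassoc0 _ H H H)) !linear_sum /=.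
    rewrite (bigD1 t)//= key betaP eqxx scale1r big1 ?addr0; last first.
      by move=> r ne; rewrite key betaP (negPf ne) scale0r.
    move=> ->; apply: eq_bigr => r _; rewrite linear_sum /= (bigD1 t)//=.
    rewrite tmap_tens /= contractr_tens betaP eqxx scale1r big1 ?addr0//.
    by move=> l ne; rewrite tmap_tens /= contractr_tens betaP (negPf ne) scale0r tens0r.
  apply/eqP; rewrite -subr_eq0; apply/eqP.
  have := hb (fun t => counit (w s t) - (s == t)%:R); apply.
  under eq_bigr do rewrite scalerBl; rewrite sumrB.
  have := lact_counit (b s); rewrite {1}/lact comulb raddf_sum.
  under eq_bigr do rewrite /= contractl_tens.
  move=> ->; rewrite (bigD1 s)//= eqxx scale1r big1 ?addr0 ?subrr//.
  by move=> j; rewrite eq_sym => /negPf->; rewrite scale0r.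
exists n, w, (\col_i b i), (\row_i counit (a i)), alpha; split=> //.
- by move=> i; rewrite mxE.
- apply/colP => i; rewrite mulmx_sc mxE -{1}[b i]ract_counit /ract comulb raddf_sum.
  by apply: eq_bigr => k _; rewrite !mxE /= contractr_tens.
- rewrite mulsc_mx -{1}[x]lact_counit /lact e raddf_sum.
  by apply: eq_bigr => k _; rewrite !mxE /= contractl_tens.
Qed.

Lemma antipode_balancedl : balanced (fun a b : H => antipode a * b).
Proof.
split=> [w x y|u x y|a u w]; rewrite ?linearD ?mulrDl ?mulrDr//.
by rewrite linearZ /= -scalerAl -scalerAr.
Qed.
Lemma antipode_balancedr : balanced (fun a b : H => a * antipode b).
Proof.
split=> [w x y|u x y|a u w]; rewrite ?linearD ?mulrDl ?mulrDr//.
by rewrite linearZ /= -scalerAl -scalerAr.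
Qed.

Lemma tsum_sum (U W : lmodType C) (M : zmodType) (f : U -> W -> M) (I : Type)
  (r : seq I) (P : pred I) (F : I -> U ⊗ W) : balanced f ->
  tsum f (\sum_(i <- r | P i) F i) = \sum_(i <- r | P i) tsum f (F i).
Proof.
by move=> bf; apply: (big_morph _ (fun x y => tsumD x y bf) (tsum0 bf)).
Qed.

Lemma corep_antipodeVl n (w : 'M[H]_n) : corep w -> map_mx antipode w *m w = 1%:M.
Proof.
move=> [cw ew]; apply/matrixP => i j; rewrite !mxE.
have := antipode_comull (w i j); rewrite cw ew.
rewrite (tsum_sum _ _ _ antipode_balancedl) => h.
transitivity ((i == j)%:R *: (1 : H)); last by rewrite scaler_nat.
rewrite -h; apply: eq_bigr => k _.
by rewrite (tsum_tens _ _ antipode_balancedl) mxE.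
Qed.

Lemma corep_antipodeVr n (w : 'M[H]_n) : corep w -> w *m map_mx antipode w = 1%:M.
Proof.
move=> [cw ew]; apply/matrixP => i j; rewrite !mxE.
have := antipode_comulr (w i j); rewrite cw ew.
rewrite (tsum_sum _ _ _ antipode_balancedr) => h.
transitivity ((i == j)%:R *: (1 : H)); last by rewrite scaler_nat.
rewrite -h; apply: eq_bigr => k _.
by rewrite (tsum_tens _ _ antipode_balancedr) mxE.
Qed.

Lemma ucorep_antipode n (w : 'M[H]_n) : ucorep w -> map_mx antipode w = adj w.
Proof. by move=> [_ h]; apply/matrixP => i j; rewrite !mxE h. Qed.

Lemma ucorepVl n (w : 'M[H]_n) : ucorep w -> adj w *m w = 1%:M.
Proof. by move=> uw; rewrite -ucorep_antipode// corep_antipodeVl//; case: uw. Qed.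

Lemma ucorepVr n (w : 'M[H]_n) : ucorep w -> w *m adj w = 1%:M.
Proof. by move=> uw; rewrite -ucorep_antipode// corep_antipodeVr//; case: uw. Qed.

Lemma corep_conj n (w : 'M[H]_n) (B B' : 'M[C]_n) : B *m B' = 1%:M ->
  corep w -> corep (scmx H B *m w *m scmx H B').
Proof.
move=> BB' [cw ew]; have B'B := mulmx1C BB'; split=> i j; last first.
  have := map_scalar_sc counit B w B'.
  have -> : map_mx counit w = 1%:M by apply/matrixP => k l; rewrite !mxE ew.
  by rewrite mulmx1 BB' => /matrixP /(_ i j); rewrite !mxE.
rewrite (linear_sc comul).
under eq_bigr do under eq_bigr do rewrite cw scaler_sumr.
pose x : 'M[H]_n := scmx H B *m w; pose y : 'M[H]_n := w *m scmx H B'.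
transitivity (\sum_r tens (x i r) (y r j)).
  under [RHS]eq_bigr do rewrite mulsc_mx mulmx_sc tens_suml.
  rewrite [RHS]exchange_big; apply: eq_bigr => k _ /=; rewrite exchange_big.
  apply: eq_bigr => r _ /=; rewrite tens_sumr; apply: eq_bigr => l _.
  by rewrite tensZl tensZr scalerA.
have xE : x = scmx H B *m w *m scmx H B' *m scmx H B.
  by rewrite -[RHS]mulmxA -scmxM B'B scmx1 mulmx1.
have yE : scmx H B *m y = scmx H B *m w *m scmx H B' by rewrite mulmxA.
rewrite {1}xE.
under eq_bigr do rewrite mulmx_sc tens_suml.
rewrite exchange_big; apply: eq_bigr => k _ /=.
have -> : (scmx H B *m w *m scmx H B') k j = (scmx H B *m y) k j by rewrite yE.
rewrite mulsc_mx tens_sumr; apply: eq_bigr => r _.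
by rewrite tensZl tensZr.
Qed.

End Coreps.

(** * Unitarity *)

Section PositiveDefinite.
Variable R : realType.
Local Notation C := R[i].

Definition posdef n (G : 'M[C]_n) : Prop :=
  G ^t* = G /\ forall x : 'cV[C]_n, x != 0 -> 0 < (x ^t* *m G *m x) 0 0.

(** Spectral theorem: if G = U^* D U with D positive diagonal, then B is the product of the square
    root of D with U. *)
Lemma posdef_factor n (G : 'M[C]_n) : posdef G ->
  exists B B' : 'M[C]_n, B *m B' = 1%:M /\ G = B ^t* *m B.
Proof.
move=> [hG pG].
have nG : G \is normalmx by apply/normalmxP; rewrite hG.
have uU := spectral_unitarymx G; have := orthomx_spectralP nG.
set U := spectralmx G; set D := spectral_diag G; rewrite invmx_unitary// => eG.
have UU : U *m U ^t* = 1%:M by apply/unitarymxP.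
have Dpos i : 0 < D 0 i.
  have := pG (U ^t* *m delta_mx i 0).
  rewrite eG trmx_mul map_mxM trmxCK !mulmxA.
  rewrite -[_ *m U *m U ^t*]mulmxA UU mulmx1.
  rewrite -[_ *m U *m U ^t*]mulmxA UU mulmx1.
  have -> : ((delta_mx i 0 : 'cV[C]_n) ^t* *m diag_mx D *m delta_mx i (0 : 'I_1)) 0 0 = D 0 i.
    rewrite -colE mxE mxE (bigD1 i)//= big1 ?addr0.
      by rewrite !mxE !eqxx conjC1 mul1r mulr1n.
    by move=> j ne; rewrite !mxE (negPf ne) conjC0 mul0r.
  apply; apply/eqP => /(congr1 (mulmx U)); rewrite mulmxA UU mul1mx mulmx0.
  by move=> /colP /(_ i); rewrite !mxE !eqxx => /eqP; rewrite oner_eq0.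
pose E : 'rV[C]_n := \row_i sqrtC (D 0 i).
pose E' : 'rV[C]_n := \row_i (sqrtC (D 0 i))^-1.
exists (diag_mx E *m U), (U ^t* *m diag_mx E'); split.
  rewrite mulmxA -[_ *m U *m _]mulmxA UU mulmx1 mulmx_diag -diag_const_mx.
  congr diag_mx; apply/rowP => i; rewrite !mxE divff// sqrtC_eq0.
  by rewrite gt_eqF.
rewrite {1}eG trmx_mul map_mxM !mulmxA; congr (_ *m _); rewrite -!mulmxA; congr (_ *m _).
rewrite tr_diag_mx map_diag_mx mulmx_diag; congr diag_mx; apply/rowP => i.
rewrite !mxE; have /ltW h := Dpos i.
have e : Num.conj (sqrtC (D 0 i)) = sqrtC (D 0 i) by apply: geC0_conj; rewrite sqrtC_ge0.
by rewrite -[LHS]sqrtCK expr2 -{1}e.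
Qed.

End PositiveDefinite.

(** * Comodules and invariant inner products in coordinates *)

Section ComoduleMatrix.
Variables (R : realType) (H : hopf_star_algebra R).
Local Notation C := R[i].

Lemma tensor_basis (V : vectType C) n (b : n.-tuple V) (t : V ⊗ H) :
  basis_of fullv b ->
  t = \sum_i tens (tnth b i) (contractl (coord b i : {scalar V}) t).
Proof.
move=> hb; elim/tens_ind: t => [|x y hx hy|v h].
- by rewrite big1// => i _; rewrite linear0 tens0r.
- rewrite {1}hx {1}hy -big_split; apply: eq_bigr => i _ /=.
  by rewrite -tensDr linearD.
under eq_bigr do rewrite contractl_tens tensZr -tensZl.
rewrite -tens_suml {1}(coord_basis hb (memvf v)); congr (tens _ _).
by apply: eq_bigr => i _; rewrite (tnth_nth 0).
Qed.

Lemma coord_tnth (V : vectType C) n (b : n.-tuple V) i j : basis_of fullv b ->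
  coord b i (tnth b j) = (i == j)%:R.
Proof. by move=> hb; rewrite (tnth_nth 0) coord_free ?(basis_free hb)// eq_sym. Qed.

Lemma contractl_coord (V : vectType C) n (b : n.-tuple V) (h : 'I_n -> H) i :
  basis_of fullv b ->
  contractl (coord b i : {scalar V}) (\sum_j tens (tnth b j) (h j)) = h i.
Proof.
move=> hb; rewrite raddf_sum (bigD1 i)//= contractl_tens big1 ?addr0.
  by rewrite /= coord_tnth// eqxx scale1r.
move=> j ne; rewrite contractl_tens /= coord_tnth//.
by rewrite eq_sym (negPf ne) scale0r.
Qed.

Definition comodule_matrix (V : vectType C) (rho : comodule H V) n
  (b : n.-tuple V) (w : 'M[H]_n) : Prop :=
  forall j, rho (tnth b j) = \sum_i tens (tnth b i) (w i j).

Lemma tensor_basis_inj (V : vectType C) n (b : n.-tuple V) (h h' : 'I_n -> H) :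
  basis_of fullv b ->
  \sum_j tens (tnth b j) (h j) = \sum_j tens (tnth b j) (h' j) -> forall i, h i = h' i.
Proof.
by move=> hb e i; rewrite -(contractl_coord h i hb) e contractl_coord.
Qed.

Lemma comodule_corep (V : vectType C) (rho : comodule H V) n (b : n.-tuple V) :
  basis_of fullv b -> exists2 w : 'M[H]_n, corep w & comodule_matrix rho b w.
Proof.
move=> hb; pose w : 'M[H]_n := \matrix_(i, j)
  contractl (coord b i : {scalar V}) (rho (tnth b j)).
have cw : comodule_matrix rho b w.
  by move=> j; rewrite {1}(tensor_basis (rho _) hb); apply: eq_bigr => i _; rewrite mxE.
exists w => //; split=> i j.
  have := coaction_coassoc rho (tnth b j).
  rewrite cw !linear_sum /= (big_morph _ (@tassocD _ V H H) (@tassoc0 _ V H H)).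
  under eq_bigr do rewrite tmap_tens /= cw tens_suml
    (big_morph _ (@tassocD _ V H H) (@tassoc0 _ V H H)).
  rewrite exchange_big /=.
  under eq_bigr => l _ do under eq_bigr do rewrite tassoc_tens.
  under eq_bigr do rewrite -tens_sumr.
  under [RHS]eq_bigr do rewrite tmap_tens /=.
  move=> /(congr1 (contractl (coord b i : {scalar V}))).
  have cc (g : 'I_n -> H ⊗ H) : contractl (coord b i : {scalar V})
      (\sum_j tens (tnth b j) (g j)) = g i.
    rewrite raddf_sum (bigD1 i)//= contractl_tens big1 ?addr0.
      by rewrite /= coord_tnth// eqxx scale1r.
    move=> k ne; rewrite contractl_tens /= coord_tnth//.
    by rewrite eq_sym (negPf ne) scale0r.
  by rewrite !cc.
have := coaction_counit rho (tnth b j).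
rewrite cw tsum_sum; last exact: contractr_balanced.
under eq_bigr do rewrite (tsum_tens _ _ (contractr_balanced _ counit)).
move=> /(congr1 (coord b i)); rewrite raddf_sum (bigD1 i)//= scalarZ /=.
rewrite !coord_tnth// eqxx mulr1 big1 ?addr0//.
move=> k ne; rewrite scalarZ /= coord_tnth//.
by rewrite eq_sym (negPf ne) mulr0.
Qed.

Lemma comodule_matrixE (V : vectType C) (rho : comodule H V) n (b : n.-tuple V)
  (w : 'M[H]_n) (x : 'cV[C]_n) : comodule_matrix rho b w ->
  rho (\sum_j x j 0 *: tnth b j) = \sum_i tens (tnth b i) ((w *m scmx H x) i 0).
Proof.
move=> cw; rewrite linear_sum.
under eq_bigr do rewrite linearZ /= cw scaler_sumr.
rewrite exchange_big; apply: eq_bigr => i _ /=.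
by rewrite mulmx_sc tens_sumr; apply: eq_bigr => j _; rewrite tensZr.
Qed.

(** The unitarizability identity for the inner product with Gram matrix [G]. For the identity matrix
    it is unitarity of [w]. *)
Definition invariant_gram n (w : 'M[H]_n) (G : 'M[C]_n) : Prop :=
  adj w *m scmx H G = scmx H G *m map_mx antipode w.

Lemma ip_star_balanced (V : vectType C) (ip : V -> V -> C) w : inner_product ip ->
  balanced (fun (v0 : V) (v1 : H) => ip v0 w *: star v1).
Proof.
move=> [h1 h2 _].
have D x y : ip (x + y) w = ip x w + ip y w.
  by rewrite h2 -[x]scale1r h1 mul1r scale1r rmorphD /= -!h2.
have Z a x : ip (a *: x) w = conjc a * ip x w.
  rewrite h2 -[_ *: _]addr0 h1 rmorphD rmorphM /= -h2.
  suff -> : ip w 0 = 0 by rewrite rmorph0 addr0.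
  by apply: (addrI (ip w 0)); rewrite addr0 -{1}[ip w 0]mul1r -h1 scale1r addr0.
split=> [v1 x y|u x y|a u v1].
- by rewrite D scalerDl.
- by rewrite starD scalerDr.
- by rewrite Z starZ scalerA mulrC.
Qed.

Lemma ip_antipode_balanced (V : vectType C) (ip : V -> V -> C) v : inner_product ip ->
  balanced (fun (v0 : V) (v1 : H) => ip v v0 *: antipode v1).
Proof.
move=> [h1 h2 _].
have D x y : ip v (x + y) = ip v x + ip v y.
  by rewrite -[x]scale1r h1 mul1r scale1r.
have Z a x : ip v (a *: x) = a * ip v x.
  rewrite -[_ *: _]addr0 h1.
  suff -> : ip v 0 = 0 by rewrite addr0.
  by apply: (addrI (ip v 0)); rewrite addr0 -{1}[ip v 0]mul1r -h1 scale1r addr0.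
split=> [v1 x y|u x y|a u v1].
- by rewrite D scalerDl.
- by rewrite linearD scalerDr.
- by rewrite Z linearZ /= scalerA mulrC.
Qed.

Lemma inner_product_suml (V : vectType C) (ip : V -> V -> C) n (x : 'I_n -> C)
  (b : 'I_n -> V) v : inner_product ip ->
  ip v (\sum_j x j *: b j) = \sum_j x j * ip v (b j).
Proof.
move=> [h1 _ _].
have ip0 : ip v 0 = 0.
  by apply: (addrI (ip v 0)); rewrite addr0 -{1}[ip v 0]mul1r -h1 scale1r addr0.
by elim/big_rec2: _ => // i y z _ <-; rewrite h1.
Qed.

Lemma unitarizable_gram (V : vectType C) (rho : comodule H V) n (b : n.-tuple V)
  (w : 'M[H]_n) : basis_of fullv b -> comodule_matrix rho b w ->
  unitarizable rho -> exists2 G, posdef G & invariant_gram w G.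
Proof.
move=> hb cw [ip ipP inv]; have [h1 h2 h3] := ipP.
pose G : 'M[C]_n := \matrix_(i, j) ip (tnth b i) (tnth b j).
exists G.
  split; first by apply/matrixP => i j; rewrite !mxE [RHS]h2.
  move=> x x0; pose v := \sum_j x j 0 *: tnth b j.
  have -> : (x ^t* *m G *m x) 0 0 = ip v v.
    rewrite -mulmxA /v inner_product_suml// mxE.
    under [RHS]eq_bigr do rewrite h2 inner_product_suml// rmorph_sum mulr_sumr.
    rewrite exchange_big; apply: eq_bigr => i _ /=.
    rewrite !mxE mulr_sumr; apply: eq_bigr => j _ /=.
    by rewrite !mxE rmorphM /= -h2 [RHS]mulrC mulrA.
  apply: h3; apply: contra x0 => /eqP v0; apply/eqP/colP => i; rewrite mxE.
  have /freeP fr := basis_free hb; apply: (fr (fun j => x j 0)).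
  by rewrite -[RHS]v0; apply: eq_bigr => j _; rewrite (tnth_nth 0).
apply/matrixP => p q; have := inv (tnth b p) (tnth b q).
rewrite !cw !tsum_sum; [|exact: ip_antipode_balanced|exact: ip_star_balanced].
under eq_bigr do rewrite (tsum_tens _ _ (ip_star_balanced _ ipP)).
under [RHS]eq_bigr do rewrite (tsum_tens _ _ (ip_antipode_balanced _ ipP)).
move=> e; rewrite mulmx_sc mulsc_mx.
under eq_bigr do rewrite !mxE; under [RHS]eq_bigr do rewrite !mxE.
exact: e.
Qed.

(** The converse passage: to unitarize a comodule it is enough to exhibit a positive matrix, which
    is how comodules of a quotient are treated later. *)
Lemma gram_unitarizable (V : vectType C) (rho : comodule H V) n (b : n.-tuple V)
  (w : 'M[H]_n) (G : 'M[C]_n) : basis_of fullv b -> comodule_matrix rho b w ->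
  posdef G -> invariant_gram w G -> unitarizable rho.
Proof.
move=> hb cw [hG pG] inv.
pose co v : 'cV[C]_n := \col_i coord b i v.
have coE v : v = \sum_j co v j 0 *: tnth b j.
  rewrite {1}(coord_basis hb (memvf v)); apply: eq_bigr => i _.
  by rewrite mxE (tnth_nth 0).
have col a x y : co (a *: x + y) = a *: co x + co y.
  by apply/colP => i; rewrite !mxE linearP.
have cob j : co (tnth b j) = delta_mx j 0.
  apply/colP => i; rewrite !mxE coord_tnth//.
  by rewrite andbT eq_sym.
pose ip v w := ((co v) ^t* *m G *m co w) 0 0.
have ipP : inner_product ip.
  split=> [v a x y|v z|v v0].
  - by rewrite /ip col mulmxDr -scalemxAr !mxE.
  - rewrite /ip -[conjc _]/(Num.conj _).
    transitivity ((((co v) ^t* *m G *m co z) ^t*) 0 0); last by rewrite !mxE.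
    by rewrite !trmx_mul !map_mxM trmxCK hG mulmxA.
  - apply: pG; apply: contra v0 => /eqP co0; rewrite (coE v) co0.
    by rewrite big1// => j _; rewrite mxE scale0r.
exists ip => // v z.
rewrite [in rho v](coE v) [in rho z](coE z) !(comodule_matrixE _ cw).
rewrite !tsum_sum; [|exact: ip_antipode_balanced|exact: ip_star_balanced].
under eq_bigr do rewrite (tsum_tens _ _ (ip_star_balanced _ ipP)).
under [RHS]eq_bigr do rewrite (tsum_tens _ _ (ip_antipode_balanced _ ipP)).
transitivity ((adj (w *m scmx H (co v)) *m scmx H (G *m co z)) 0 0).
  rewrite mulmx_sc; apply: eq_bigr => i _; rewrite !mxE; congr (_ *: _).
  rewrite /ip cob; rewrite -mulmxA mxE (bigD1 i)//= big1 ?addr0.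
    by rewrite !mxE eqxx conjC1 mul1r.
  by move=> j ne; rewrite !mxE (negPf ne) conjC0 mul0r.
rewrite adjM scmxM mulmxA -[adj _ *m _ *m _]mulmxA inv adj_scmx mulmxA -scmxM.
rewrite -mulmxA mulsc_mx; apply: eq_bigr => i _.
rewrite /ip cob -colE [in RHS]mxE; congr (_ *: _).
have := map_lin_sc antipode 1%:M w (co z).
by rewrite scmx1 !mul1mx => /matrixP/(_ i 0); rewrite mxE => <-.
Qed.

End ComoduleMatrix.

Section CorepComodule.
Variables (R : realType) (H : hopf_star_algebra R) (n : nat) (w : 'M[H]_n).
Hypothesis cw : corep w.
Local Notation C := R[i].
Local Notation V := 'cV[C]_n.

(** Corepresentation matrices are realised as comodules on column vectors so that the
    unitarizability of a CQG algebra, stated for comodules, applies to them. *)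
Definition corep_coaction (v : V) : V ⊗ H :=
  \sum_i tens (delta_mx i 0) ((w *m scmx H v) i 0).

Lemma corep_coaction_linear : linear corep_coaction.
Proof.
move=> a x y; rewrite /corep_coaction scaler_sumr -big_split; apply: eq_bigr => i _ /=.
rewrite -tensZr -tensDr; congr (tens _ _); rewrite !mulmx_sc scaler_sumr -big_split.
by apply: eq_bigr => j _ /=; rewrite !mxE scalerDl scalerA.
Qed.
HB.instance Definition _ := GRing.isLinear.Build C V (V ⊗ H) _ corep_coaction
  corep_coaction_linear.

Lemma corep_coaction_delta j :
  corep_coaction (delta_mx j 0) = \sum_i tens (delta_mx i 0) (w i j).
Proof.
apply: eq_bigr => i _; congr (tens _ _); rewrite mulmx_sc (bigD1 j)//= big1.
  by rewrite mxE !eqxx scale1r addr0.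
by move=> k ne; rewrite mxE (negPf ne) scale0r.
Qed.

Lemma linear_delta_ext (W : lmodType C) (f g : {linear V -> W}) :
  (forall j, f (delta_mx j 0) = g (delta_mx j 0)) -> f =1 g.
Proof.
move=> e v; rewrite (matrix_sum_delta v).
under eq_bigr do rewrite big_ord1.
by rewrite !raddf_sum; apply: eq_bigr => i _ /=; rewrite !linearZ /= e.
Qed.

Lemma corep_coaction_counit v :
  tsum (fun v0 (v1 : H) => counit v1 *: v0) (corep_coaction v) = v.
Proof.
apply: (@linear_delta_ext _ (contractr counit \o corep_coaction) idfun) => j /=.
rewrite corep_coaction_delta linear_sum (bigD1 j)//= contractr_tens.
rewrite cw.2 eqxx scale1r big1 ?addr0// => i ne.
by rewrite contractr_tens cw.2 (negPf ne) scale0r.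
Qed.

Lemma tassoc_linear (U V W : lmodType C) : linear (@tassoc C U V W).
Proof.
move=> a x y; rewrite tassocD /tassoc tsumZ//; first exact: tassoc_balanced.
move=> b u v; rewrite (tsumZ _ _ (@tassoc_inner_balanced _ _ _ _ v))//.
by move=> c u' w'; rewrite tensZl.
Qed.

Lemma corep_coaction_coassoc v :
  tassoc (tmap corep_coaction idfun (corep_coaction v)) =
  tmap idfun comul (corep_coaction v).
Proof.
apply: (@linear_delta_ext _
  (mk_linear (@tassoc_linear V H H) \o tmap corep_coaction idfun \o corep_coaction)
  (tmap idfun comul \o corep_coaction)) => j /=.
rewrite corep_coaction_delta !linear_sum /=.
rewrite (big_morph _ (@tassocD _ V H H) (@tassoc0 _ V H H)).
under eq_bigr do rewrite tmap_tens /= corep_coaction_delta tens_suml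
    (big_morph _ (@tassocD _ V H H) (@tassoc0 _ V H H)).
rewrite exchange_big; apply: eq_bigr => i _ /=.
under eq_bigr do rewrite tassoc_tens.
by rewrite tmap_tens /= cw.1 tens_sumr.
Qed.

Definition corep_comodule : comodule H V :=
  Comodule corep_coaction_counit corep_coaction_coassoc.

End CorepComodule.

(** * Orthogonal complements in finite dimension *)

Section Orthogonality.
Variable R : realType.
Local Notation C := R[i].

(** A subspace of maximal dimension among those inside [N] exhausts it: any further vector of [N]
    would enlarge it. *)
Lemma submodule_vspace (V : vectType C) (N : set V) : submodule N ->
  exists U : {vspace V}, forall v, v \in U <-> N v.
Proof.
move=> sN.
pose P k := `[< exists2 U : {vspace V}, (forall v, v \in U -> N v) & \dim U = k >].
have exP : exists k, P k.
  exists 0%N; apply/asboolP; exists 0%VS; last exact: dimv0.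
  by move=> v; rewrite memv0 => /eqP ->; case: sN.
have leP k : P k -> (k <= \dim {:V})%N.
  by move=> /asboolP [U _ <-]; apply: dimvS; exact: subvf.
case: (ex_maxnP exP leP) => k /asboolP [U UN dU] max.
exists U => v; split; first exact: UN.
move=> Nv; have /max : P (\dim (U + <[v]>)%VS).
  apply/asboolP; exists (U + <[v]>)%VS => // x /memv_addP [y yU [z /vlineP [c ->] ->]].
  by rewrite addrC; case: (sN) => _; apply => //; exact: UN.
rewrite -dU => le; have : (U == U + <[v]>)%VS by rewrite eqEdim addvSl le.
by move=> /eqP ->; rewrite (subvP (addvSr _ _))// memv_line.
Qed.

Lemma inner_product0 (V : vectType C) (ip : V -> V -> C) v :
  inner_product ip -> ip v 0 = 0.
Proof.
move=> [h1 _ _].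
by apply: (addrI (ip v 0)); rewrite addr0 -{1}[ip v 0]mul1r -h1 scale1r addr0.
Qed.

(** The vectors orthogonal to a basis of N form a kernel of codimension at most dim N, which meets N
    trivially by positivity; a dimension count finishes. *)
Lemma orthogonal_decomposition (V : vectType C) (ip : V -> V -> C) (N : set V) (x : V) :
  inner_product ip -> submodule N ->
  exists y z, [/\ N y, forall t, N t -> ip t z = 0 & x = y + z].
Proof.
move=> ipP sN; have [U UN] := submodule_vspace sN; have [h1 h2 h3] := ipP.
pose k := \dim U; pose u := vbasis U.
pose F v : 'cV[C]_k := \col_i ip (tnth u i) v.
have Flin : linear F by move=> a y z; apply/colP => i; rewrite !mxE h1.
pose f := linfun (mk_linear Flin).
have fE v : f v = F v by rewrite lfunE.
have kerP v : v \in lker f -> forall t, N t -> ip t v = 0.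
  rewrite memv_ker fE => /eqP Fv t /UN tU.
  rewrite h2 (coord_vbasis tU) inner_product_suml// big1 ?conjc0// => i _.
  have /colP/(_ i) := Fv; rewrite !mxE -tnth_nth => e.
  by rewrite h2 e conjc0 mulr0.
have disj : (U :&: lker f = 0)%VS.
  apply/eqP; rewrite -subv0; apply/subvP => v; rewrite memv_cap => /andP [vU vk].
  rewrite memv0; apply/negPn/negP => v0.
  by have := h3 v v0; rewrite (kerP v vk) ?ltxx//; exact/UN.
have full : (U + lker f)%VS = fullv.
  apply/eqP; rewrite eqEdim subvf dimv_disjoint_sum//.
  rewrite -(limg_ker_dim f {:V}) capfv addnC leq_add2r.
  apply: leq_trans (dimvS (subvf _)) _.
  by rewrite dimvf /dim /= muln1.
have : x \in (U + lker f)%VS by rewrite full memvf.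
move=> /memv_addP [y yU [z zk ->]]; exists y, z; split=> //; first exact/UN.
exact: kerP.
Qed.

(** The Hilbert-Schmidt inner product, conjugate-linear on the left; on single columns it is the
    standard one. *)
Definition hs m n (A B : 'M[C]_(m, n)) : C := \tr (A ^t* *m B).

Lemma hsE m n (A B : 'M[C]_(m, n)) :
  hs A B = \sum_j \sum_i Num.conj (A i j) * B i j.
Proof.
apply: eq_bigr => j _; rewrite mxE; apply: eq_bigr => i _.
by rewrite !mxE.
Qed.

Lemma hs_inner_product m n : inner_product (@hs m n).
Proof.
split=> [A a B D|A B|A A0].
- by rewrite /hs mulmxDr -scalemxAr mxtraceD mxtraceZ.
- rewrite !hsE -[conjc _]/(Num.conj _) rmorph_sum; apply: eq_bigr => j _.
  rewrite rmorph_sum; apply: eq_bigr => i _ /=.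
  by rewrite rmorphM [RHS]mulrC; congr (_ * _); exact/esym/conjCK.
- have ge0 j : 0 <= \sum_i Num.conj (A i j) * A i j.
    by apply: sumr_ge0 => i _; rewrite mulrC mul_conjC_ge0.
  rewrite lt_def hsE; apply/andP; split; last by apply: sumr_ge0 => j _.
  apply: contra A0 => /eqP/psumr_eq0P h; apply/eqP/matrixP => i j.
  have /psumr_eq0P h' := h (fun j _ => ge0 j) j isT; apply/eqP; rewrite mxE.
  rewrite -mul_conjC_eq0 mulrC; apply/eqP; apply: (h' _ i isT) => k _.
  by rewrite mulrC mul_conjC_ge0.
Qed.

End Orthogonality.

(** * Unitary corepresentations of a CQG algebra *)

Section Unitarization.
Variable R : realType.
Local Notation C := R[i].

(** Passage to an orthonormal basis: with G = B^* B, conjugation by B turns the invariance of G into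
    unitarity. *)
Lemma invariant_gram_ucorep (H : hopf_star_algebra R) n (w : 'M[H]_n) (G : 'M[C]_n) :
  corep w -> posdef G -> invariant_gram w G ->
  exists B B' : 'M[C]_n, [/\ B *m B' = 1%:M, G = B ^t* *m B &
    ucorep (scmx H B *m w *m scmx H B')].
Proof.
move=> cw pG inv; have [B [B' [BB' eG]]] := posdef_factor pG.
exists B, B'; split=> //.
have B'B := mulmx1C BB'.
have B's : scmx H (B' ^t*) *m scmx H (B ^t*) = 1%:M.
  by rewrite -scmxM -map_mxM -trmx_mul BB' trmx1 map_mx1 scmx1.
split; first exact: corep_conj.
suff : map_mx antipode (scmx H B *m w *m scmx H B') =
    adj (scmx H B *m w *m scmx H B').
  by move=> /matrixP e i j; have := e i j; rewrite !mxE.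
rewrite map_lin_sc !adjM !adj_scmx.
transitivity (scmx H (B'^t*) *m (scmx H G *m map_mx antipode w) *m scmx H B').
  rewrite eG scmxM !mulmxA B's mul1mx//.
by rewrite -inv eG scmxM !mulmxA -[_ *m scmx H B *m _]mulmxA -scmxM BB' scmx1 mulmx1.
Qed.

Definition delta_basis n : n.-tuple 'cV[C]_n := [tuple delta_mx i 0 | i < n].

Lemma delta_basisP n : basis_of fullv (delta_basis n).
Proof.
have fr : free (delta_basis n).
  apply/freeP => c h i; move: h.
  have e (k : 'I_n) : (delta_basis n)`_k = delta_mx k 0.
    by rewrite -tnth_nth tnth_mktuple.
  under eq_bigr do rewrite e.
  move=> /colP/(_ i); rewrite mxE summxE (bigD1 i)//= !mxE !eqxx mulr1 big1 ?addr0//.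
  by move=> j ne; rewrite !mxE eq_sym (negPf ne) mulr0.
by rewrite basisEfree fr subvf size_tuple dimvf /dim /= muln1 leqnn.
Qed.

Lemma cqg_ucorep (H : cqg_algebra R) n (w : 'M[H]_n) : corep w ->
  exists B B' : 'M[C]_n, B *m B' = 1%:M /\ ucorep (scmx H B *m w *m scmx H B').
Proof.
move=> cw; have mw : comodule_matrix (corep_comodule cw) (delta_basis n) w.
  move=> j; rewrite /= tnth_mktuple corep_coaction_delta.
  by apply: eq_bigr => i _; rewrite tnth_mktuple.
have [G pG inv] := unitarizable_gram (delta_basisP n) mw (cqg_unitarizable _).
by have [B [B' [? _ ?]]] := invariant_gram_ucorep cw pG inv; exists B, B'.
Qed.

(** The functionals [f i] record that all entries of the column w eta lie in every left coideal
    containing x. This transports a property of x, such as membership in A(P), to the whole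
    column. *)
Lemma ucorep_coefficient (H : cqg_algebra R) (x : H) :
  exists n (w : 'M[H]_n) (xi : 'rV[C]_n) (eta : 'cV[C]_n) (f : 'I_n -> {scalar H}),
  [/\ ucorep w, forall i, (w *m scmx H eta) i 0 = lact (f i) x
    & x = (scmx H xi *m w *m scmx H eta) 0 0].
Proof.
have [n [w [b [xi [f [cw bf be xE]]]]]] := corep_coefficient x.
have [B [B' [BB' uw]]] := cqg_ucorep cw; have B'B := mulmx1C BB'.
have lin i : scalar (fun x : H => \sum_k B i k * f k x).
  move=> a y z; rewrite mulr_sumr -big_split; apply: eq_bigr => k _ /=.
  by rewrite linearP mulrDr mulrCA.
exists n, (scmx H B *m w *m scmx H B'), (xi *m B'), (B *m map_mx counit b),
  (fun i => mk_scalar (lin i)).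
have e : scmx H B *m w *m scmx H B' *m scmx H (B *m map_mx counit b) = scmx H B *m b.
  by rewrite -!mulmxA -scmxM [B' *m _]mulmxA B'B mul1mx -be.
split=> // [i|].
  rewrite e mulsc_mx /lact; under eq_bigr do rewrite bf /lact.
  elim/tens_ind: (comul x) => [|y z hy hz|y z].
  - by rewrite linear0 big1// => k _; rewrite linear0 scaler0.
  - rewrite linearD /= -hy -hz -big_split; apply: eq_bigr => k _ /=.
    by rewrite linearD scalerDr.
  - rewrite contractl_tens /= scaler_suml; apply: eq_bigr => k _.
    by rewrite contractl_tens scalerA.
by rewrite -mulmxA e mulmxA -scmxM -mulmxA B'B mulmx1.
Qed.

End Unitarization.

(** * Spanning by unitary coefficients implies unitarizability *)

Section Coefficients.
Variables (R : realType) (H : hopf_star_algebra R).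
Local Notation C := R[i].

Definition coef n (w : 'M[H]_n) (X : 'M[C]_n) : H := \sum_i \sum_j X i j *: w i j.

Lemma coef_linear n (w : 'M[H]_n) : linear (coef w).
Proof.
move=> a X Y; rewrite /coef scaler_sumr -big_split; apply: eq_bigr => i _ /=.
rewrite scaler_sumr -big_split; apply: eq_bigr => j _ /=.
by rewrite !mxE scalerDl scalerA.
Qed.
HB.instance Definition _ n w := GRing.isLinear.Build C 'M[C]_n H _ (coef w)
  (@coef_linear n w).

Lemma coef_delta n (w : 'M[H]_n) i j : coef w (delta_mx i j) = w i j.
Proof.
rewrite /coef (bigD1 i)//= (bigD1 j)//= mxE !eqxx scale1r !big1 ?addr0//.
  by move=> k ne; rewrite big1// => l _; rewrite mxE (negPf ne) scale0r.
by move=> k ne; rewrite mxE (negPf ne) andbF scale0r.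
Qed.

Lemma ract_coef f n (w : 'M[H]_n) X : corep w ->
  ract f (coef w X) = coef w (X *m (map_mx f w)^T).
Proof.
move=> cw; rewrite /coef raddf_sum; apply: eq_bigr => i _ /=.
rewrite raddf_sum /=; under eq_bigr do rewrite linearZ /= ract_corep// scaler_sumr.
rewrite exchange_big; apply: eq_bigr => k _ /=.
rewrite !mxE scaler_suml; apply: eq_bigr => j _.
by rewrite !mxE scalerA.
Qed.

Lemma coef_row_col n (w : 'M[H]_n) (xi : 'rV[C]_n) (eta : 'cV[C]_n) :
  (scmx H xi *m w *m scmx H eta) 0 0 = coef w (xi^T *m eta^T).
Proof.
rewrite -[LHS]/(idfun _) linear_sc /coef; apply: eq_bigr => i _; apply: eq_bigr => j _ /=.
by rewrite !mxE big_ord1 !mxE.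
Qed.

Lemma corep_dsum n m (w : 'M[H]_n) (z : 'M[H]_m) :
  ucorep w -> ucorep z -> ucorep (block_mx w 0 0 z).
Proof.
move=> [[cw ew] aw] [[cz ez] az].
have urE i j : block_mx w 0 0 z (lshift m i) (rshift n j) = 0.
  by rewrite block_mxEur mxE.
have dlE i j : block_mx w 0 0 z (rshift n i) (lshift m j) = 0.
  by rewrite block_mxEdl mxE.
split; first split.
- move=> i j; rewrite big_split_ord /=.
  case: (split_ordP i) => {}i ->; case: (split_ordP j) => {}j ->.
  + rewrite block_mxEul cw [X in _ = _ + X]big1 ?addr0.
      by apply: eq_bigr => k _; rewrite !block_mxEul.
    by move=> k _; rewrite urE tens0l.
  + rewrite urE linear0 !big1 ?addr0// => k _.
      by rewrite urE tens0l.
    by rewrite urE tens0r.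
  + rewrite dlE linear0 !big1 ?addr0// => k _.
      by rewrite dlE tens0r.
    by rewrite dlE tens0l.
  + rewrite block_mxEdr cz [X in _ = X + _]big1 ?add0r.
      by apply: eq_bigr => k _; rewrite !block_mxEdr.
    by move=> k _; rewrite dlE tens0l.
- move=> i j.
  case: (split_ordP i) => {}i ->; case: (split_ordP j) => {}j ->.
  + by rewrite block_mxEul ew eq_lshift.
  + by rewrite urE linear0 eq_lrshift.
  + by rewrite dlE linear0 eq_rlshift.
  + by rewrite block_mxEdr ez eq_rshift.
- move=> i j.
  case: (split_ordP i) => {}i ->; case: (split_ordP j) => {}j ->.
  + by rewrite !block_mxEul aw.
  + by rewrite urE dlE linear0 raddf0.
  + by rewrite urE dlE linear0 raddf0.
  + by rewrite !block_mxEdr az.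
Qed.

Lemma coef_dsuml n m (w : 'M[H]_n) (z : 'M[H]_m) X :
  coef (block_mx w 0 0 z) (block_mx X 0 0 0) = coef w X.
Proof.
rewrite /coef big_split_ord /= [X in _ + X]big1 ?addr0; last first.
  move=> i _; rewrite big1// => j _.
  case: (split_ordP j) => {}j ->; rewrite ?block_mxEdl ?block_mxEdr !mxE scale0r//.
apply: eq_bigr => i _; rewrite big_split_ord /= [X in _ + X]big1 ?addr0.
  by apply: eq_bigr => j _; rewrite !block_mxEul.
by move=> j _; rewrite block_mxEur !mxE scale0r.
Qed.

Lemma coef_dsumr n m (w : 'M[H]_n) (z : 'M[H]_m) X :
  coef (block_mx w 0 0 z) (block_mx 0 0 0 X) = coef z X.
Proof.
rewrite /coef big_split_ord /= [X in X + _]big1 ?add0r; last first.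
  move=> i _; rewrite big1// => j _.
  case: (split_ordP j) => {}j ->; rewrite ?block_mxEul ?block_mxEur !mxE scale0r//.
apply: eq_bigr => i _; rewrite big_split_ord /= [X in X + _]big1 ?add0r.
  by apply: eq_bigr => j _; rewrite !block_mxEdr.
by move=> j _; rewrite block_mxEdl !mxE scale0r.
Qed.

(** Equivalent to the CQG condition, by [cqg_spanned] and [unitarily_spanned_unitarizable], but
    inherited by quotients simply by mapping the matrices w. *)
Definition unitarily_spanned : Prop :=
  forall x : H, exists n (w : 'M[H]_n) X, ucorep w /\ x = coef w X.

Lemma common_ucorep (s : seq H) : unitarily_spanned ->
  exists n (w : 'M[H]_n), ucorep w /\ forall x, x \in s -> exists X, x = coef w X.
Proof.
move=> sp; elim: s => [|x s [n [w [uw ws]]]].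
  have [n [w [X [uw _]]]] := sp 0; exists n, w; by split.
have [m [z [X [uz ->]]]] := sp x.
exists (m + n)%N, (block_mx z 0 0 w); split; first exact: corep_dsum.
move=> y; rewrite inE => /orP [/eqP ->|/ws [Y ->]].
  by exists (block_mx X 0 0 0); rewrite coef_dsuml.
by exists (block_mx 0 0 0 Y); rewrite coef_dsumr.
Qed.

(* The functional whose matrix on a unitary corepresentation is the adjoint. *)
Lemma star_functional_scalar (f : {scalar H}) :
  scalar (fun x => Num.conj (f (star (antipode x)))).
Proof.
move=> a x y; rewrite linearP starD starZ linearP rmorphD rmorphM /=.
by congr (_ * _ + _); exact: conjCK.
Qed.
Definition star_functional f : {scalar H} := mk_scalar (star_functional_scalar f).

Lemma star_functionalE f n (w : 'M[H]_n) : ucorep w ->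
  map_mx (star_functional f) w = (map_mx f w) ^t*.
Proof.
by move=> [_ aw]; apply/matrixP => i j; rewrite !mxE /= aw starK.
Qed.

(* The orthogonal complement of the relations among the coefficients of a unitary
   corepresentation is a subcomodule isomorphic to the coefficient space. *)
Definition coef_normal n (w : 'M[H]_n) (X : 'M[C]_n) : Prop :=
  forall Y, coef w Y = 0 -> hs Y X = 0.

Lemma coef_normal_eq n (w : 'M[H]_n) X Y : coef_normal w X -> coef_normal w Y ->
  coef w X = coef w Y -> X = Y.
Proof.
move=> nX nY e; apply/eqP; rewrite -subr_eq0; apply/negPn/negP => ne.
have := (hs_inner_product R n n) => -[h1 _ /(_ _ ne)].
have Z : coef w (X - Y) = 0 by rewrite linearB /= e subrr.
have -> : hs (X - Y) (X - Y) = 0.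
  have e2 : X - Y = -1 *: Y + X by rewrite scaleN1r addrC.
  by rewrite {2}e2 h1 nX// nY// mulr0 addr0.
by rewrite ltxx.
Qed.

(** By unitarity the operators through which functionals act on coefficient matrices form a family
    closed under adjoints; hence the orthogonal complement of a stable subspace is stable. *)
Lemma hs_functional_adjoint (f : {scalar H}) n (w : 'M[H]_n) (X Y : 'M[C]_n) : ucorep w ->
  hs Y (X *m (map_mx f w)^T) = hs (Y *m (map_mx (star_functional f) w)^T) X.
Proof.
move=> uw; rewrite star_functionalE// /hs.
rewrite mulmxA mxtrace_mulC mulmxA; congr (\tr (_ *m _)).
rewrite trmx_mul map_mxM trmxK; congr (_ *m _).
by apply/matrixP => i j; rewrite !mxE; apply/esym/conjCK.
Qed.

Lemma coef_normal_ract (f : {scalar H}) n (w : 'M[H]_n) X : ucorep w -> coef_normal w X ->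
  coef_normal w (X *m (map_mx f w)^T).
Proof.
move=> uw nX Y Y0; rewrite hs_functional_adjoint//; apply: nX.
by rewrite -ract_coef ?Y0 ?linear0//; case: uw.
Qed.

Lemma coef_normal_lift n (w : 'M[H]_n) X :
  exists2 Y, coef_normal w Y & coef w Y = coef w X.
Proof.
have [||Y [Z [Y0 nZ e]]] := @orthogonal_decomposition _ _ (@hs _ n n)
  [set Y | coef w Y = 0] X.
- exact: hs_inner_product.
- split=> /= [|a Y Z hY hZ]; first by rewrite linear0.
  by rewrite linearP /= hY hZ scaler0 addr0.
by exists Z => //; rewrite e linearD /= Y0 add0r.
Qed.

(** Each row of y consists of coefficients of one common unitary w. Choosing normal representatives
    makes the lifts unique, hence equivariant, so each row p of the lifts of row i of y yields an
    intertwiner from y to w. Joint injectivity is seen by applying the counit. *)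
Lemma unitarily_spanned_intertwiners n (y : 'M[H]_n) : unitarily_spanned -> corep y ->
  exists N (w : 'M[H]_N) (g : 'I_n * 'I_N -> 'M[C]_(N, n)),
  [/\ ucorep w, forall a, w *m scmx H (g a) = scmx H (g a) *m y
    & forall x : 'cV[C]_n, (forall a, g a *m x = 0) -> x = 0].
Proof.
move=> sp cy; have [N [w [uw ws]]] :=
  common_ucorep [seq y ij.1 ij.2 | ij <- enum {: 'I_n * 'I_n}] sp.
have cw : corep w by case: uw.
have lift ij : exists X, coef_normal w X /\ coef w X = y ij.1 ij.2.
  have [|X ->] := ws (y ij.1 ij.2); first by apply/mapP; exists ij; rewrite ?mem_enum.
  by have [Y nY <-] := coef_normal_lift w X; exists Y.
have [M MP] := choice lift.
exists N, w, (fun a => \matrix_(q, j) M (a.1, j) a.2 q); split=> //.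
- move=> [i p]; apply/matrixP => q j; rewrite mulmx_sc mulsc_mx /=.
  apply/eqP; rewrite -subr_eq0; apply/eqP/functional_separates => f.
  (* Both [Z] and the right-hand side below are normal lifts of [ract f (y i j)], so they
     coincide. *)
  pose Z := \sum_k f (y k j) *: M (i, k).
  have : Z = M (i, j) *m (map_mx f w)^T.
    apply: (@coef_normal_eq _ w).
    - move=> Y Y0; rewrite /Z inner_product_suml; last exact: hs_inner_product.
      by rewrite big1// => k _; rewrite (MP _).1// mulr0.
    - by apply: coef_normal_ract => //; exact: (MP _).1.
    - rewrite -ract_coef// (MP _).2 ract_corep// linear_sum.
      by apply: eq_bigr => k _; rewrite linearZ /= (MP _).2.
  move=> /matrixP /(_ p q) e; rewrite linearB /= !(raddf_sum f) /=.
  apply/eqP; rewrite subr_eq0; apply/eqP.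
  transitivity (\sum_k M (i, j) p k * (map_mx f w)^T k q).
    by apply: eq_bigr => k _; rewrite scalarZ !mxE.
  move: e; rewrite [RHS]mxE => <-; rewrite /Z summxE.
  by apply: eq_bigr => k _; rewrite scalarZ !mxE mulrC.
- move=> x h; apply/colP => i; rewrite mxE.
  have e : \sum_j x j 0 *: M (i, j) = 0.
    apply/matrixP => p q; rewrite summxE mxE.
    have /colP/(_ q) := h (i, p); rewrite !mxE => hq; rewrite -[RHS]hq.
    by apply: eq_bigr => j _; rewrite !mxE mulrC.
  have := congr1 (coef w) e; rewrite linear0 linear_sum.
  under eq_bigr do rewrite linearZ /= (MP _).2 /=.
  move=> /(congr1 counit); rewrite linear0 raddf_sum (bigD1 i)//= scalarZ cy.2 eqxx mulr1.
  rewrite big1 ?addr0// => j ne.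
  by rewrite scalarZ cy.2 eq_sym (negPf ne) mulr0.
Qed.

(** The invariant inner product is the sum of the pullbacks of the standard one along the
    intertwiners into w; joint injectivity makes it positive definite. *)
Lemma unitarily_spanned_unitarizable (V : vectType C) (rho : comodule H V) :
  unitarily_spanned -> unitarizable rho.
Proof.
move=> sp; pose b := vbasis {:V}; have hb : basis_of fullv b := vbasisP _.
have [y cy my] := comodule_corep rho hb.
have [N [w [g [uw gw gi]]]] := unitarily_spanned_intertwiners sp cy.
have gy a : scmx H (g a) *m map_mx antipode y = adj w *m scmx H (g a).
  have e : scmx H (g a) = adj w *m (scmx H (g a) *m y).
    by rewrite -gw mulmxA ucorepVl// mul1mx.
  by rewrite {1}e -!mulmxA corep_antipodeVr// mulmx1.
apply: (gram_unitarizable (G := \sum_a (g a) ^t* *m g a) hb my).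
  split.
    rewrite raddf_sum raddf_sum; apply: eq_bigr => a _ /=.
    by rewrite trmx_mul map_mxM trmxCK.
  move=> x x0.
  have -> : (x ^t* *m (\sum_a (g a) ^t* *m g a) *m x) 0 0 = \sum_a hs (g a *m x) (g a *m x).
    rewrite mulmx_sumr mulmx_suml summxE; apply: eq_bigr => a _.
    by rewrite /hs /mxtrace big_ord1 trmx_mul map_mxM !mulmxA.
  have [_ _ hpos] := hs_inner_product R N 1.
  have ge0 a : 0 <= hs (g a *m x) (g a *m x).
    have [->|/hpos/ltW//] := eqVneq (g a *m x) 0.
    by rewrite inner_product0//; exact: hs_inner_product.
  rewrite lt_def sumr_ge0 // andbT; apply: contra x0 => /eqP/psumr_eq0P h.
  apply/eqP/gi => a; apply/eqP/negPn/negP => /hpos.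
  by rewrite h ?ltxx.
rewrite /invariant_gram /scmx !map_mx_sum mulmx_sumr mulmx_suml; apply: eq_bigr => a _.
rewrite -/(scmx _ _) scmxM -mulmxA gy -adj_scmx !mulmxA; congr (_ *m _).
by rewrite -!adjM gw.
Qed.

End Coefficients.

Lemma cqg_spanned (R : realType) (H : cqg_algebra R) : unitarily_spanned H.
Proof.
move=> x; have [n [w [xi [eta [f [uw _ ->]]]]]] := ucorep_coefficient x.
by exists n, w, (xi^T *m eta^T); rewrite coef_row_col.
Qed.

(** * The Haar functional *)

Section Haar.
Variables (R : realType) (H : hopf_star_algebra R).
Local Notation C := R[i].

Lemma functional_lact (f g : {scalar H}) x : f (lact g x) = g (ract f x).
Proof.
rewrite /lact /ract; elim/tens_ind: (comul x) => [|y z hy hz|a b].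
- by rewrite !linear0.
- by rewrite !linearD /= hy hz.
by rewrite contractl_tens contractr_tens !scalarZ mulrC.
Qed.

Lemma ract1 (f : {scalar H}) : ract f 1 = f 1 *: 1.
Proof.
by rewrite /ract (comul_monoid_morphism H).1 -[X in contractr _ X]/(tens 1 1) contractr_tens.
Qed.

(** Normalised two-sided invariance. Positivity will enter only through sums of h(b_l^* b_l) over a
    column b, which unitarity evaluates explicitly. *)
Definition haar (h : {scalar H}) : Prop :=
  [/\ h 1 = 1, forall x, lact h x = h x *: 1 & forall x, ract h x = h x *: 1].

(** The normal representative X of 1 is an eigenvector, with eigenvalue f(1), of every operator
    given by a functional f. As these operators are closed under adjoints, X is orthogonal to
    representatives of all the summands, so 1 being their sum would force the norm of X to
    vanish. *)
Lemma one_not_augmented (s : seq ({scalar H} * H)) : unitarily_spanned H ->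
  1 <> \sum_(p <- s) (ract p.1 p.2 - p.1 1 *: p.2).
Proof.
move=> sp e; have [n [w [uw ws]]] := common_ucorep (1 :: unzip2 s) sp.
have cw : corep w by case: uw.
have [E eE] : exists X, 1 = coef w X by apply: ws; rewrite mem_head.
have [X nX eX] := coef_normal_lift w E; rewrite -eE in eX.
have [h1 h2 h3] := hs_inner_product R n n.
have XfZ (f : {scalar H}) : X *m (map_mx f w)^T = f 1 *: X.
  apply: (coef_normal_eq (w := w)); first exact: coef_normal_ract.
    move=> Y Y0; rewrite -[_ *: _]addr0 h1 nX// mulr0 inner_product0//.
    by rewrite addr0.
  by rewrite -ract_coef// linearZ /= eX ract1.
have [Y eY] : exists Y, \sum_(p <- s) (ract p.1 p.2 - p.1 1 *: p.2) = coef w Y /\ hs X Y = 0.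
  have : {subset s <= s} by [].
  elim: {1 3}s => [|p r IH] rs.
    by rewrite big_nil; exists 0; rewrite linear0 inner_product0.
  have /IH [Y [eY Y0]] : {subset r <= s} by move=> z zr; apply: rs; rewrite inE zr orbT.
  have [Z eZ] : exists Z, p.2 = coef w Z.
    apply: ws; rewrite inE; apply/orP; right; apply/mapP; exists p => //.
    by apply: rs; rewrite mem_head.
  rewrite big_cons eY eZ ract_coef//.
  exists (Z *m (map_mx p.1 w)^T - p.1 1 *: Z + Y).
  split; first by rewrite [RHS]linearD /= [X in _ = X + _]linearB /= [X in _ = _ - X + _]linearZ.
  have hsD (x y z : 'M[C]_n) : hs x (y + z) = hs x y + hs x z.
    by rewrite -[y]scale1r h1 mul1r scale1r.
  have hsZ (x : 'M[C]_n) a (y : 'M[C]_n) : hs x (a *: y) = a * hs x y.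
    by rewrite -[a *: y]addr0 h1 inner_product0// addr0.
  rewrite hsD Y0 addr0 hsD -scaleNr hsZ hs_functional_adjoint//.
  rewrite XfZ h2 hsZ /= antipode1 star1 rmorphM /= -h2.
  rewrite -[X in X * _]/(Num.conj (Num.conj _)) conjCK.
  by rewrite mulNr subrr.
case: eY => eY Y0.
have /nX : coef w (Y - X) = 0 by rewrite linearB /= eX -eY -e subrr.
rewrite h2 -scaleN1r addrC h1 Y0 addr0 mulN1r rmorphN /= -h2 => /eqP.
rewrite oppr_eq0 => XX0.
have X0 : X = 0 by apply/eqP/negPn/negP => /h3; rewrite (eqP XX0) ltxx.
move: eX; rewrite X0 linear0 => /(congr1 counit); rewrite linear0.
by rewrite (counit_monoid_morphism H).1 => /esym/eqP; rewrite oner_eq0.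
Qed.

Lemma haar_ucorep_left (h : {scalar H}) n (w : 'M[H]_n) :
  (forall x, lact h x = h x *: 1) -> ucorep w ->
  scmx H (map_mx h w) *m w = scmx H (map_mx h w).
Proof.
move=> hl [cw _]; apply/matrixP => i j; rewrite mulsc_mx [RHS]mxE [X in in_alg _ X]mxE /=.
by rewrite -hl lact_corep//; apply: eq_bigr => k _; rewrite mxE.
Qed.

(* From p w = p and unitarity, w p^* = p^*; applying h gives p = p^*. *)
Lemma haar_ucorep_right (h : {scalar H}) n (w : 'M[H]_n) :
  (forall x, lact h x = h x *: 1) -> h 1 = 1 -> ucorep w ->
  w *m scmx H (map_mx h w) = scmx H (map_mx h w).
Proof.
move=> hl h1 uw; set p := map_mx h w.
have pw : scmx H p *m w = scmx H p by exact: haar_ucorep_left.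
have wp : w *m scmx H (p ^t*) = scmx H (p ^t*).
  have : adj (scmx H p *m w) = adj (scmx H p) by rewrite pw.
  rewrite adjM adj_scmx => e.
  by rewrite -{1}e mulmxA ucorepVr// mul1mx.
have ph : p *m p ^t* = p ^t*.
  have := map_scalar_sc h 1%:M w (p ^t*); rewrite scmx1 !mul1mx wp => <-.
  by apply/matrixP => i j; rewrite mxE [X in h X]mxE /= scalarZ h1 mulr1.
suff -> : p = p ^t* by [].
have : (p *m p ^t*) ^t* = (p ^t*) ^t* by rewrite ph.
by rewrite trmx_mul map_mxM trmxCK ph.
Qed.

(** A functional that kills the span [K] and sends 1 to 1 is invariant on one side, since f(lact h
    x) = h(ract f x) = f(1) h(x). Invariance on the other side then comes from unitarity. *)
Lemma haar_exists : unitarily_spanned H -> exists h, haar h.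
Proof.
move=> sp.
pose K : set H := [set x | exists s : seq ({scalar H} * H),
  x = \sum_(p <- s) (ract p.1 p.2 - p.1 1 *: p.2)].
have sK : submodule K.
  split; first by exists [::]; rewrite big_nil.
  move=> a x y [s ->] [t ->]; exists ([seq (p.1, a *: p.2) | p <- s] ++ t).
  rewrite big_cat big_map; congr (_ + _); rewrite scaler_sumr.
  by apply: eq_bigr => p _ /=; rewrite [ract _ (a *: _)]linearZ /= scalerBr !scalerA [p.1 1 * a]mulrC.
have [|h [h1 hK]] := @separating_functional _ _ K 1 sK.
  by move=> [s]; exact: one_not_augmented.
have hl x : lact h x = h x *: 1.
  apply/eqP; rewrite -subr_eq0; apply/eqP/functional_separates => f.
  rewrite linearB /= scalarZ functional_lact mulrC -scalarZ -linearB; apply: hK.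
  by exists [:: (f, x)]; rewrite big_seq1.
exists h; split=> // x.
have [n [w [X [uw ->]]]] := sp x.
have /matrixP e := haar_ucorep_right hl h1 uw.
rewrite /coef !raddf_sum scaler_suml; apply: eq_bigr => i _ /=.
rewrite !raddf_sum scaler_suml; apply: eq_bigr => j _ /=.
rewrite linearZ /= scalarZ -scalerA; congr (_ *: _).
have := e i j; rewrite mulmx_sc ract_corep; last by case: uw.
rewrite [RHS]mxE [X in in_alg _ X]mxE /= => <-.
by apply: eq_bigr => k _; rewrite mxE.
Qed.

End Haar.

(** * Quotients by Hopf *-ideals *)

Section HopfIdeal.
Variable R : realType.
Local Notation C := R[i].

Record hopf_ideal (H : hopf_star_algebra R) := HopfIdeal {
  ideal_set : set H;
  ideal_submodule : submodule ideal_set;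
  ideal_mull : forall x y, ideal_set y -> ideal_set (x * y);
  ideal_mulr : forall x y, ideal_set x -> ideal_set (x * y);
  ideal_counit : forall x, ideal_set x -> counit x = 0;
  ideal_antipode : forall x, ideal_set x -> ideal_set (antipode x);
  ideal_star : forall x, ideal_set x -> ideal_set (star x);
  ideal_comul : forall x, ideal_set x -> exists s t,
    [/\ in_tensor ideal_set setT s, in_tensor setT ideal_set t & comul x = s + t]
}.

Section Quotient.
Variables (H : hopf_star_algebra R) (I : hopf_ideal H).
Let J := ideal_set I.
Let sJ : submodule J := ideal_submodule I.

Definition ideal_eqb (x y : H) : bool := `[< ideal_set I (x - y) >].

Lemma ideal_eqb_refl : reflexive ideal_eqb.
Proof. by move=> x; apply/asboolP; rewrite subrr; case: sJ. Qed.
Lemma ideal_eqb_sym : symmetric ideal_eqb.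
Proof.
by move=> x y; apply/asboolP/asboolP => /(submoduleN sJ); rewrite opprB.
Qed.
Lemma ideal_eqb_trans : transitive ideal_eqb.
Proof.
move=> x y z /asboolP h /asboolP h'; apply/asboolP.
by have := submoduleD sJ h h'; rewrite addrA addrNK.
Qed.

Canonical ideal_equivRel :=
  EquivRel ideal_eqb ideal_eqb_refl ideal_eqb_sym ideal_eqb_trans.

Definition hopf_quotient : Type := {eq_quot ideal_equivRel}.
Local Notation D := hopf_quotient.

HB.instance Definition _ := Choice.on hopf_quotient.
HB.instance Definition _ := EqQuotient.on hopf_quotient.

Definition hopf_proj (x : H) : D := \pi_hopf_quotient x.
Local Notation pi := hopf_proj.

Lemma hopf_projP x y : pi x = pi y <-> ideal_set I (x - y).
Proof.
split=> [/eqmodP /asboolP//|h].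
by apply/eqmodP/asboolP.
Qed.

Lemma hopf_repr x : ideal_set I (repr (pi x) - x).
Proof. by apply/hopf_projP; rewrite /hopf_proj reprK. Qed.

Lemma hopf_reprK (a : D) : pi (repr a) = a.
Proof. by rewrite /hopf_proj reprK. Qed.

Lemma hopf_proj_ind (P : D -> Prop) : (forall x, P (pi x)) -> forall a, P a.
Proof. by move=> h a; rewrite -(hopf_reprK a). Qed.

Definition qadd (a b : D) : D := pi (repr a + repr b).
Definition qopp (a : D) : D := pi (- repr a).
Definition qscale (c : C) (a : D) : D := pi (c *: repr a).
Definition qmul (a b : D) : D := pi (repr a * repr b).

Lemma qaddE x y : qadd (pi x) (pi y) = pi (x + y).
Proof.
apply/hopf_projP; rewrite opprD addrACA.
by apply: (submoduleD sJ); exact: hopf_repr.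
Qed.
Lemma qoppE x : qopp (pi x) = pi (- x).
Proof.
by apply/hopf_projP; rewrite -opprD; apply: (submoduleN sJ); exact: hopf_repr.
Qed.
Lemma qscaleE c x : qscale c (pi x) = pi (c *: x).
Proof.
by apply/hopf_projP; rewrite -scalerBr; apply: (submoduleZ c sJ); exact: hopf_repr.
Qed.
Lemma qmulE x y : qmul (pi x) (pi y) = pi (x * y).
Proof.
apply/hopf_projP.
have -> : repr (pi x) * repr (pi y) - x * y =
    (repr (pi x) - x) * repr (pi y) + x * (repr (pi y) - y).
  by rewrite mulrBl mulrBr addrA addrNK.
apply: (submoduleD sJ); [apply: ideal_mulr|apply: ideal_mull]; exact: hopf_repr.
Qed.

Lemma qaddA : associative qadd.
Proof.
elim/hopf_proj_ind => x; elim/hopf_proj_ind => y; elim/hopf_proj_ind => z.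
by rewrite !qaddE addrA.
Qed.
Lemma qaddC : commutative qadd.
Proof. by elim/hopf_proj_ind => x; elim/hopf_proj_ind => y; rewrite !qaddE addrC. Qed.
Lemma qadd0 : left_id (pi 0) qadd.
Proof. by elim/hopf_proj_ind => x; rewrite !qaddE add0r. Qed.
Lemma qaddN : left_inverse (pi 0) qopp qadd.
Proof. by elim/hopf_proj_ind => x; rewrite qoppE qaddE addNr. Qed.
HB.instance Definition _ := GRing.isZmodule.Build hopf_quotient qaddA qaddC qadd0 qaddN.

Lemma qmulA : associative qmul.
Proof.
elim/hopf_proj_ind => x; elim/hopf_proj_ind => y; elim/hopf_proj_ind => z.
by rewrite !qmulE mulrA.
Qed.
Lemma qmul1r : left_id (pi 1) qmul.
Proof. by elim/hopf_proj_ind => x; rewrite qmulE mul1r. Qed.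
Lemma qmulr1 : right_id (pi 1) qmul.
Proof. by elim/hopf_proj_ind => x; rewrite qmulE mulr1. Qed.
Lemma qmulDl : left_distributive qmul +%R.
Proof.
elim/hopf_proj_ind => x; elim/hopf_proj_ind => y; elim/hopf_proj_ind => z.
by rewrite -[_ + _]/(qadd _ _) -[RHS]/(qadd _ _) !(qaddE, qmulE) mulrDl.
Qed.
Lemma qmulDr : right_distributive qmul +%R.
Proof.
elim/hopf_proj_ind => x; elim/hopf_proj_ind => y; elim/hopf_proj_ind => z.
by rewrite -[pi y + _]/(qadd _ _) -[RHS]/(qadd _ _) !(qaddE, qmulE) mulrDr.
Qed.
Lemma q1_neq0 : pi 1 != 0.
Proof.
apply/eqP => /hopf_projP; rewrite subr0 => /ideal_counit.
by rewrite (counit_monoid_morphism H).1 => /eqP; rewrite oner_eq0.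
Qed.
HB.instance Definition _ := GRing.Zmodule_isNzRing.Build hopf_quotient
  qmulA qmul1r qmulr1 qmulDl qmulDr q1_neq0.

Lemma qscaleA a b x : qscale a (qscale b x) = qscale (a * b) x.
Proof. by elim/hopf_proj_ind: x => x; rewrite !qscaleE scalerA. Qed.
Lemma qscale1 : left_id 1 qscale.
Proof. by elim/hopf_proj_ind => x; rewrite qscaleE scale1r. Qed.
Lemma qscaleDr : right_distributive qscale +%R.
Proof.
move=> a; elim/hopf_proj_ind => x; elim/hopf_proj_ind => y.
by rewrite -[pi x + _]/(qadd _ _) -[RHS]/(qadd _ _) !(qaddE, qscaleE) scalerDr.
Qed.
Lemma qscaleDl x : {morph qscale^~ x : a b / a + b}.
Proof.
move=> a b; elim/hopf_proj_ind: x => x.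
by rewrite -[RHS]/(qadd _ _) !qscaleE qaddE scalerDl.
Qed.
HB.instance Definition _ := GRing.Zmodule_isLmodule.Build C hopf_quotient
  qscaleA qscale1 qscaleDr qscaleDl.

Lemma qscaleAl (a : C) (x y : D) : a *: (x * y) = (a *: x) * y.
Proof.
elim/hopf_proj_ind: x => x; elim/hopf_proj_ind: y => y.
rewrite -[LHS]/(qscale _ (qmul _ _)) -[RHS]/(qmul (qscale _ _) _).
by rewrite !(qmulE, qscaleE) scalerAl.
Qed.
HB.instance Definition _ := GRing.Lmodule_isLalgebra.Build C hopf_quotient qscaleAl.

Lemma qscaleAr (a : C) (x y : D) : a *: (x * y) = x * (a *: y).
Proof.
elim/hopf_proj_ind: x => x; elim/hopf_proj_ind: y => y.
rewrite -[LHS]/(qscale _ (qmul _ _)) -[RHS]/(qmul _ (qscale _ _)).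
by rewrite !(qmulE, qscaleE) scalerAr.
Qed.
HB.instance Definition _ := GRing.Lalgebra_isAlgebra.Build C hopf_quotient qscaleAr.

Lemma hopf_projD x y : pi (x + y) = pi x + pi y. Proof. by rewrite -qaddE. Qed.
Lemma hopf_projZ a x : pi (a *: x) = a *: pi x. Proof. by rewrite -qscaleE. Qed.
Lemma hopf_projM x y : pi (x * y) = pi x * pi y. Proof. by rewrite -qmulE. Qed.
Lemma hopf_proj_linear : linear pi.
Proof. by move=> a x y; rewrite hopf_projD hopf_projZ. Qed.
HB.instance Definition _ := GRing.isLinear.Build C H D _ pi hopf_proj_linear.
HB.instance Definition _ := GRing.isMonoidMorphism.Build H D pi (erefl, hopf_projM).

Lemma hopf_proj0 x : ideal_set I x -> pi x = 0.
Proof. by move=> h; apply/hopf_projP; rewrite subr0. Qed.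

Definition qcomul (a : D) : D ⊗ D := tmap pi pi (comul (repr a)).

Lemma qcomulE x : qcomul (pi x) = tmap pi pi (comul x).
Proof.
apply/eqP; rewrite -subr_eq0 -!linearB /=; apply/eqP.
have [s [t [[ss hs ->] [st ht ->] ->]]] := ideal_comul (hopf_repr x).
rewrite linearD !linear_sum /= !big1_seq ?addr0// => p /andP [_ hp].
  by rewrite tmap_tens /= [pi p.2]hopf_proj0 ?tens0r//; case: (ht _ hp).
by rewrite tmap_tens /= [pi p.1]hopf_proj0 ?tens0l//; case: (hs _ hp).
Qed.

Lemma qcomul_linear : linear qcomul.
Proof.
move=> a; elim/hopf_proj_ind => x; elim/hopf_proj_ind => y.
by rewrite -hopf_projZ -hopf_projD !qcomulE !linearP.
Qed.
HB.instance Definition _ := GRing.isLinear.Build C D (D ⊗ D) _ qcomul qcomul_linear.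

Definition qcounit (a : D) : C := counit (repr a).
Lemma qcounitE x : qcounit (pi x) = counit x.
Proof.
apply/eqP; rewrite -subr_eq0 -linearB /=; apply/eqP.
exact/ideal_counit/hopf_repr.
Qed.
Lemma qcounit_linear : scalar qcounit.
Proof.
move=> a; elim/hopf_proj_ind => x; elim/hopf_proj_ind => y.
by rewrite -hopf_projZ -hopf_projD !qcounitE !linearP.
Qed.
HB.instance Definition _ := GRing.isLinear.Build C D C _ qcounit qcounit_linear.

Definition qantipode (a : D) : D := pi (antipode (repr a)).
Lemma qantipodeE x : qantipode (pi x) = pi (antipode x).
Proof.
apply/hopf_projP; rewrite -linearB.
exact/ideal_antipode/hopf_repr.
Qed.
Lemma qantipode_linear : linear qantipode.
Proof.
move=> a; elim/hopf_proj_ind => x; elim/hopf_proj_ind => y.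
by rewrite -hopf_projZ -hopf_projD !qantipodeE !linearP.
Qed.
HB.instance Definition _ := GRing.isLinear.Build C D D _ qantipode qantipode_linear.

Definition qstar (a : D) : D := pi (star (repr a)).
Lemma qstarE x : qstar (pi x) = pi (star x).
Proof.
apply/hopf_projP; rewrite -raddfB.
exact/ideal_star/hopf_repr.
Qed.

Lemma tmap_projM (s t : H ⊗ H) : tmap pi pi (s * t) = tmap pi pi s * tmap pi pi t.
Proof.
elim/tens_ind: s => [|x y hx hy|a b].
- by rewrite mul0r linear0 mul0r.
- by rewrite mulrDl !linearD /= hx hy mulrDl.
elim/tens_ind: t => [|x y hx hy|c d].
- by rewrite mulr0 linear0 mulr0.
- by rewrite mulrDr !linearD /= hx hy mulrDr.
rewrite -[X in tmap _ _ X]/(tmul _ _) tmul_tens !tmap_tens /= !hopf_projM.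
by rewrite -[RHS]/(tmul _ _) tmul_tens.
Qed.

Lemma qcomul_monoid_morphism : monoid_morphism qcomul.
Proof.
split=> [|].
  rewrite -[X in qcomul X]/(pi 1) qcomulE (comul_monoid_morphism H).1.
  by rewrite -[X in tmap _ _ X]/(tens 1 1) tmap_tens.
elim/hopf_proj_ind => x; elim/hopf_proj_ind => y.
by rewrite -hopf_projM !qcomulE (comul_monoid_morphism H).2 tmap_projM.
Qed.

Lemma qcounit_monoid_morphism : monoid_morphism qcounit.
Proof.
split=> [|].
  by rewrite -[X in qcounit X]/(pi 1) qcounitE (counit_monoid_morphism H).1.
elim/hopf_proj_ind => x; elim/hopf_proj_ind => y.
by rewrite -hopf_projM !qcounitE (counit_monoid_morphism H).2.
Qed.

Lemma qcomul_coassoc a :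
  tassoc (tmap qcomul idfun (qcomul a)) = tmap idfun qcomul (qcomul a).
Proof.
elim/hopf_proj_ind: a => v; rewrite qcomulE.
pose Q (x : H ⊗ (H ⊗ H)) : D ⊗ (D ⊗ D) := tmap pi (tmap pi pi) x.
transitivity (Q (tassoc (tmap comul idfun (comul v)))).
  elim/tens_ind: (comul v) => [|x y hx hy|u h].
  - by rewrite !(tmap_linear0, tassoc0) /Q tmap_linear0.
  - by rewrite !(tmap_linearD, tassocD) hx hy /Q tmap_linearD.
  rewrite !tmap_tens /= qcomulE.
  elim/tens_ind: (comul u) => [|x y hx hy|w a].
  - by rewrite tmap_linear0 !tens0l !tassoc0 /Q tmap_linear0.
  - by rewrite tmap_linearD !tensDl !tassocD hx hy /Q tmap_linearD.
  by rewrite tmap_tens !tassoc_tens /Q tmap_tens /= tmap_tens.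
rewrite comul_coassoc /Q.
elim/tens_ind: (comul v) => [|x y hx hy|u h].
- by rewrite !tmap_linear0.
- by rewrite !tmap_linearD hx hy.
by rewrite !tmap_tens /= qcomulE.
Qed.

Lemma qcounit_comull a : tsum (fun a b => qcounit a *: b) (qcomul a) = a.
Proof.
elim/hopf_proj_ind: a => v; rewrite qcomulE -[in RHS](counit_comull v).
rewrite -[LHS]/(contractl qcounit _) -[X in pi X]/(contractl counit _).
elim/tens_ind: (comul v) => [|x y hx hy|u h].
- by rewrite !linear0.
- by rewrite tmap_linearD !linearD /= hx hy.
by rewrite tmap_tens !contractl_tens /= qcounitE hopf_projZ.
Qed.

Lemma qcounit_comulr a : tsum (fun a b => qcounit b *: a) (qcomul a) = a.
Proof.
elim/hopf_proj_ind: a => v; rewrite qcomulE -[in RHS](counit_comulr v).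
rewrite -[LHS]/(contractr qcounit _) -[X in pi X]/(contractr counit _).
elim/tens_ind: (comul v) => [|x y hx hy|u h].
- by rewrite !linear0.
- by rewrite tmap_linearD !linearD /= hx hy.
by rewrite tmap_tens !contractr_tens /= qcounitE hopf_projZ.
Qed.

Lemma qantipode_balancedl : balanced (fun a b : D => qantipode a * b).
Proof.
split=> [w x y|u x y|a u w]; rewrite ?linearD ?mulrDl ?mulrDr//.
by rewrite linearZ /= -scalerAl -scalerAr.
Qed.
Lemma qantipode_balancedr : balanced (fun a b : D => a * qantipode b).
Proof.
split=> [w x y|u x y|a u w]; rewrite ?linearD ?mulrDl ?mulrDr//.
by rewrite linearZ /= -scalerAl -scalerAr.
Qed.

Lemma qantipode_comull a :
  tsum (fun a b => qantipode a * b) (qcomul a) = qcounit a *: 1.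
Proof.
elim/hopf_proj_ind: a => v; rewrite qcomulE qcounitE -[1]/(pi 1) -hopf_projZ.
rewrite -antipode_comull.
have b1 := qantipode_balancedl; have b2 := @antipode_balancedl _ H.
elim/tens_ind: (comul v) => [|x y hx hy|u h].
- by rewrite linear0 !tsum0// linear0.
- by rewrite tmap_linearD !tsumD// linearD hx hy.
by rewrite tmap_tens !tsum_tens//= qantipodeE hopf_projM.
Qed.

Lemma qantipode_comulr a :
  tsum (fun a b => a * qantipode b) (qcomul a) = qcounit a *: 1.
Proof.
elim/hopf_proj_ind: a => v; rewrite qcomulE qcounitE -[1]/(pi 1) -hopf_projZ.
rewrite -antipode_comulr.
have b1 := qantipode_balancedr; have b2 := @antipode_balancedr _ H.
elim/tens_ind: (comul v) => [|x y hx hy|u h].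
- by rewrite linear0 !tsum0// linear0.
- by rewrite tmap_linearD !tsumD// linearD hx hy.
by rewrite tmap_tens !tsum_tens//= qantipodeE hopf_projM.
Qed.

Lemma qstarD : {morph qstar : x y / x + y}.
Proof.
elim/hopf_proj_ind => x; elim/hopf_proj_ind => y.
by rewrite -hopf_projD !qstarE -hopf_projD starD.
Qed.
Lemma qstarZ a x : qstar (a *: x) = conjc a *: qstar x.
Proof.
by elim/hopf_proj_ind: x => x; rewrite -hopf_projZ !qstarE -hopf_projZ starZ.
Qed.
Lemma qstarM x y : qstar (x * y) = qstar y * qstar x.
Proof.
elim/hopf_proj_ind: x => x; elim/hopf_proj_ind: y => y.
by rewrite -hopf_projM !qstarE -hopf_projM starM.
Qed.
Lemma qstarK : involutive qstar.
Proof. by elim/hopf_proj_ind => x; rewrite !qstarE starK. Qed.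

Lemma qcomul_star x : qcomul (qstar x) = tmap qstar qstar (qcomul x).
Proof.
elim/hopf_proj_ind: x => x; rewrite qstarE !qcomulE comul_star /tmap.
have b1 : balanced (fun u w : H => tens (star u) (star w)).
  by split=> [w y z|u y z|a u w]; rewrite ?starD ?tensDl ?tensDr// !starZ tensZl tensZr.
have b2 : balanced (fun u w : D => tens (qstar u) (qstar w)).
  by split=> [w y z|u y z|a u w]; rewrite ?qstarD ?tensDl ?tensDr// !qstarZ tensZl tensZr.
have b3 := @tmap_balanced _ _ _ _ _ pi pi.
elim/tens_ind: (comul x) => [|y z hy hz|u h].
- by rewrite !tsum0.
- by rewrite !tsumD// hy hz.
by rewrite !tsum_tens//= !qstarE.
Qed.

Definition quotient_hopf_star_algebra : hopf_star_algebra R :=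
  HopfStarAlgebra qcomul_monoid_morphism qcounit_monoid_morphism qcomul_coassoc
    qcounit_comull qcounit_comulr qantipode_comull qantipode_comulr qstarD qstarZ
    qstarM qstarK qcomul_star.

Definition quotient_morphism : hopf_star_morphism H quotient_hopf_star_algebra :=
  @HopfStarMorphism R H quotient_hopf_star_algebra pi qcomulE qcounitE
    (fun x => esym (qantipodeE x)) (fun x => esym (qstarE x)).

End Quotient.

Lemma map_ucorep (H H' : hopf_star_algebra R) (q : hopf_star_morphism H H') n
  (w : 'M[H]_n) : ucorep w -> ucorep (map_mx q w).
Proof.
move=> [[cw ew] aw]; split; first split; move=> i j; rewrite !mxE.
- rewrite hopf_fun_comul cw linear_sum; apply: eq_bigr => k _.
  by rewrite /= tmap_tens !mxE.
- by rewrite hopf_fun_counit ew.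
- by rewrite -hopf_fun_antipode aw hopf_fun_star.
Qed.

Lemma quotient_spanned (H : hopf_star_algebra R) (I : hopf_ideal H) :
  unitarily_spanned H -> unitarily_spanned (quotient_hopf_star_algebra I).
Proof.
move=> sp; elim/hopf_proj_ind => x; have [n [w [X [uw ->]]]] := sp x.
exists n, (map_mx (quotient_morphism I) w), X; split; first exact: map_ucorep.
rewrite /coef (raddf_sum (@hopf_proj H I)); apply: eq_bigr => i _.
rewrite (raddf_sum (@hopf_proj H I)); apply: eq_bigr => j _.
by rewrite /= hopf_projZ mxE.
Qed.

(** Being a CQG algebra, the quotient may be fed to the universal property of the isotropy
    algebra. *)
Definition quotient_cqg (H : hopf_star_algebra R) (I : hopf_ideal H)
  (sp : unitarily_spanned H) : cqg_algebra R :=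
  @CqgAlgebra R (quotient_hopf_star_algebra I)
    (fun V rho => unitarily_spanned_unitarizable rho (quotient_spanned (I := I) sp)).

End HopfIdeal.

(** * Coinvariants of the isotropy quotient *)

Section SpannedHopf.
Variables (R : realType) (H : hopf_star_algebra R).
Local Notation C := R[i].

Lemma counitM (x y : H) : counit (x * y) = counit x * counit y.
Proof. exact: (counit_monoid_morphism H).2. Qed.

Lemma counit1 : counit (1 : H) = 1.
Proof. exact: (counit_monoid_morphism H).1. Qed.

Lemma comulM (x y : H) : comul (x * y) = comul x * comul y.
Proof. exact: (comul_monoid_morphism H).2. Qed.

Lemma tensM (a b c d : H) : tens a b * tens c d = tens (a * c) (b * d).
Proof. by rewrite -[LHS]/(tmul _ _) tmul_tens. Qed.

Lemma map_counitM m n p (A : 'M[H]_(m, n)) (B : 'M[H]_(n, p)) :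
  map_mx counit (A *m B) = map_mx counit A *m map_mx counit B.
Proof.
apply/matrixP => i j; rewrite !mxE raddf_sum; apply: eq_bigr => k _.
by rewrite /= counitM !mxE.
Qed.

Lemma map_counit_corep n (w : 'M[H]_n) : corep w -> map_mx counit w = 1%:M.
Proof. by move=> [_ ew]; apply/matrixP => i j; rewrite !mxE ew. Qed.

Lemma map_counit_adj n (w : 'M[H]_n) : ucorep w -> map_mx counit (adj w) = 1%:M.
Proof.
move=> uw; have := congr1 (map_mx counit) (ucorepVr uw).
rewrite map_counitM map_counit_corep ?mul1mx; last by case: uw.
move=> ->; apply/matrixP => i j; rewrite !mxE.
by case: eqP => _; rewrite ?counit1 ?linear0.
Qed.

Lemma counit_conj n (w M : 'M[H]_n) i j : ucorep w ->
  counit ((w *m M *m adj w) i j) = counit (M i j).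
Proof.
move=> uw; have /matrixP/(_ i j) := map_counitM (w *m M) (adj w).
rewrite [LHS]mxE => ->; rewrite map_counit_adj// mulmx1 map_counitM.
by rewrite map_counit_corep ?mul1mx ?mxE//; case: uw.
Qed.

Lemma spanned_ind (sp : unitarily_spanned H) (Q : set H) : submodule Q ->
  (forall n (w : 'M[H]_n) i j, ucorep w -> Q (w i j)) -> forall x, Q x.
Proof.
move=> sQ h x; have [n [w [X [uw ->]]]] := sp x.
apply: submodule_sum => // i _; apply: submodule_sum => // j _.
by apply: submoduleZ => //; exact: h.
Qed.

(** Applying the counit to w w^* = 1 shows that the counit of [adj w] is the identity matrix, which
    is the claim on spanning elements. *)
Lemma counit_star (sp : unitarily_spanned H) (x : H) :
  counit (star x) = Num.conj (counit x).
Proof.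
have [n [w [X [uw ->]]]] := sp x.
rewrite /coef !raddf_sum; apply: eq_bigr => i _; rewrite !raddf_sum; apply: eq_bigr => j _.
rewrite /= starZ !scalarZ rmorphM /=; congr (_ * _).
have /matrixP/(_ j i) := map_counit_adj uw; rewrite !mxE => ->.
by have [[_ ->] _] := uw; rewrite eq_sym; case: eqP => _; rewrite ?rmorph1 ?rmorph0.
Qed.

(* S(wz) and S(z)S(w) are both inverse to the product corepresentation. *)
Lemma antipodeM (sp : unitarily_spanned H) (x y : H) :
  antipode (x * y) = antipode y * antipode x.
Proof.
have bl := @antipode_balancedl _ H.
have key n m (w : 'M[H]_n) (z : 'M[H]_m) i j k l : ucorep w -> ucorep z ->
    antipode (w i j * z k l) = antipode (z k l) * antipode (w i j).
  move=> uw uz; have [[cw ew] aw] := uw; have [[cz ez] az] := uz.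
  have inv a b : \sum_p \sum_q antipode (w i p * z k q) * (w p a * z q b) =
      ((i == a)%:R * (k == b)%:R) *: 1.
    have := antipode_comull (w i a * z k b).
    rewrite counitM ew ez comulM cw cz mulr_suml (tsum_sum _ _ _ bl) => <-.
    apply: eq_bigr => p _; rewrite mulr_sumr (tsum_sum _ _ _ bl).
    by apply: eq_bigr => q _; rewrite tensM (tsum_tens _ _ bl).
  have wV p : \sum_a w p a * star (w j a) = (p == j)%:R.
    have /matrixP/(_ p j) := ucorepVr uw; rewrite !mxE => <-.
    by apply: eq_bigr => a _; rewrite mxE.
  have zV q : \sum_b z q b * star (z l b) = (q == l)%:R.
    have /matrixP/(_ q l) := ucorepVr uz; rewrite !mxE => <-.
    by apply: eq_bigr => b _; rewrite mxE.
  transitivity (\sum_p \sum_q antipode (w i p * z k q) *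
      (\sum_a \sum_b (w p a * z q b) * (star (z l b) * star (w j a)))).
    rewrite (bigD1 j)//= (bigD1 l)//=.
    have e p q : \sum_a \sum_b (w p a * z q b) * (star (z l b) * star (w j a)) =
        (q == l)%:R * (p == j)%:R.
      under eq_bigr => a _.
        under eq_bigr do rewrite mulrA -[w p a * _ * _]mulrA.
        rewrite -mulr_suml -mulr_sumr zV.
        over.
      case: (q == l).
        by under eq_bigr do rewrite mulr1; rewrite wV mul1r.
      by rewrite mul0r big1// => a _; rewrite mulr0 mul0r.
    rewrite e !eqxx !mulr1 !big1 ?addr0//.
      by move=> p ne; rewrite big1// => q _; rewrite e (negPf ne) !mulr0.
    by move=> q ne; rewrite e (negPf ne) mul0r mulr0.
  rewrite az aw.
  transitivity (\sum_a \sum_b (\sum_p \sum_q antipode (w i p * z k q) * (w p a * z q b)) *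
      (star (z l b) * star (w j a))).
    under eq_bigr do under eq_bigr do rewrite mulr_sumr.
    under eq_bigr do rewrite exchange_big.
    rewrite exchange_big; apply: eq_bigr => a _ /=.
    under eq_bigr do under eq_bigr do rewrite mulr_sumr.
    under eq_bigr do rewrite exchange_big.
    rewrite exchange_big; apply: eq_bigr => b _ /=.
    rewrite mulr_suml; apply: eq_bigr => p _; rewrite mulr_suml; apply: eq_bigr => q _.
    by rewrite mulrA.
  rewrite (bigD1 i)//= (bigD1 k)//= inv !eqxx mulr1 scale1r mul1r.
  rewrite !big1 ?addr0//.
    move=> a ne; rewrite big1// => b _.
    by rewrite inv [i == a]eq_sym (negPf ne) mul0r scale0r mul0r.
  by move=> b ne; rewrite inv [k == b]eq_sym (negPf ne) mulr0 scale0r mul0r.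
have sub (f g : {linear H -> H}) : submodule [set x | f x = g x].
  split=> /= [|a v v' hv hv']; first by rewrite !linear0.
  by rewrite !linearP /= hv hv'.
have lin1 (z : H) : linear (fun x : H => antipode (x * z)).
  by move=> a v v'; rewrite mulrDl -scalerAl linearP.
have lin2 (z : H) : linear (fun x : H => antipode z * antipode x).
  by move=> a v v'; rewrite linearP mulrDr -scalerAr.
have lin3 (z : H) : linear (fun x : H => antipode (z * x)).
  by move=> a v v'; rewrite mulrDr -scalerAr linearP.
have lin4 (z : H) : linear (fun x : H => antipode x * antipode z).
  by move=> a v v'; rewrite linearP mulrDl -scalerAl.
refine (spanned_ind sp (sub (mk_linear (lin1 y)) (mk_linear (lin2 y))) _ x).
move=> n w i j uw.
refine (spanned_ind sp (sub (mk_linear (lin3 (w i j))) (mk_linear (lin4 (w i j)))) _ y).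
by move=> m z k l uz; exact: key.
Qed.

End SpannedHopf.

Section CosetAlgebra.
Variables (R : realType) (H : hopf_star_algebra R) (n : nat) (u : 'M[H]_n).
Variable P : 'M[R[i]]_n.
Local Notation C := R[i].

(* The functions on the quantum homogeneous space of the isotropy subgroup of the
   range of P: generated by the coordinates u P u^* of the orbit map, and stable
   under the adjoint action, as the kernel of a Hopf algebra morphism requires. *)
Inductive coset_alg : H -> Prop :=
| coset_gen i j : coset_alg ((u *m scmx H P *m adj u) i j)
| coset_one : coset_alg 1
| coset_lin (a : C) x y : coset_alg x -> coset_alg y -> coset_alg (a *: x + y)
| coset_mul x y : coset_alg x -> coset_alg y -> coset_alg (x * y)
| coset_adjoint m (w : 'M[H]_m) i j x : ucorep w -> coset_alg x ->
    coset_alg ((w *m x%:M *m adj w) i j).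

Hypothesis uu : ucorep u.

Lemma coset_submodule : submodule coset_alg.
Proof.
split; last by move=> a x y; exact: coset_lin.
by have := coset_lin (-1) coset_one coset_one; rewrite scaleN1r addNr.
Qed.

Let in_tensorD (t t' : H ⊗ H) : in_tensor setT coset_alg t ->
  in_tensor setT coset_alg t' -> in_tensor setT coset_alg (t + t').
Proof.
move=> [s hs ->] [s' hs' ->]; exists (s ++ s'); last by rewrite big_cat.
by move=> p; rewrite mem_cat => /orP [/hs|/hs'].
Qed.

Let in_tensor0 : in_tensor setT coset_alg (0 : H ⊗ H).
Proof. by exists [::] => //; rewrite big_nil. Qed.

Let in_tensor_sum (I : Type) (r : seq I) (Q : pred I) (F : I -> H ⊗ H) :
  (forall i, Q i -> in_tensor setT coset_alg (F i)) ->
  in_tensor setT coset_alg (\sum_(i <- r | Q i) F i).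
Proof. by move=> h; elim/big_ind: _ => //; exact: in_tensorD. Qed.

Let in_tensor_tens (a x : H) : coset_alg x -> in_tensor setT coset_alg (tens a x).
Proof.
move=> Ax; exists [:: (a, x)]; last by rewrite big_seq1.
by move=> p; rewrite inE => /eqP ->.
Qed.

(** The first legs of the entries of w and of its adjoint move to the outside, and their second legs
    conjugate M again. This is why the adjoint action preserves left coideals. *)
Lemma comul_conj m (w M : 'M[H]_m) i j : ucorep w ->
  comul ((w *m M *m adj w) i j) = \sum_r \sum_t tens (w i r) 1 *
    (\sum_l \sum_p tens 1 (w r p) * comul (M p l) * tens 1 (star (w t l))) *
    tens (star (w j t)) 1.
Proof.
move=> [[cw _] _].
have bs : balanced (fun a b : H => tens (star a) (star b)).
  by split=> [b y z|b y z|a b c]; rewrite ?starD ?tensDl ?tensDr// !starZ tensZl tensZr.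
have cs k l : comul (star (w k l)) = \sum_t tens 1 (star (w t l)) * tens (star (w k t)) 1.
  rewrite comul_star cw /tmap (tsum_sum _ _ _ bs); apply: eq_bigr => t _.
  by rewrite (tsum_tens _ _ bs) tensM mul1r mulr1.
have cw' k l : comul (w k l) = \sum_r tens (w k r) 1 * tens 1 (w r l).
  by rewrite cw; apply: eq_bigr => r _; rewrite tensM mul1r mulr1.
rewrite mxE raddf_sum /=.
transitivity (\sum_l \sum_p \sum_r \sum_t tens (w i r) 1 *
    (tens 1 (w r p) * comul (M p l) * tens 1 (star (w t l))) * tens (star (w j t)) 1).
  apply: eq_bigr => l _; rewrite mxE mulr_suml raddf_sum; apply: eq_bigr => p _ /=.
  rewrite !comulM [adj w l j]mxE cs cw' !mulr_suml; apply: eq_bigr => r _.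
  by rewrite mulr_sumr; apply: eq_bigr => t _; rewrite !mulrA.
have E (F : 'I_m -> 'I_m -> 'I_m -> 'I_m -> H ⊗ H) :
    \sum_l \sum_p \sum_r \sum_t F l p r t = \sum_r \sum_t \sum_l \sum_p F l p r t.
  under eq_bigr do rewrite exchange_big.
  rewrite exchange_big; apply: eq_bigr => r _ /=.
  under eq_bigr do rewrite exchange_big.
  by rewrite exchange_big.
rewrite E; apply: eq_bigr => r _; apply: eq_bigr => t _.
rewrite mulr_sumr mulr_suml; apply: eq_bigr => l _.
by rewrite mulr_sumr mulr_suml.
Qed.

Lemma comul_conj_sc m (w : 'M[H]_m) (T : 'M[C]_m) i j : ucorep w ->
  comul ((w *m scmx H T *m adj w) i j) =
  \sum_r \sum_t tens (w i r * star (w j t)) ((w *m scmx H T *m adj w) r t).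
Proof.
move=> uw; rewrite comul_conj//; apply: eq_bigr => r _; apply: eq_bigr => t _.
transitivity (tens (w i r) 1 * tens 1 ((w *m scmx H T *m adj w) r t) *
    tens (star (w j t)) 1); last by rewrite !tensM !mulr1 mul1r.
congr (_ * _ * _); rewrite mxE tens_sumr; apply: eq_bigr => l _.
rewrite mxE mulr_suml tens_sumr; apply: eq_bigr => p _.
rewrite mxE /= linearZ /= (comul_monoid_morphism H).1 -[X in _ *: X]/(tens 1 1) -tensZr.
by rewrite !tensM !mulr1 mxE.
Qed.

(** The second leg of a generator u P u^* is again such a generator, and products and the adjoint
    action preserve left coideals. *)
Lemma coset_comul x : coset_alg x -> in_tensor setT coset_alg (comul x).
Proof.
elim=> {x} [i j||a x y _ hx _ hy|x y _ [s hs ex] _ [t ht ey]|m w i j x uw Ax [s hs ex]].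
- rewrite comul_conj_sc//; apply: in_tensor_sum => r _; apply: in_tensor_sum => t _.
  exact/in_tensor_tens/coset_gen.
- by rewrite (comul_monoid_morphism H).1; apply: in_tensor_tens; exact: coset_one.
- rewrite linearP; apply: in_tensorD => //; case: hx => s hs ->.
  rewrite scaler_sumr big_seq; apply: in_tensor_sum => p ps.
  by rewrite -tensZl; apply: in_tensor_tens; case: (hs _ ps).
- rewrite comulM ex ey mulr_suml big_seq; apply: in_tensor_sum => p ps.
  rewrite mulr_sumr big_seq; apply: in_tensor_sum => p' ps'.
  rewrite tensM; apply: in_tensor_tens; apply: coset_mul.
    by case: (hs _ ps).
  by case: (ht _ ps').
- rewrite comul_conj//; apply: in_tensor_sum => r _; apply: in_tensor_sum => t _.
  have -> : \sum_l \sum_p tens 1 (w r p) * comul ((x%:M : 'M[H]_m) p l) * tens 1 (star (w t l)) =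
      \sum_(c <- s) tens c.1 ((w *m c.2%:M *m adj w) r t).
    transitivity (\sum_l \sum_(c <- s) tens c.1 (w r l * c.2 * star (w t l))).
      apply: eq_bigr => l _; rewrite (bigD1 l)//= big1 ?addr0; last first.
        by move=> p ne; rewrite mxE (negPf ne) mulr0n linear0 mulr0 mul0r.
      rewrite mxE eqxx mulr1n ex mulr_sumr mulr_suml; apply: eq_bigr => c _.
      by rewrite !tensM mul1r mulr1.
    rewrite exchange_big; apply: eq_bigr => c _ /=; rewrite mxE tens_sumr.
    apply: eq_bigr => l _; congr (tens _ _); rewrite [adj w l t]mxE; congr (_ * _).
    rewrite mxE (bigD1 l)//= big1 ?addr0; first by rewrite mxE eqxx.
    by move=> p ne; rewrite mxE (negPf ne) mulr0n mulr0.
  rewrite mulr_sumr mulr_suml big_seq; apply: in_tensor_sum => c cs.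
  rewrite !tensM mulr1 mul1r; apply: in_tensor_tens; apply: coset_adjoint => //.
  by case: (hs _ cs).
Qed.

Lemma coset_lact f x : coset_alg x -> coset_alg (lact f x).
Proof.
move=> /coset_comul [s hs e]; rewrite /lact e raddf_sum big_seq.
apply: submodule_sum; [exact: coset_submodule|move=> p ps /=; rewrite contractl_tens].
by apply: (submoduleZ _ coset_submodule); case: (hs _ ps).
Qed.

Lemma coset_star x : P ^t* = P -> coset_alg x -> coset_alg (star x).
Proof.
move=> hP; elim=> {x} [i j||a x y _ hx _ hy|x y _ hx _ hy|m w i j x uw Ax hx].
- have -> : star ((u *m scmx H P *m adj u) i j) = (u *m scmx H P *m adj u) j i.
    by rewrite -adjE !adjM adjK adj_scmx hP mulmxA.
  exact: coset_gen.
- by rewrite star1; exact: coset_one.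
- by rewrite starD starZ; exact: coset_lin.
- by rewrite starM; exact: coset_mul.
- have -> : star ((w *m x%:M *m adj w) i j) = (w *m (star x)%:M *m adj w) j i.
    rewrite -adjE !adjM adjK mulmxA; congr ((_ *m _ *m _) _ _).
    by apply/matrixP => a b; rewrite !mxE eq_sym; case: eqP => _; rewrite ?mulr1n ?mulr0n ?raddf0.
  exact: coset_adjoint.
Qed.

(** Since q(u) is unitary and commutes with P, the generators u P u^* become the scalar matrix P;
    the other constructors keep scalars scalar. *)
Lemma coset_character (H' : hopf_star_algebra R) (q : hopf_star_morphism H H') x :
  map_mx q u *m scmx H' P = scmx H' P *m map_mx q u ->
  coset_alg x -> q x = counit x *: 1.
Proof.
move=> com.
have qsc m k (A : 'M[C]_(m, k)) : map_mx q (scmx H A) = scmx H' A.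
  by apply/matrixP => i j; rewrite !mxE /= linearZ /= rmorph1.
have qadj m (w : 'M[H]_m) : map_mx q (adj w) = adj (map_mx q w).
  by apply/matrixP => i j; rewrite !mxE hopf_fun_star.
elim=> {x} [i j||a x y _ hx _ hy|x y _ hx _ hy|m w i j x uw Ax hx].
- have -> : counit ((u *m scmx H P *m adj u) i j) = P i j.
    by rewrite counit_conj// mxE /= scalarZ counit1 mulr1.
  transitivity (map_mx q (u *m scmx H P *m adj u) i j); first by rewrite [RHS]mxE.
  rewrite !map_mxM /= qsc com -mulmxA qadj ucorepVr ?mulmx1 ?mxE//.
  exact: map_ucorep.
- by rewrite rmorph1 counit1 scale1r.
- by rewrite [q _]linearP /= hx hy [counit (_ + _)]linearP /= scalerDl scalerA.
- by rewrite rmorphM /= hx hy counitM -scalerAl mul1r scalerA.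
- transitivity (map_mx q (w *m x%:M *m adj w) i j); first by rewrite [RHS]mxE.
  rewrite !map_mxM map_scalar_mx /= hx.
  have -> : (counit x *: (1 : H'))%:M = scmx H' ((counit x)%:M) :> 'M[H']_m.
    apply/matrixP => a b; rewrite mxE [RHS]mxE [X in in_alg _ X]mxE /=.
    by case: (a == b); rewrite ?mulr1n ?mulr0n ?scale0r.
  have -> : map_mx q w *m scmx H' ((counit x)%:M) = scmx H' ((counit x)%:M) *m map_mx q w.
    apply/matrixP => a b; rewrite mulmx_sc mulsc_mx.
    rewrite (bigD1 b)//= big1 ?addr0; last first.
      by move=> k ne; rewrite mxE (negPf ne) mulr0n scale0r.
    rewrite [RHS](bigD1 a)//= [X in _ + X]big1 ?addr0 ?mxE ?eqxx//.
    by move=> k ne; rewrite !mxE eq_sym (negPf ne) mulr0n scale0r.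
  rewrite -mulmxA qadj ucorepVr; last exact: map_ucorep.
  rewrite mulmx1 counit_conj// !mxE.
  by case: (i == j); rewrite /= ?mulr1n ?mulr0n ?linear0 ?scale0r.
Qed.

End CosetAlgebra.

(** * The Hopf *-ideal generated by A(P)^+ *)

Section CosetIdeal.
Variables (R : realType) (H : cqg_algebra R) (n : nat) (u : 'M[H]_n).
Variable P : 'M[R[i]]_n.
Local Notation C := R[i].
Hypothesis uu : ucorep u.
Hypothesis hP : P ^t* = P.

Let sp : unitarily_spanned H := @cqg_spanned R H.
Local Notation A := (coset_alg u P).

(** Defined only as the right ideal generated by A(P)^+; each closure property of a Hopf *-ideal is
    then derived from the corresponding property of A(P). *)
Definition coset_ideal : set H := [set x | exists s : seq (H * H),
  (forall p, p \in s -> A p.1 /\ counit p.1 = 0) /\ x = \sum_(p <- s) p.1 * p.2].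

Lemma coset_ideal_submodule : submodule coset_ideal.
Proof.
split; first by exists [::]; rewrite big_nil.
move=> a x y [s [hs ->]] [t [ht ->]].
exists ([seq (p.1, a *: p.2) | p <- s] ++ t); split.
  by move=> p; rewrite mem_cat => /orP [/mapP [p' /hs ? ->]|/ht].
rewrite big_cat big_map scaler_sumr; congr (_ + _).
by apply: eq_bigr => p _; rewrite -scalerAr.
Qed.

Lemma coset_ideal_gen a x : A a -> counit a = 0 -> coset_ideal (a * x).
Proof.
move=> Aa a0; exists [:: (a, x)]; split; last by rewrite big_seq1.
by move=> p; rewrite inE => /eqP ->.
Qed.

Lemma coset_ideal_ind (Q : set H) : submodule Q ->
  (forall a x, A a -> counit a = 0 -> Q (a * x)) -> forall x, coset_ideal x -> Q x.
Proof.
move=> sQ h x [s [hs ->]]; rewrite big_seq; apply: submodule_sum => // p ps.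
by have [] := hs _ ps; exact: h.
Qed.

Lemma coset_augmentation a : A a -> A (a - counit a *: 1) /\ counit (a - counit a *: 1) = 0.
Proof.
move=> Aa; split; last by rewrite linearB /= scalarZ counit1 mulr1 subrr.
rewrite addrC -scaleNr; apply: coset_lin => //; exact: coset_one.
Qed.

Lemma coset_augmentation_ideal a : A a -> coset_ideal (a - counit a *: 1).
Proof.
move=> /coset_augmentation [h h0]; rewrite -[_ - _]mulr1.
exact: coset_ideal_gen.
Qed.

Lemma coset_ideal_mulr x y : coset_ideal x -> coset_ideal (x * y).
Proof.
move=> [s [hs ->]]; exists [seq (p.1, p.2 * y) | p <- s]; split.
  by move=> p /mapP [p' /hs ? ->].
by rewrite big_map mulr_suml; apply: eq_bigr => p _; rewrite mulrA.
Qed.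

(* x a = (x_(1) a S(x_(2))) x_(3), and A is stable under the adjoint action. *)
Lemma coset_ideal_mull x y : coset_ideal y -> coset_ideal (x * y).
Proof.
have sI := coset_ideal_submodule.
move: y; apply: coset_ideal_ind => [|a y Aa a0].
  split=> /= [|c y z hy hz]; first by rewrite mulr0; case: sI.
  by rewrite mulrDr -scalerAr; apply: submoduleD => //; exact: submoduleZ.
refine (spanned_ind sp (Q := [set x | coset_ideal (x * (a * y))]) _ _ x).
  split=> /= [|c v z hv hz]; first by rewrite mul0r; case: sI.
  by rewrite mulrDl -scalerAl; apply: submoduleD => //; exact: submoduleZ.
move=> m w i j uw /=.
have : w *m a%:M *m adj w *m w = w *m a%:M by rewrite -mulmxA ucorepVl// mulmx1.
move=> /matrixP/(_ i j); rewrite mxE [RHS]mxE => e.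
have {}e : \sum_k (w *m a%:M *m adj w) i k * w k j = w i j * a.
  rewrite e (bigD1 j)//= big1 ?addr0; first by rewrite mxE eqxx mulr1n.
  by move=> k ne; rewrite mxE (negPf ne) mulr0n mulr0.
rewrite mulrA -e mulr_suml; apply: submodule_sum => // k _; apply: coset_ideal_mulr.
apply: coset_ideal_gen; first exact: coset_adjoint.
by rewrite counit_conj// mxE; case: eqP => _; rewrite ?mulr1n ?mulr0n ?linear0.
Qed.

Lemma coset_ideal_counit x : coset_ideal x -> counit x = 0.
Proof.
move: x; apply: coset_ideal_ind => [|a x _ a0].
  by split=> /= [|c y z hy hz]; rewrite ?linear0// linearP /= hy hz mulr0 addr0.
by rewrite counitM a0 mul0r.
Qed.

Lemma coset_ideal_star x : coset_ideal x -> coset_ideal (star x).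
Proof.
have sI := coset_ideal_submodule.
move: x; apply: coset_ideal_ind => [|a x Aa a0].
  split=> /= [|c y z hy hz]; first by rewrite raddf0; case: sI.
  by rewrite starD starZ; apply: submoduleD => //; exact: submoduleZ.
rewrite starM; apply: coset_ideal_mull; rewrite -[star a]mulr1.
by apply: coset_ideal_gen; [exact: coset_star|rewrite counit_star// a0 rmorph0].
Qed.

(** Since S(a x) = S(x) S(a), it suffices to treat S(a) with a in A(P)^+. From S(a_1) a_2 = 0 one
    gets S(a) as minus the sum of S(a_1) (a_2 - counit(a_2) 1), whose second factors are augmented
    elements of the coideal A(P). *)
Lemma coset_ideal_antipode x : coset_ideal x -> coset_ideal (antipode x).
Proof.
have sI := coset_ideal_submodule.
move: x; apply: coset_ideal_ind => [|a x Aa a0].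
  split=> /= [|c y z hy hz]; first by rewrite linear0; case: sI.
  by rewrite linearP; apply: submoduleD => //; exact: submoduleZ.
rewrite antipodeM//; apply: coset_ideal_mull.
have [s hs ea] := coset_comul uu Aa.
have bl := @antipode_balancedl _ H.
have e1 : \sum_(p <- s) antipode p.1 * p.2 = 0.
  have := antipode_comull a; rewrite a0 scale0r ea (tsum_sum _ _ _ bl) => e; rewrite -[RHS]e.
  by apply: eq_bigr => p _; rewrite (tsum_tens _ _ bl).
have e2 : \sum_(p <- s) antipode p.1 * (counit p.2 *: 1) = antipode a.
  rewrite -[in RHS](ract_counit a) /ract ea (raddf_sum (contractr counit)) (raddf_sum antipode); apply: eq_bigr => p _ /=.
  by rewrite contractr_tens linearZ /= -scalerAr mulr1.
have -> : antipode a = - \sum_(p <- s) antipode p.1 * (p.2 - counit p.2 *: 1).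
  by under eq_bigr do rewrite mulrBr; rewrite sumrB e1 e2 sub0r opprK.
apply: (submoduleN sI); rewrite big_seq; apply: submodule_sum => // p ps.
apply: coset_ideal_mull; apply: coset_augmentation_ideal.
by case: (hs _ ps).
Qed.

Lemma coset_ideal_comul x : coset_ideal x -> exists s t : H ⊗ H,
  [/\ in_tensor coset_ideal setT s, in_tensor setT coset_ideal t & comul x = s + t].
Proof.
pose B := [set t : H ⊗ H | exists s t', [/\ in_tensor coset_ideal setT s,
  in_tensor setT coset_ideal t' & t = s + t']].
have sI := coset_ideal_submodule.
have BD s t : B s -> B t -> B (s + t).
  move=> [s1 [s2 [[l1 h1 ->] [l2 h2 ->] ->]]] [t1 [t2 [[k1 g1 ->] [k2 g2 ->] ->]]].
  exists (\sum_(p <- l1 ++ k1) tens p.1 p.2), (\sum_(p <- l2 ++ k2) tens p.1 p.2).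
  split; last by rewrite !big_cat addrACA.
    by exists (l1 ++ k1) => // p; rewrite mem_cat => /orP [/h1|/g1].
  by exists (l2 ++ k2) => // p; rewrite mem_cat => /orP [/h2|/g2].
have z1 : in_tensor coset_ideal setT (0 : H ⊗ H) by exists [::]; rewrite ?big_nil.
have z2 : in_tensor setT coset_ideal (0 : H ⊗ H) by exists [::]; rewrite ?big_nil.
have B0 : B 0 by exists 0, 0; rewrite addr0.
have Bl y z : coset_ideal y -> B (tens y z).
  move=> Iy; exists (tens y z), 0; rewrite addr0; split=> //.
  by exists [:: (y, z)]; rewrite ?big_seq1// => p; rewrite inE => /eqP ->.
have Br y z : coset_ideal z -> B (tens y z).
  move=> Iz; exists 0, (tens y z); rewrite add0r; split=> //.
  by exists [:: (y, z)]; rewrite ?big_seq1// => p; rewrite inE => /eqP ->.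
have Bsum (I : eqType) (r : seq I) (F : I -> H ⊗ H) :
    (forall i, i \in r -> B (F i)) -> B (\sum_(i <- r) F i).
  by move=> h; rewrite big_seq; elim/big_ind: _.
move=> [s [hs ->]]; suff : B (comul (\sum_(p <- s) p.1 * p.2)) by [].
rewrite raddf_sum; apply: (Bsum) => -[a y] /hs /= [Aa a0].
have [l hl ea] := coset_comul uu Aa.
(* Subtracting counits in the second leg leaves the term a ⊗ 1 in I ⊗ H and puts all others in H ⊗
   I. *)
have ea' : comul a = tens a 1 + \sum_(p <- l) tens p.1 (p.2 - counit p.2 *: 1).
  rewrite -[in RHS](ract_counit a) /ract ea raddf_sum tens_suml -big_split.
  apply: eq_bigr => p _ /=; rewrite contractr_tens tensZl -tensZr -tensDr.
  by rewrite addrC addrNK.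
rewrite comulM ea' mulrDl; apply: BD.
  have [k [b [c ->]]] := tensor_sum (comul y); rewrite mulr_sumr.
  by apply: (Bsum) => i _; rewrite tensM; apply/Bl/coset_ideal_gen.
rewrite mulr_suml; apply: (Bsum) => p pl.
have [k [b [c ->]]] := tensor_sum (comul y); rewrite mulr_sumr.
apply: (Bsum) => i _; rewrite tensM; apply/Br/coset_ideal_mulr.
by apply: coset_augmentation_ideal; case: (hl _ pl).
Qed.

Definition coset_hopf_ideal : hopf_ideal H :=
  HopfIdeal coset_ideal_submodule coset_ideal_mull coset_ideal_mulr
    coset_ideal_counit coset_ideal_antipode coset_ideal_star coset_ideal_comul.

(** * The Haar splitting of H along A(P) *)

Section Orthogonal.
Variable h : {scalar H}.
Hypothesis hh : haar h.

(** As A(P) is closed under star, this is the orthogonal complement of A(P) for the form h(a^*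
    y). *)
Definition coset_orth : set H := [set y | forall a, A a -> h (a * y) = 0].

Lemma coset_orth_submodule : submodule coset_orth.
Proof.
split=> [a _|a x y hx hy b Ab]; first by rewrite mulr0 linear0.
by rewrite mulrDr -scalerAr linearP /= hx// hy// mulr0 addr0.
Qed.

Lemma coset_orth_mull a y : A a -> coset_orth y -> coset_orth (a * y).
Proof. by move=> Aa hy b Ab; rewrite mulrA; apply: hy; exact: coset_mul. Qed.

Lemma mul_functional_scalar (f : {scalar H}) (x : H) : scalar (fun y => f (y * x)).
Proof. by move=> a y z; rewrite mulrDl -scalerAl linearP. Qed.
Lemma functional_mul_scalar (f : {scalar H}) (x : H) : scalar (fun y => f (x * y)).
Proof. by move=> a y z; rewrite mulrDr -scalerAr linearP. Qed.

Lemma contractl_mul (f : {scalar H}) (t : H ⊗ H) x y :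
  contractl f (t * tens x y) = contractl (mk_scalar (mul_functional_scalar f x)) t * y.
Proof.
elim/tens_ind: t => [|s t hs ht|a b].
- by rewrite mul0r !linear0 mul0r.
- by rewrite mulrDl !linearD /= hs ht mulrDl.
by rewrite tensM !contractl_tens scalerAl.
Qed.

Lemma contractr_mul (f : {scalar H}) (t : H ⊗ H) x y :
  contractr f (tens x y * t) = x * contractr (mk_scalar (functional_mul_scalar f y)) t.
Proof.
elim/tens_ind: t => [|s t hs ht|a b].
- by rewrite mulr0 !linear0 mulr0.
- by rewrite mulrDr !linearD /= hs ht mulrDr.
by rewrite tensM !contractr_tens scalerAr.
Qed.

(** Invariance reads h(a_1 x_1) a_2 x_2 = h(a x) 1. For x an entry of w, unitarity cancels the
    factor x_2 and leaves an expression lying in every left coideal that contains a. *)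
Lemma haar_projection m (w : 'M[H]_m) a k l : ucorep w ->
  \sum_j h (a * w k j) *: star (w l j) =
  lact (mk_scalar (mul_functional_scalar h (w k l))) a.
Proof.
move=> uw; have [_ hl _] := hh.
have e j : h (a * w k j) *: 1 =
    \sum_p lact (mk_scalar (mul_functional_scalar h (w k p))) a * w p j.
  rewrite -hl /lact comulM; have [[-> _] _] := uw.
  by rewrite mulr_sumr raddf_sum; apply: eq_bigr => p _ /=; rewrite contractl_mul.
transitivity (\sum_j \sum_p lact (mk_scalar (mul_functional_scalar h (w k p))) a *
    (w p j * star (w l j))).
  apply: eq_bigr => j _; rewrite -[star _]mul1r scalerAl e mulr_suml.
  by apply: eq_bigr => p _; rewrite mul1r mulrA.
rewrite exchange_big (bigD1 l)//= [X in _ + X]big1 ?addr0.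
  rewrite -mulr_sumr; have /matrixP/(_ l l) := ucorepVr uw; rewrite !mxE eqxx.
  by under eq_bigr do rewrite mxE; move=> ->; rewrite mulr1.
move=> p ne; rewrite -mulr_sumr; have /matrixP/(_ p l) := ucorepVr uw.
rewrite !mxE (negPf ne); under eq_bigr do rewrite mxE.
by move=> ->; rewrite mulr0.
Qed.

Definition coset_vectors m (w : 'M[H]_m) : set 'cV[C]_m :=
  [set eta | forall l, A ((w *m scmx H eta) l 0)].

Lemma coset_vectors_submodule m (w : 'M[H]_m) : submodule (coset_vectors w).
Proof.
have [A0 Al] := coset_submodule u P.
split=> [l|a x y hx hy l]; first by rewrite scmx0 mulmx0 mxE.
have -> : (w *m scmx H (a *: x + y)) l 0 =
    a *: (w *m scmx H x) l 0 + (w *m scmx H y) l 0.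
  rewrite !mulmx_sc scaler_sumr -big_split; apply: eq_bigr => k _ /=.
  by rewrite !mxE scalerDl scalerA.
exact: Al.
Qed.

Lemma coset_vectors_orth m (w : 'M[H]_m) (eta : 'cV[C]_m) : ucorep w ->
  (forall v, coset_vectors w v -> hs v eta = 0) ->
  forall k, coset_orth ((w *m scmx H eta) k 0).
Proof.
move=> uw ort k a Aa; rewrite mulmx_sc mulr_sumr.
(* Pairing with this [v] computes h(a (w eta)_k), and [haar_projection] places [v] in
   [coset_vectors w]. *)
pose v : 'cV[C]_m := \col_j Num.conj (h (a * w k j)).
have <- : hs v eta = 0.
  apply: ort => l; rewrite mulmx_sc.
  have -> : \sum_j v j 0 *: w l j = star (\sum_j h (a * w k j) *: star (w l j)).
    by rewrite raddf_sum; apply: eq_bigr => j _; rewrite /= starZ starK mxE.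
  by rewrite haar_projection//; apply: coset_star => //; exact: coset_lact.
rewrite hsE big_ord1 raddf_sum; apply: eq_bigr => j _ /=.
rewrite mxE -scalerAr scalarZ mulrC; congr (_ * _).
by apply/esym/conjCK.
Qed.

(** The infinite-dimensional projection is obtained inside one unitary corepresentation: splitting
    the vector eta orthogonally along [coset_vectors w] splits the coefficient. *)
Lemma coset_decomposition x : exists a y, [/\ A a, coset_orth y & x = a + y].
Proof.
have [m [w [xi [eta [f [uw _ ->]]]]]] := ucorep_coefficient x.
have [y [z [Ny oz ->]]] := orthogonal_decomposition eta (hs_inner_product R m 1)
  (coset_vectors_submodule w).
exists ((scmx H xi *m (w *m scmx H y)) 0 0), ((scmx H xi *m (w *m scmx H z)) 0 0).
split.
- rewrite mulsc_mx; apply: submodule_sum; first exact: coset_submodule.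
  by move=> k _; apply: (submoduleZ _ (coset_submodule u P)); exact: Ny.
- rewrite mulsc_mx; apply: submodule_sum; first exact: coset_orth_submodule.
  move=> k _; apply: (submoduleZ _ coset_orth_submodule).
  exact: coset_vectors_orth.
- rewrite -mulmxA !mulsc_mx -big_split; apply: eq_bigr => k _ /=.
  rewrite -scalerDr !mulmx_sc -big_split; congr (_ *: _); apply: eq_bigr => j _ /=.
  by rewrite mxE scalerDl.
Qed.

(** Let n be a column z eta with entries in A(P), z unitary. Invariance of h applied to n_i y = 0
    under h gives z F = 0 for F_k = y_1 h(n_k y_2); as z is invertible, F = 0, and f(F_k) is what
    has to vanish. *)
Lemma coset_orth_lact f y : coset_orth y -> coset_orth (lact f y).
Proof.
move=> hy a Aa; have [_ _ hr] := hh.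
have [m [z [xi [eta [g [uz hg ea]]]]]] := ucorep_coefficient a.
pose n' k := (z *m scmx H eta) k 0.
have An k : A (n' k) by rewrite /n' hg; exact: coset_lact.
pose F k := contractr (mk_scalar (functional_mul_scalar h (n' k))) (comul y).
have cn i : comul (n' i) = \sum_k tens (z i k) (n' k).
  rewrite /n' mulmx_sc linear_sum; have [[cz _] _] := uz.
  under eq_bigr do rewrite linearZ /= cz scaler_sumr.
  rewrite exchange_big; apply: eq_bigr => k _ /=; rewrite mulmx_sc tens_sumr.
  by apply: eq_bigr => l _; rewrite tensZr.
have zF i : \sum_k z i k * F k = 0.
  have := hr (n' i * y); rewrite (hy _ (An i)) scale0r /ract comulM cn mulr_suml.
  rewrite raddf_sum => e; rewrite -[RHS]e; apply: eq_bigr => k _ /=.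
  by rewrite contractr_mul.
have F0 k : F k = 0.
  pose Fc : 'cV[H]_m := \col_k F k.
  have : z *m Fc = 0.
    apply/colP => i; rewrite !mxE -[RHS](zF i).
    by apply: eq_bigr => l _; rewrite mxE.
  move=> /(congr1 (mulmx (adj z))); rewrite mulmxA ucorepVl// mul1mx mulmx0.
  by move=> /colP/(_ k); rewrite !mxE.
have -> : a = \sum_k xi 0 k *: n' k by rewrite {1}ea -mulmxA mulsc_mx.
rewrite mulr_suml raddf_sum big1// => k _ /=; rewrite -scalerAl scalarZ.
have -> : h (n' k * lact f y) = f (F k).
  by rewrite -[LHS]/(mk_scalar (functional_mul_scalar h (n' k)) _) functional_lact.
by rewrite F0 linear0 mulr0.
Qed.

(** For the column b = w eta, unitarity evaluates the sum of h(b_l^* b_l) to the squared norm of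
    eta. This explicit value does the work of faithfulness of h. *)
Lemma coset_cap_orth a : A a -> coset_orth a -> a = 0.
Proof.
move=> Aa oa; have [h1 _ _] := hh.
have [m [w [xi [eta [f [uw hf ->]]]]]] := ucorep_coefficient a.
pose b := w *m scmx H eta.
have Ab l : A (b l 0) by rewrite /b hf; exact: coset_lact.
have ob l : coset_orth (b l 0) by rewrite /b hf; exact: coset_orth_lact.
have : \sum_l h (star (b l 0) * b l 0) = 0.
  by rewrite big1// => l _; apply: ob; exact: coset_star.
have -> : \sum_l h (star (b l 0) * b l 0) = hs eta eta.
  transitivity (h ((adj b *m b) 0 0)).
    by rewrite [in RHS]mxE raddf_sum; apply: eq_bigr => l _; rewrite adjE.
  rewrite /b adjM mulmxA -[_ *m adj w *m w]mulmxA ucorepVl// mulmx1 adj_scmx -scmxM.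
  by rewrite mxE /= scalarZ h1 mulr1 /hs /mxtrace big_ord1.
have [_ _ hpos] := hs_inner_product R m 1.
have [-> _|/hpos] := eqVneq eta 0; first by rewrite scmx0 mulmx0 mxE.
by move=> /[swap] ->; rewrite ltxx.
Qed.

(** Split the right factor as A(P) plus its complement: A(P)^+ A(P) lies in A(P)^+, and A(P)
    preserves the complement. *)
Lemma coset_ideal_decomposition x : coset_ideal x ->
  exists a y, [/\ A a, counit a = 0, coset_orth y & x = a + y].
Proof.
have sA := coset_submodule u P; have sO := coset_orth_submodule.
move: x; apply: (@coset_ideal_ind [set x |
  exists a y, [/\ A a, counit a = 0, coset_orth y & x = a + y]]).
  split=> /=; first by exists 0, 0; rewrite linear0 addr0; split=> //; [case: sA|case: sO].
  move=> c x y [a [z [Aa a0 oz ->]]] [b [t [Ab b0 ot ->]]].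
  exists (c *: a + b), (c *: z + t); rewrite scalerDr addrACA linearP /= a0 b0 mulr0 addr0.
  by split=> //; [case: sA => _; apply|case: sO => _; apply].
move=> a x Aa a0; have [b [y [Ab oy ->]]] := coset_decomposition x.
exists (a * b), (a * y); rewrite mulrDr counitM a0 mul0r; split=> //.
  exact: coset_mul.
exact: coset_orth_mull.
Qed.

(** Write x through w eta and split eta = y + z along [coset_vectors w]. Coinvariance puts (w z)_l -
    z_l 1 in the ideal, hence equal to a + t with a in A(P)^+ and t orthogonal. Then a + z_l 1 lies
    both in A(P) and in its complement, so it is 0, and the counit gives z_l = 0. *)
Lemma coset_ideal_coinvariants x :
  (forall f : {scalar H}, coset_ideal (lact f x - f x *: 1)) -> A x.
Proof.
move=> hx; have [m [w [xi [eta [f [uw hf ex]]]]]] := ucorep_coefficient x.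
have sI := coset_ideal_submodule.
have counitw (v : 'cV[C]_m) l : counit ((w *m scmx H v) l 0) = v l 0.
  rewrite mulmx_sc raddf_sum (bigD1 l)//= scalarZ; have [[_ ew] _] := uw.
  rewrite ew eqxx mulr1 big1 ?addr0// => k ne.
  by rewrite scalarZ ew eq_sym (negPf ne) mulr0.
have [y [z [Ny oz eyz]]] := orthogonal_decomposition eta (hs_inner_product R m 1)
  (coset_vectors_submodule w).
suff z0 : z = 0.
  rewrite ex -mulmxA mulsc_mx; apply: submodule_sum; first exact: coset_submodule.
  move=> k _; apply: (submoduleZ _ (coset_submodule u P)).
  by rewrite eyz z0 addr0; exact: Ny.
apply/colP => l; rewrite [RHS]mxE.
have wD : (w *m scmx H z) l 0 = (w *m scmx H eta) l 0 - (w *m scmx H y) l 0.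
  rewrite !mulmx_sc -sumrB; apply: eq_bigr => k _.
  by rewrite eyz [in RHS]mxE scalerDl addrAC subrr add0r.
have : coset_ideal ((w *m scmx H z) l 0 - z l 0 *: 1).
  have zE : z l 0 = eta l 0 - y l 0 by rewrite eyz mxE addrAC subrr add0r.
  have e1 : coset_ideal ((w *m scmx H eta) l 0 - eta l 0 *: 1).
    by have := hx (f l); rewrite -counit_lact -hf counitw.
  have := coset_augmentation_ideal (Ny l); rewrite counitw => /(submoduleB sI e1).
  congr coset_ideal; rewrite wD zE scalerBl !opprB addrACA [RHS]addrACA.
  by congr (_ + _); rewrite addrC.
move=> /coset_ideal_decomposition [a [t [Aa a0 ot e]]].
have e' : (w *m scmx H z) l 0 - t = a + z l 0 *: 1.
  by move/eqP: e; rewrite subr_eq => /eqP ->; rewrite [a + t + _]addrAC addrK.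
have Ab : A (a + z l 0 *: 1) by rewrite addrC; apply: coset_lin => //; exact: coset_one.
have ob : coset_orth (a + z l 0 *: 1).
  rewrite -e'; apply: (submoduleB coset_orth_submodule) => //.
  exact: coset_vectors_orth.
have := congr1 counit (coset_cap_orth Ab ob).
by rewrite linear0 linearD /= a0 scalarZ counit1 mulr1 add0r.
Qed.

End Orthogonal.

(** The coinvariants of q contain A(P) by [coset_character]. By the universal property the
    projection to the quotient by the coset ideal factors through q, so they are also contained in
    the coinvariants of that projection, which lie in A(P). *)
Lemma coset_coinvariants (Q : hopf_star_algebra R) (q : hopf_star_morphism H Q) :
  map_mx q u *m scmx Q P = scmx Q P *m map_mx q u ->
  (forall (H' : cqg_algebra R) (f : hopf_star_morphism H H'),
     map_mx f u *m scmx H' P = scmx H' P *m map_mx f u ->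
     exists g : hopf_star_morphism Q H', forall x, g (q x) = f x) ->
  forall x, (forall f : {scalar H}, q (lact f x) = f x *: 1) <-> A x.
Proof.
move=> qP univ x; split=> [hx|Ax f]; last first.
  by rewrite (coset_character uu qP) ?counit_lact//; exact: coset_lact.
pose I := coset_hopf_ideal; pose D := quotient_cqg I sp.
pose p : hopf_star_morphism H D := quotient_morphism I.
have [h hh] := haar_exists sp; apply: (coset_ideal_coinvariants hh) => f.
suff : p (lact f x) = p (f x *: 1) by move=> /hopf_projP.
have [|g gq] := univ D p.
  have pA a : A a -> p a = counit a *: 1.
    move=> Aa; have : p a = p (counit a *: 1).
      exact/(hopf_projP I a (counit a *: 1))/coset_augmentation_ideal.
    by rewrite linearZ /= rmorph1.
  have upu : ucorep (map_mx p u) by exact: map_ucorep.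
  (* Modulo the ideal every entry of u P u^* equals its counit, which is the entry of P; unitarity
     turns this into commutation with P. *)
  have e : map_mx p u *m scmx D P *m adj (map_mx p u) = scmx D P.
    apply/matrixP => i j.
    have psc : map_mx p (scmx H P) = scmx D P.
      by apply/matrixP => k l; rewrite !mxE /= linearZ /= rmorph1.
    have padj : map_mx p (adj u) = adj (map_mx p u).
      by apply/matrixP => k l; rewrite !mxE hopf_fun_star.
    transitivity (p ((u *m scmx H P *m adj u) i j)).
      by rewrite -psc -padj -!map_mxM [LHS]mxE.
    rewrite (pA _ (coset_gen u P i j)).
    by rewrite counit_conj// !mxE /= scalarZ counit1 mulr1.
  by rewrite -{2}e -[in RHS]mulmxA ucorepVl// mulmx1.
by rewrite -gq hx linearZ /= rmorph1 linearZ /= rmorph1.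
Qed.

End CosetIdeal.

(** * Algebraic families of invariant vectors and intertwiners *)

Section Families.
Variables (R : realType) (H : cqg_algebra R) (n : nat) (u : 'M[H]_n).
Local Notation C := R[i].
Hypothesis uu : ucorep u.
Variables (X : Type) (reg : (X -> C) -> Prop).
Hypothesis reg_const : forall c, reg (fun=> c).
Hypothesis regD : forall f g, reg f -> reg g -> reg (fun A => f A + g A).
Hypothesis regM : forall f g, reg f -> reg g -> reg (fun A => f A * g A).

(** Finite sums of regular functions times fixed elements of H, that is, the algebraic tensor
    product of the regular functions with H. *)
Inductive regular_element : (X -> H) -> Prop :=
| regular_scale f c : reg f -> regular_element (fun A => f A *: c)
| regular_add a b : regular_element a -> regular_element b ->
    regular_element (fun A => a A + b A).

Lemma regular_element_ext a b : (forall A, a A = b A) ->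
  regular_element a -> regular_element b.
Proof. by move=> /funext ->. Qed.

Lemma regular_element_const c : regular_element (fun=> c).
Proof.
by apply: regular_element_ext (regular_scale c (reg_const 1)) => A; rewrite scale1r.
Qed.

Lemma regular_element_sum (I : Type) (r : seq I) (F : I -> X -> H) :
  (forall i, regular_element (F i)) -> regular_element (fun A => \sum_(i <- r) F i A).
Proof.
move=> h; elim: r => [|i r IH].
  by apply: regular_element_ext (regular_element_const 0) => A; rewrite big_nil.
apply: regular_element_ext (regular_add (h i) IH) => A.
by rewrite big_cons.
Qed.

Lemma regular_elementM a b : regular_element a -> regular_element b ->
  regular_element (fun A => a A * b A).
Proof.
move=> ha hb; elim: ha => {a} [f c rf|a a' _ ha _ ha'].
  elim: hb => {b} [g e rg|b b' _ hb _ hb'].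
    apply: regular_element_ext (regular_scale (c * e) (regM rf rg)) => A.
    by rewrite -scalerAl -scalerAr scalerA.
  by apply: regular_element_ext (regular_add hb hb') => A; rewrite mulrDr.
by apply: regular_element_ext (regular_add ha ha') => A; rewrite mulrDl.
Qed.

Lemma regular_elementZ c a : regular_element a -> regular_element (fun A => c *: a A).
Proof.
elim=> {a} [f e rf|a b _ ha _ hb].
  apply: regular_element_ext (regular_scale e (regM (reg_const c) rf)) => A.
  by rewrite scalerA.
by apply: regular_element_ext (regular_add ha hb) => A; rewrite scalerDr.
Qed.

Lemma regular_functional (f : {scalar H}) a : regular_element a ->
  reg (fun A => f (a A)).
Proof.
elim=> {a} [g c rg|a b _ ha _ hb].
  rewrite (_ : (fun A => _) = fun A => g A * f c); first exact: regM.
  by apply/funext => A; rewrite scalarZ.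
rewrite (_ : (fun A => _) = fun A => f (a A) + f (b A)); first exact: regD.
by apply/funext => A; rewrite linearD.
Qed.

Variable P : X -> 'M[C]_n.
Hypothesis regP : forall i j, reg (fun A => P A i j).

(** By induction on the derivation of membership: the same expression, read with P A in place of P
    A0, is the extension. It depends on the derivation chosen, which is harmless since only
    existence is claimed. *)
Lemma coset_alg_extend A0 x : coset_alg u (P A0) x ->
  exists a, [/\ regular_element a, a A0 = x & forall A, coset_alg u (P A) (a A)].
Proof.
elim=> {x} [i j||c x y _ [a [ra a0 aA]] _ [b [rb b0 bA]]
  |x y _ [a [ra a0 aA]] _ [b [rb b0 bA]]|m w i j x uw _ [a [ra a0 aA]]].
- exists (fun A => (u *m scmx H (P A) *m adj u) i j); split=> // [|A]; last exact: coset_gen.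
  apply: (@regular_element_ext
    (fun A => \sum_k \sum_l P A l k *: (u i l * adj u k j))) => [A|].
    rewrite mxE; apply: eq_bigr => k _; rewrite mulmx_sc mulr_suml.
    by apply: eq_bigr => l _; rewrite scalerAl.
  apply: regular_element_sum => k; apply: regular_element_sum => l.
  exact: regular_scale.
- by exists (fun=> 1); split=> // [|A]; [exact: regular_element_const|exact: coset_one].
- exists (fun A => c *: a A + b A); rewrite a0 b0; split=> // [|A]; last exact: coset_lin.
  by apply: regular_add => //; exact: regular_elementZ.
- exists (fun A => a A * b A); rewrite a0 b0; split=> // [|A]; last exact: coset_mul.
  exact: regular_elementM.
- exists (fun A => (w *m (a A)%:M *m adj w) i j); rewrite a0; split=> // [|A].
    apply: (@regular_element_ext (fun A => \sum_k w i k * a A * adj w k j)) => [A|].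
      rewrite mxE; apply: eq_bigr => k _; congr (_ * _); rewrite mxE (bigD1 k)//= big1.
        by rewrite mxE eqxx addr0.
      by move=> l ne; rewrite mxE (negPf ne) mulr0n mulr0.
    apply: regular_element_sum => k; apply: regular_elementM.
      by apply: regular_elementM => //; exact: regular_element_const.
    exact: regular_element_const.
  exact: coset_adjoint.
Qed.

Hypothesis hP : forall A, (P A) ^t* = P A.
Variables (Q : X -> hopf_star_algebra R) (q : forall A, hopf_star_morphism H (Q A)).
Hypothesis qP : forall A,
  map_mx (q A) u *m scmx (Q A) (P A) = scmx (Q A) (P A) *m map_mx (q A) u.
Hypothesis univ : forall A (H' : cqg_algebra R) (f : hopf_star_morphism H H'),
  map_mx f u *m scmx H' (P A) = scmx H' (P A) *m map_mx f u ->
  exists g : hopf_star_morphism (Q A) H', forall x, g (q A x) = f x.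

Lemma map_scmx (H' : hopf_star_algebra R) (f : hopf_star_morphism H H') m k
  (T : 'M[C]_(m, k)) : map_mx f (scmx H T) = scmx H' T.
Proof. by apply/matrixP => i j; rewrite !mxE /= linearZ /= rmorph1. Qed.

Lemma map_adj (H' : hopf_star_algebra R) (f : hopf_star_morphism H H') m k
  (w : 'M[H]_(m, k)) : map_mx f (adj w) = adj (map_mx f w).
Proof. by apply/matrixP => i j; rewrite !mxE hopf_fun_star. Qed.

(** The entries of u v are coinvariants of q exactly when v is invariant: slicing Δ(u v) leaves u v
    in the second leg, and the counit of u v is v. *)
Lemma invariant_coset A (v : 'cV[C]_n) :
  map_mx (q A) u *m scmx (Q A) v = scmx (Q A) v <->
  forall l, coset_alg u (P A) ((u *m scmx H v) l 0).
Proof.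
have cu : corep u by case: uu.
split=> [e l|h].
  apply/(coset_coinvariants uu (hP A) (qP A) (@univ A)) => f.
  have -> : lact f ((u *m scmx H v) l 0) = \sum_k f (u l k) *: (u *m scmx H v) k 0.
    rewrite mulmx_sc linear_sum; under eq_bigr do rewrite linearZ /= lact_corep// scaler_sumr.
    rewrite exchange_big; apply: eq_bigr => k _ /=; rewrite mulmx_sc scaler_sumr.
    by apply: eq_bigr => j _; rewrite !scalerA mulrC.
  have qe k : q A ((u *m scmx H v) k 0) = v k 0 *: 1.
    have /matrixP/(_ k 0) := e; rewrite -(map_scmx (q A)) -map_mxM [LHS]mxE => ->.
    by rewrite map_scmx mxE.
  rewrite linear_sum mulmx_sc raddf_sum scaler_suml; apply: eq_bigr => k _ /=.
  by rewrite linearZ /= qe scalerA scalarZ mulrC.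
apply/colP => l; have := h l.
move=> /(coset_coinvariants uu (hP A) (qP A) (@univ A)) /(_ counit).
rewrite lact_counit => e; transitivity (q A ((u *m scmx H v) l 0)).
  by rewrite -(map_scmx (q A)) -map_mxM [LHS]mxE.
rewrite e [RHS]mxE /=; congr (_ *: _); rewrite mulmx_sc raddf_sum (bigD1 l)//=.
rewrite scalarZ cu.2 eqxx mulr1 big1 ?addr0// => k ne.
by rewrite scalarZ cu.2 eq_sym (negPf ne) mulr0.
Qed.

(** The same argument with conjugation: commuting with q(u) means that q sends u T u^* to the scalar
    matrix T. *)
Lemma intertwiner_coset A (T : 'M[C]_n) :
  map_mx (q A) u *m scmx (Q A) T = scmx (Q A) T *m map_mx (q A) u <->
  forall i j, coset_alg u (P A) ((u *m scmx H T *m adj u) i j).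
Proof.
have uq : ucorep (map_mx (q A) u) by exact: map_ucorep.
have qconj : map_mx (q A) (u *m scmx H T *m adj u) =
    map_mx (q A) u *m scmx (Q A) T *m adj (map_mx (q A) u).
  by rewrite !map_mxM /= map_scmx map_adj.
split=> [e i j|h].
  apply/(coset_coinvariants uu (hP A) (qP A) (@univ A)) => f.
  have qe r t : q A ((u *m scmx H T *m adj u) r t) = T r t *: 1.
    transitivity (map_mx (q A) (u *m scmx H T *m adj u) r t); first by rewrite [RHS]mxE.
    by rewrite qconj e -mulmxA ucorepVr// mulmx1 mxE.
  have ue : (u *m scmx H T *m adj u) i j = \sum_r \sum_t T r t *: (u i r * star (u j t)).
    rewrite mxE exchange_big; apply: eq_bigr => t _; rewrite mulmx_sc mulr_suml.
    by apply: eq_bigr => r _; rewrite adjE scalerAl.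
  rewrite /lact comul_conj_sc// ue (raddf_sum (contractl f)) (raddf_sum (q A)).
  rewrite (raddf_sum f) scaler_suml; apply: eq_bigr => r _ /=.
  rewrite (raddf_sum (contractl f)) (raddf_sum (q A)) (raddf_sum f) scaler_suml.
  apply: eq_bigr => t _ /=.
  by rewrite contractl_tens linearZ /= qe scalerA scalarZ mulrC.
have e : map_mx (q A) u *m scmx (Q A) T *m adj (map_mx (q A) u) = scmx (Q A) T.
  apply/matrixP => i j; have := h i j.
  move=> /(coset_coinvariants uu (hP A) (qP A) (@univ A)) /(_ counit).
  rewrite lact_counit counit_conj// => e; rewrite -qconj [LHS]mxE e.
  by rewrite !mxE /= scalarZ counit1 mulr1.
by rewrite -{2}e -[in RHS]mulmxA ucorepVl// mulmx1.
Qed.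

Lemma contractl_mull (f : {scalar H}) (t : H ⊗ H) x y :
  contractl f (tens x y * t) = y * contractl (mk_scalar (functional_mul_scalar f x)) t.
Proof.
elim/tens_ind: t => [|s t hs ht|a b].
- by rewrite mulr0 !linear0 mulr0.
- by rewrite mulrDr !linearD /= hs ht mulrDr.
by rewrite tensM !contractl_tens scalerAr.
Qed.

Lemma comul_star_ucorep k l : comul (star (u k l)) = \sum_m tens (star (u k m)) (star (u m l)).
Proof.
have bs : balanced (fun a b : H => tens (star a) (star b)).
  by split=> [b y z|b y z|a b c]; rewrite ?starD ?tensDl ?tensDr// !starZ tensZl tensZr.
have [[cu _] _] := uu; rewrite comul_star cu /tmap (tsum_sum _ _ _ bs).
by apply: eq_bigr => t _; rewrite (tsum_tens _ _ bs).
Qed.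

Lemma row_orthonormal p m : \sum_i u p i * star (u m i) = (p == m)%:R.
Proof.
have /matrixP/(_ p m) := ucorepVr uu; rewrite !mxE => <-.
by apply: eq_bigr => i _; rewrite mxE.
Qed.

(** The mechanism of [haar_projection] with u^* on the left of y: the u-transform of the scalar
    vector h(u^* y) stays in every left coideal containing y. *)
Lemma haar_vector (h : {scalar H}) l p y : haar h ->
  \sum_i h (star (u l i) * y) *: u p i =
  lact (mk_scalar (functional_mul_scalar h (star (u l p)))) y.
Proof.
move=> [_ hl _]; pose g m := lact (mk_scalar (functional_mul_scalar h (star (u l m)))) y.
have e i : h (star (u l i) * y) *: 1 = \sum_m star (u m i) * g m.
  rewrite -hl /lact comulM comul_star_ucorep mulr_suml raddf_sum.
  by apply: eq_bigr => m _ /=; rewrite contractl_mull.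
transitivity (\sum_i \sum_m u p i * star (u m i) * g m).
  apply: eq_bigr => i _; rewrite -[u p i]mulr1 scalerAr e mulr_sumr.
  by apply: eq_bigr => m _; rewrite mulr1 mulrA.
rewrite exchange_big (bigD1 p)//= [X in _ + X]big1 ?addr0.
  by rewrite -mulr_suml row_orthonormal eqxx mul1r.
by move=> m ne; rewrite -mulr_suml row_orthonormal eq_sym (negPf ne) mul0r.
Qed.

Lemma extend_invariant_vector A0 (v : 'cV[C]_n) :
  map_mx (q A0) u *m scmx (Q A0) v = scmx (Q A0) v ->
  exists V : X -> 'cV[C]_n, [/\ forall i, reg (fun A => V A i 0), V A0 = v
    & forall A, map_mx (q A) u *m scmx (Q A) (V A) = scmx (Q A) (V A)].
Proof.
move=> /invariant_coset hv; have [h hh] := haar_exists (@cqg_spanned R H).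
have [a aP] := choice (fun l => coset_alg_extend (hv l)).
(* Integrating u^* a(A) by h gives scalars depending regularly on A. At A0 it returns v, because u^*
   u v = v and h(1) = 1. *)
pose V A : 'cV[C]_n := \col_i \sum_l h (star (u l i) * a l A).
exists V; split=> [i||A].
- rewrite (_ : (fun A => _) = fun A => h (\sum_l star (u l i) * a l A)); last first.
    by apply/funext => A; rewrite mxE raddf_sum.
  apply: regular_functional; apply: regular_element_sum => l.
  by apply: regular_elementM; [exact: regular_element_const|case: (aP l)].
- apply/colP => i; rewrite mxE -raddf_sum.
  have -> : \sum_l star (u l i) * a l A0 = (adj u *m (u *m scmx H v)) i 0.
    rewrite mxE; apply: eq_bigr => l _; rewrite adjE; congr (_ * _).
    by have [_ ->] := aP l.
  rewrite mulmxA ucorepVl// mul1mx mxE /= scalarZ.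
  by have [-> _ _] := hh; rewrite mulr1.
- apply/invariant_coset => p; rewrite mulmx_sc.
  have -> : \sum_k V A k 0 *: u p k =
      \sum_l lact (mk_scalar (functional_mul_scalar h (star (u l p)))) (a l A).
    under [RHS]eq_bigr do rewrite -haar_vector//.
    rewrite exchange_big; apply: eq_bigr => i _ /=.
    by rewrite mxE scaler_suml.
  apply: submodule_sum; first exact: coset_submodule.
  by move=> l _; apply: coset_lact => //; have [_ _] := aP l.
Qed.

(** The two-sided version: conjugating the scalar matrix h(u^* y u) by u again stays in every left
    coideal containing y. *)
Lemma haar_matrix (h : {scalar H}) k l p r y : haar h ->
  \sum_i \sum_j h (star (u k i) * y * u l j) *: (u p i * star (u r j)) =
  lact (mk_scalar (functional_mul_scalar
    (mk_scalar (mul_functional_scalar h (u l r))) (star (u k p)))) y.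
Proof.
move=> [_ hl _]; have [[cu _] _] := uu.
pose g m s := lact (mk_scalar (functional_mul_scalar
    (mk_scalar (mul_functional_scalar h (u l s))) (star (u k m)))) y.
have e i j : h (star (u k i) * y * u l j) *: 1 = \sum_m \sum_s star (u m i) * g m s * u s j.
  rewrite -hl /lact !comulM comul_star_ucorep cu [X in X * _]mulr_suml mulr_suml.
  rewrite (raddf_sum (contractl h)).
  apply: eq_bigr => m _ /=; rewrite mulr_sumr (raddf_sum (contractl h)).
  apply: eq_bigr => s _ /=; by rewrite contractl_mul contractl_mull.
transitivity (\sum_i \sum_j \sum_m \sum_s
   (u p i * star (u m i)) * g m s * (u s j * star (u r j))).
  apply: eq_bigr => i _; apply: eq_bigr => j _.
  transitivity (u p i * (h (star (u k i) * y * u l j) *: 1) * star (u r j)).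
    by rewrite -scalerAr mulr1 scalerAl.
  rewrite e mulr_sumr mulr_suml; apply: eq_bigr => m _.
  rewrite mulr_sumr mulr_suml; apply: eq_bigr => s _.
  by rewrite !mulrA.
have E (F : 'I_n -> 'I_n -> 'I_n -> 'I_n -> H) :
    \sum_i \sum_j \sum_m \sum_s F i j m s = \sum_m \sum_s \sum_i \sum_j F i j m s.
  under eq_bigr do rewrite exchange_big.
  rewrite exchange_big; apply: eq_bigr => m _ /=.
  under eq_bigr do rewrite exchange_big.
  by rewrite exchange_big.
have key m s : \sum_i \sum_j u p i * star (u m i) * g m s * (u s j * star (u r j)) =
    (p == m)%:R * g m s * (s == r)%:R.
  rewrite -!row_orthonormal !mulr_suml; apply: eq_bigr => i _.
  by rewrite mulr_sumr.
rewrite E (bigD1 p)//= (bigD1 r)//= key !eqxx mul1r mulr1 !big1 ?addr0//.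
  move=> m ne; rewrite big1// => s _; rewrite key eq_sym (negPf ne).
  by rewrite !mul0r.
by move=> s ne; rewrite key (negPf ne) mulr0.
Qed.

Lemma extend_intertwiner A0 (T : 'M[C]_n) :
  map_mx (q A0) u *m scmx (Q A0) T = scmx (Q A0) T *m map_mx (q A0) u ->
  exists M : X -> 'M[C]_n, [/\ forall i j, reg (fun A => M A i j), M A0 = T
    & forall A, map_mx (q A) u *m scmx (Q A) (M A) = scmx (Q A) (M A) *m map_mx (q A) u].
Proof.
move=> /intertwiner_coset hT; have [h hh] := haar_exists (@cqg_spanned R H).
have [a aP] := choice (fun kl : 'I_n * 'I_n => coset_alg_extend (hT kl.1 kl.2)).
(* For intertwiners u^* a(A) u is integrated; at A0 the inner u T u^* cancels to T. *)
pose M A : 'M[C]_n := \matrix_(i, j) \sum_k \sum_l h (star (u k i) * a (k, l) A * u l j).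
exists M; split=> [i j||A].
- rewrite (_ : (fun A => _) =
      fun A => h (\sum_k \sum_l star (u k i) * a (k, l) A * u l j)); last first.
    apply/funext => A; rewrite mxE raddf_sum; apply: eq_bigr => k _.
    by rewrite raddf_sum.
  apply: regular_functional; apply: regular_element_sum => k.
  apply: regular_element_sum => l; apply: regular_elementM; last exact: regular_element_const.
  by apply: regular_elementM; [exact: regular_element_const|case: (aP (k, l))].
- apply/matrixP => i j; rewrite mxE.
  have -> : T i j = h ((adj u *m (u *m scmx H T *m adj u) *m u) i j).
    rewrite !mulmxA ucorepVl// mul1mx -mulmxA ucorepVl// mulmx1 mxE /= scalarZ.
    by have [-> _ _] := hh; rewrite mulr1.
  rewrite mxE raddf_sum exchange_big; apply: eq_bigr => l _ /=.
  rewrite mxE mulr_suml raddf_sum; apply: eq_bigr => k _ /=.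
  by rewrite adjE; have [_ /= -> _] := aP (k, l).
- apply/intertwiner_coset => p r.
  have -> : (u *m scmx H (M A) *m adj u) p r = \sum_k \sum_l
      lact (mk_scalar (functional_mul_scalar
        (mk_scalar (mul_functional_scalar h (u l r))) (star (u k p)))) (a (k, l) A).
    under [RHS]eq_bigr do under eq_bigr do rewrite -haar_matrix//.
    have E (F : 'I_n -> 'I_n -> 'I_n -> 'I_n -> H) :
        \sum_i \sum_j \sum_m \sum_s F i j m s = \sum_m \sum_s \sum_i \sum_j F i j m s.
      under eq_bigr do rewrite exchange_big.
      rewrite exchange_big; apply: eq_bigr => m _ /=.
      under eq_bigr do rewrite exchange_big.
      by rewrite exchange_big.
    rewrite E mxE exchange_big; apply: eq_bigr => j _; rewrite mulmx_sc mulr_suml.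
    apply: eq_bigr => i _; rewrite adjE mxE -scalerAl scaler_suml.
    by apply: eq_bigr => k _; rewrite scaler_suml.
  apply: submodule_sum; first exact: coset_submodule.
  move=> k _; apply: submodule_sum; first exact: coset_submodule.
  by move=> l _; apply: coset_lact => //; have [_ _] := aP (k, l).
Qed.

End Families.

(** * Subcomodules in coordinates *)

Section Coordinates.
Variables (R : realType) (V : vectType R[i]) (n : nat) (e : n.-tuple V).
Local Notation C := R[i].
Hypothesis he : basis_of fullv e.

Definition vec (x : 'cV[C]_n) : V := \sum_j x j 0 *: tnth e j.
Definition covec (v : V) : 'cV[C]_n := \col_i coord e i v.

Lemma covecK v : vec (covec v) = v.
Proof.
rewrite [RHS](coord_basis he (memvf v)); apply: eq_bigr => i _.
by rewrite mxE (tnth_nth 0).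
Qed.

Lemma vecK x : covec (vec x) = x.
Proof.
apply/colP => i; rewrite mxE raddf_sum (bigD1 i)//= scalarZ /= coord_tnth// eqxx mulr1.
rewrite big1 ?addr0// => j ne.
by rewrite scalarZ /= coord_tnth// eq_sym (negPf ne) mulr0.
Qed.

End Coordinates.

Section UnitaryBasis.
Variables (R : realType) (H : cqg_algebra R) (V : vectType R[i]).
Local Notation C := R[i].

(** The basis is orthonormal for an invariant inner product: [B'] expresses it in an arbitrary
    basis, where [B] factors the Gram matrix. *)
Lemma comodule_unitary_basis (rho : comodule H V) :
  exists (e : (\dim {:V}).-tuple V) (u : 'M[H]_(\dim {:V})),
    [/\ basis_of fullv e, ucorep u & comodule_matrix rho e u].
Proof.
set n := \dim {:V}; pose b : n.-tuple V := vbasis {:V}.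
have hb : basis_of fullv b := vbasisP _.
have [w cw mw] := comodule_corep rho hb.
have [G pG inv] := unitarizable_gram hb mw (cqg_unitarizable _).
have [B [B' [BB' _ uw]]] := invariant_gram_ucorep cw pG inv.
have B'B := mulmx1C BB'.
pose e : n.-tuple V := [tuple \sum_i B' i j *: tnth b i | j < n].
have eE j : tnth e j = vec b (col j B').
  by rewrite tnth_mktuple; apply: eq_bigr => i _; rewrite mxE.
have veceE x : vec e x = vec b (B' *m x).
  rewrite /vec; under eq_bigr do rewrite eE /vec scaler_sumr.
  rewrite exchange_big; apply: eq_bigr => i _ /=; rewrite mxE scaler_suml.
  by apply: eq_bigr => j _; rewrite mxE scalerA mulrC.
have fr : free e.
  apply/freeP => c h i.
  have : vec e (\col_i c i) = 0.
    by rewrite -[RHS]h; apply: eq_bigr => j _; rewrite mxE (tnth_nth 0).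
  rewrite veceE => /(congr1 (covec b)); rewrite vecK// => /(congr1 (mulmx B)).
  rewrite mulmxA BB' mul1mx => /colP/(_ i); rewrite mxE => ->.
  by rewrite !mxE big1// => j _; rewrite !mxE linear0 mulr0.
have he : basis_of fullv e by rewrite basisEfree fr subvf size_tuple leqnn.
exists e, (scmx H B *m w *m scmx H B'); split=> // j.
rewrite eE /vec (comodule_matrixE _ mw).
have bE k : tnth b k = \sum_l B l k *: tnth e l.
  transitivity (vec e (col k B)); last by apply: eq_bigr => l _; rewrite mxE.
  rewrite veceE colE mulmxA B'B mul1mx /vec (bigD1 k)//= !mxE eqxx scale1r big1 ?addr0//.
  by move=> l ne; rewrite !mxE (negPf ne) scale0r.
under eq_bigr do rewrite bE tens_suml.
rewrite exchange_big; apply: eq_bigr => l _ /=.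
rewrite -mulmxA mulsc_mx tens_sumr; apply: eq_bigr => k _.
rewrite tensZl tensZr !mulmx_sc; congr (_ *: tens _ _).
by apply: eq_bigr => p _; rewrite mxE.
Qed.

End UnitaryBasis.

Section Translation.
Variables (R : realType) (Q : hopf_star_algebra R) (V : vectType R[i]).
Variables (rho : comodule Q V) (n : nat) (e : n.-tuple V) (U : 'M[Q]_n).
Local Notation C := R[i].
Hypothesis he : basis_of fullv e.
Hypothesis mU : comodule_matrix rho e U.
Variables (X : {vspace V}) (r : nat) (B : 'M[C]_(n, r)) (B' : 'M[C]_(r, n)).
Hypothesis BB : B' *m B = 1%:M.
Hypothesis hX : forall v, v \in X <-> exists z, v = vec e (B *m z).

Lemma coaction_vec x : rho (vec e x) = \sum_i tens (tnth e i) ((U *m scmx Q x) i 0).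
Proof. exact: comodule_matrixE. Qed.

(** The columns of [B] are coordinates of a basis of [X], and the left inverse [B'] applied to first
    legs recovers the components z. *)
Lemma in_tensor_coordinates (D : set Q) (y : 'cV[Q]_n) : submodule D ->
  in_tensor [set x | x \in X] D (\sum_i tens (tnth e i) (y i 0)) <->
  exists2 z : 'cV[Q]_r, forall k, D (z k 0) & y = scmx Q B *m z.
Proof.
move=> sD; split=> [[s hs es]|[z Dz ->]].
  exists (\col_k \sum_(p <- s) (B' *m covec e p.1) k 0 *: p.2).
    move=> k; rewrite mxE big_seq; apply: submodule_sum => // p ps.
    by apply: submoduleZ => //; case: (hs _ ps).
  apply/colP => i; rewrite mulsc_mx.
  rewrite -(contractl_coord (fun i => y i 0) i he) es raddf_sum.
  under [RHS]eq_bigr do rewrite mxE scaler_sumr.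
  rewrite exchange_big big_seq [RHS]big_seq; apply: eq_bigr => p ps /=.
  rewrite contractl_tens; under [RHS]eq_bigr do rewrite scalerA.
  rewrite -scaler_suml; congr (_ *: _) => /=.
  have [/hX [z ez] _] := hs _ ps.
  have -> : coord e i p.1 = covec e p.1 i 0 by rewrite mxE.
  rewrite ez vecK//; transitivity ((B *m (B' *m (B *m z))) i 0).
    by rewrite [B' *m _]mulmxA BB mul1mx.
  by rewrite mxE.
exists [seq (vec e (B *m delta_mx k 0), z k 0) | k <- enum 'I_r].
  move=> p /mapP [k _ ->] /=; split=> //.
  by apply/hX; exists (delta_mx k 0).
rewrite big_map big_enum /=.
under eq_bigr do rewrite mulsc_mx tens_sumr.
rewrite exchange_big; apply: eq_bigr => k _ /=; rewrite /vec tens_suml.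
apply: eq_bigr => i _; rewrite tensZr tensZl; congr (_ *: _).
by rewrite -colE mxE.
Qed.

Lemma columns_solution (D : set Q) (Y : 'M[Q]_(n, r)) :
  (forall z0 : 'cV[C]_r, exists2 z : 'cV[Q]_r, forall k, D (z k 0) &
     Y *m scmx Q z0 = scmx Q B *m z) ->
  exists2 Z : 'M[Q]_r, forall i j, D (Z i j) & Y = scmx Q B *m Z.
Proof.
move=> h.
have [|f fP] := choice (P := fun j (z : 'cV[Q]_r) => (forall k, D (z k 0)) /\
    Y *m scmx Q (delta_mx j 0) = scmx Q B *m z).
  by move=> j; have [z ? ?] := h (delta_mx j 0); exists z.
exists (\matrix_(i, j) f j i 0) => [i j|].
  by rewrite mxE; case: (fP j).
apply/matrixP => i j; have [_ /colP/(_ i)] := fP j.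
rewrite mulmx_sc (bigD1 j)//= mxE !eqxx scale1r big1 ?addr0; last first.
  by move=> k ne; rewrite mxE (negPf ne) scale0r.
by move=> ->; rewrite !mulsc_mx; apply: eq_bigr => k _; rewrite mxE.
Qed.

Lemma subcomoduleE : subcomodule rho X <->
  U *m scmx Q B = scmx Q (B *m B') *m U *m scmx Q B.
Proof.
have sT : submodule [set: Q] by [].
split=> [h|e1 w /hX [z ->]].
  have [|Z _ eZ] := @columns_solution setT (U *m scmx Q B).
    move=> z0; have /h : vec e (B *m z0) \in X by apply/hX; exists z0.
    by rewrite coaction_vec in_tensor_coordinates// scmxM mulmxA.
  by rewrite -mulmxA eZ scmxM mulmxA -[_ *m scmx Q B' *m _]mulmxA -scmxM BB scmx1 mulmx1.
rewrite coaction_vec; apply/in_tensor_coordinates => //.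
exists (scmx Q B' *m U *m scmx Q (B *m z)) => //.
by rewrite scmxM !mulmxA e1 scmxM.
Qed.

Lemma acts_triviallyE : acts_trivially rho X <-> U *m scmx Q B = scmx Q B.
Proof.
have key x : rho (vec e x) = tens (vec e x) 1 <-> U *m scmx Q x = scmx Q x.
  rewrite coaction_vec; have -> : tens (vec e x) 1 =
      \sum_i tens (tnth e i) ((scmx Q x) i 0).
    rewrite /vec tens_suml; apply: eq_bigr => i _.
    by rewrite mxE /= tensZl tensZr.
  split=> [h|->//]; apply/colP => i.
  exact: (tensor_basis_inj he h i).
split=> [h|h v /hX [z ->]]; last first.
  by apply/key; rewrite scmxM mulmxA h.
apply/matrixP => i j.
have /h/key/colP/(_ i) : vec e (B *m delta_mx j 0) \in X by apply/hX; eexists.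
rewrite -colE mulmx_sc [RHS]mxE [X in in_alg _ X]mxE /= mulmx_sc => hj.
rewrite [RHS]mxE /= -hj; apply: eq_bigr => k _.
by rewrite mxE.
Qed.

Lemma cocommutative_part_submodule : submodule (@cocommutative_part R Q).
Proof. by have [[h0 hl _] _ _] := @cocommutative_part_largest R Q; split. Qed.

Lemma factors_through_abelianizationE : factors_through_abelianization rho X <->
  exists2 Z : 'M[Q]_r, forall i j, @cocommutative_part R Q (Z i j) &
    U *m scmx Q B = scmx Q B *m Z.
Proof.
have sD := cocommutative_part_submodule.
split=> [h|[Z DZ eZ] w /hX [z ->]].
  apply: columns_solution => z0.
  have /h : vec e (B *m z0) \in X by apply/hX; exists z0.
  by rewrite coaction_vec in_tensor_coordinates// scmxM mulmxA.
rewrite coaction_vec; apply/in_tensor_coordinates => //.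
exists (Z *m scmx Q z); last by rewrite scmxM !mulmxA eZ.
move=> k; rewrite mulmx_sc; apply: submodule_sum => // j _.
exact: submoduleZ.
Qed.

End Translation.

Lemma push_comodule_matrix (R : realType) (H Q : hopf_star_algebra R)
  (q : hopf_star_morphism H Q) (V : vectType R[i]) (rho : comodule H V) n
  (e : n.-tuple V) (u : 'M[H]_n) : comodule_matrix rho e u ->
  comodule_matrix (comodule_along q rho) e (map_mx q u).
Proof.
move=> mu j; rewrite /= /push_coaction mu linear_sum; apply: eq_bigr => i _ /=.
by rewrite tmap_tens mxE.
Qed.

(** For a unitary corepresentation the orthogonal complement of an invariant subspace is invariant.
    Here the antipode turns U into U^* in the invariance identity, and taking adjoints gives P U = P
    U P. *)
Lemma ucorep_commute_projection (R : realType) (Q : hopf_star_algebra R) n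
  (U : 'M[Q]_n) (P : 'M[R[i]]_n) : ucorep U -> P ^t* = P ->
  U *m scmx Q P = scmx Q P *m U *m scmx Q P ->
  U *m scmx Q P = scmx Q P *m U.
Proof.
move=> uU hP e.
have e1 : adj U *m scmx Q P = scmx Q P *m adj U *m scmx Q P.
  have := congr1 (map_mx antipode) e; rewrite map_lin_sc.
  have := map_lin_sc antipode 1%:M U P; rewrite scmx1 !mul1mx => ->.
  by rewrite (ucorep_antipode uU).
have := congr1 (@adj R Q n n) e1.
by rewrite !adjM adjK adj_scmx hP mulmxA -e.
Qed.

(** * Cyclic intertwiners and cocommutativity *)

Section CyclicVectors.
Variable F : fieldType.

(** The Krylov matrix with rows xi, xi M, xi M^2, ...; it is invertible exactly when the row vector
    xi is cyclic for M. *)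
Definition cyclic_mx r (xi : 'rV[F]_r) (M : 'M[F]_r) : 'M[F]_r :=
  \matrix_(k < r, j < r) (iter k (mulmxr M) xi) 0 j.

Lemma row_cyclic_mx r (xi : 'rV[F]_r) (M : 'M[F]_r) k :
  row k (cyclic_mx xi M) = iter k (mulmxr M) xi.
Proof. by apply/rowP => j; rewrite !mxE. Qed.

End CyclicVectors.

Section Abelian.
Variables (R : realType) (Q : hopf_star_algebra R) (n : nat) (U : 'M[Q]_n).
Local Notation C := R[i].
Hypothesis uU : ucorep U.
Variables (r : nat) (B : 'M[C]_(n, r)) (B' : 'M[C]_(r, n)).
Hypothesis BB : B' *m B = 1%:M.
Let P := B *m B'.
Hypothesis UP : U *m scmx Q P = scmx Q P *m U.

Let PB : P *m B = B. Proof. by rewrite /P -mulmxA BB mulmx1. Qed.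
Let BP : B' *m P = B'. Proof. by rewrite /P mulmxA BB mul1mx. Qed.
Let PP : P *m P = P. Proof. by rewrite {2}/P mulmxA PB. Qed.

Lemma tswapD (s t : Q ⊗ Q) : tswap (s + t) = tswap s + tswap t.
Proof.
have lin := @tswap_linear R Q; have := lin 1 s t.
by rewrite !scale1r.
Qed.

Lemma tswap0 : tswap (0 : Q ⊗ Q) = 0.
Proof. by have := @tswap_linear R Q (-1) 0 0; rewrite scaler0 addr0 scaleN1r addNr. Qed.

Lemma tswap_tens (a b : Q) : tswap (tens a b) = tens b a.
Proof. by rewrite /tswap tsum_tens//; exact: tswap_balanced. Qed.

(* An intertwiner with a cyclic vector has a commutative commutant, namely the
   polynomials in it. *)
Lemma cyclic_intertwiner_cocommutative (T : 'M[C]_n) (xi : 'rV[C]_r) :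
  U *m scmx Q T = scmx Q T *m U -> \det (cyclic_mx xi (B' *m T *m B)) != 0 ->
  exists2 Z : 'M[Q]_r, forall i j, @cocommutative_part R Q (Z i j) &
    U *m scmx Q B = scmx Q B *m Z.
Proof.
move=> UT; set M := B' *m T *m B => dK; pose K := cyclic_mx xi M.
have Ku : K \in unitmx by rewrite unitmxE unitfE.
(* [y] is the matrix of the action on the column space of [B], in the basis given by these columns,
   and [M] is the compression of T. *)
pose y := scmx Q B' *m U *m scmx Q B.
have UB : U *m scmx Q B = scmx Q B *m y.
  by rewrite /y !mulmxA -scmxM -/P -UP -mulmxA -scmxM PB.
have BU : scmx Q B' *m U = y *m scmx Q B'.
  by rewrite /y -mulmxA -scmxM -/P -[RHS]mulmxA UP mulmxA -scmxM BP.
have yM : y *m scmx Q M = scmx Q M *m y.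
  have -> : y *m scmx Q M = scmx Q B' *m U *m scmx Q T *m scmx Q B.
    by rewrite /M !scmxM !mulmxA -BU.
  have -> : scmx Q M *m y = scmx Q B' *m scmx Q T *m U *m scmx Q B.
    by rewrite /M !scmxM -!mulmxA -UB.
  by rewrite -[_ *m U *m scmx Q T]mulmxA UT mulmxA.
(* The entries of [g] are the components of xi y in the Krylov basis, with coefficients in Q. *)
have [g gK] : exists g, scmx Q xi *m y = g *m scmx Q K.
  exists (scmx Q xi *m y *m scmx Q (invmx K)).
  by rewrite -[RHS]mulmxA -scmxM mulVmx// scmx1 mulmx1.
pose N k : 'M[C]_r := iter k (mulmxr M) 1%:M.
(* S = Σ_k M^k g_k commutes with M and agrees with y on the cyclic vector, so it will equal y. *)
pose S : 'M[Q]_r := \sum_(k < r) \matrix_(i, j) (N k i j *: g 0 k).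
have NS k : N k.+1 = N k *m M by [].
have iterM k (x : 'rV[C]_r) : iter k (mulmxr M) x = x *m N k.
  elim: k => [|k IH]; first by rewrite mulmx1.
  by rewrite NS /= IH mulmxA.
have Mk k l : N k *m N l = N (k + l)%N.
  elim: l => [|l IH]; first by rewrite mulmx1 addn0.
  by rewrite addnS !NS mulmxA IH.
have ySx : scmx Q xi *m y = scmx Q xi *m S.
  apply/rowP => j; rewrite gK mulmx_sc mulsc_mx.
  under [RHS]eq_bigr do rewrite summxE scaler_sumr.
  rewrite exchange_big; apply: eq_bigr => k _ /=.
  rewrite mxE iterM mxE scaler_suml; apply: eq_bigr => l _.
  by rewrite mxE scalerA.
have Scom k : S *m scmx Q (N k) = scmx Q (N k) *m S.
  rewrite /S mulmx_suml mulmx_sumr; apply: eq_bigr => l _.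
  apply/matrixP => i j; rewrite mulmx_sc mulsc_mx.
  transitivity ((N l *m N k) i j *: g 0 l).
    by rewrite mxE scaler_suml; apply: eq_bigr => p _; rewrite mxE scalerA mulrC.
  rewrite Mk addnC -Mk mxE scaler_suml; apply: eq_bigr => p _.
  by rewrite mxE scalerA.
have ycom k : y *m scmx Q (N k) = scmx Q (N k) *m y.
  elim: k => [|k IH]; first by rewrite scmx1 mulmx1 mul1mx.
  by rewrite NS scmxM mulmxA IH -[_ *m y *m _]mulmxA yM mulmxA.
have yS : y = S.
  have : scmx Q K *m y = scmx Q K *m S.
    apply/row_matrixP => k; rewrite !row_mul.
    have -> : row k (scmx Q K) = scmx Q xi *m scmx Q (N k).
      rewrite -scmxM -iterM; apply/rowP => j.
      by rewrite !mxE.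
    by rewrite -[_ *m y]mulmxA -ycom -[_ *m S]mulmxA -Scom [LHS]mulmxA [RHS]mulmxA ySx.
  move=> /(congr1 (mulmx (scmx Q (invmx K)))).
  by rewrite !mulmxA -scmxM mulVmx// scmx1 !mul1mx.
have cy i j : comul (y i j) = \sum_k tens (y i k) (y k j).
  have [[cU _] _] := uU.
  rewrite /y (linear_sc comul).
  transitivity (\sum_m tens ((scmx Q B' *m U) i m) ((U *m scmx Q B) m j)).
    under eq_bigr do under eq_bigr do rewrite cU scaler_sumr.
    under [RHS]eq_bigr do rewrite mulsc_mx mulmx_sc tens_suml.
    rewrite [RHS]exchange_big; apply: eq_bigr => k _ /=; rewrite exchange_big.
    apply: eq_bigr => m _ /=; rewrite tens_sumr; apply: eq_bigr => l _.
    by rewrite tensZl tensZr scalerA.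
  rewrite UB; under eq_bigr do rewrite [X in tens _ X]mulsc_mx tens_sumr.
  rewrite exchange_big; apply: eq_bigr => k _ /=.
  rewrite [X in _ = tens X _](mulmx_sc (scmx Q B' *m U) B) tens_suml.
  by apply: eq_bigr => m _; rewrite tensZr tensZl.
(* Since the powers of M multiply by adding exponents, Δ(y_ij) has coefficients depending on k + l
   only, so it is symmetric under the flip. *)
have cyg i j : comul (y i j) = \sum_(k < r) \sum_(l < r) N (k + l)%N i j *: tens (g 0 k) (g 0 l).
  rewrite cy yS /S.
  under eq_bigr do rewrite !summxE tens_suml.
  rewrite exchange_big; apply: eq_bigr => k _ /=.
  under eq_bigr do rewrite tens_sumr.
  rewrite exchange_big; apply: eq_bigr => l _ /=.
  rewrite -Mk mxE scaler_suml; apply: eq_bigr => p _.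
  by rewrite !mxE tensZl tensZr scalerA.
have ccy i j : tswap (comul (y i j)) = comul (y i j).
  rewrite cyg (big_morph _ tswapD tswap0) [RHS]exchange_big; apply: eq_bigr => k _ /=.
  rewrite (big_morph _ tswapD tswap0); apply: eq_bigr => l _ /=.
  by rewrite -tensZl tswap_tens tensZr addnC.
(* The coefficients of y span a cocommutative subcoalgebra, which lies in the largest one. *)
exists y => // i j; exists [set x | exists X, x = coef y X]; last first.
  by exists (delta_mx i j); rewrite coef_delta.
split.
- split=> [|a _ _ [X ->] [Y ->]|_ [X ->]].
  + by exists 0; rewrite linear0.
  + by exists (a *: X + Y); rewrite linearP.
  pose D := [set x : Q | exists X, x = coef y X].
  have Dy k l : D (y k l).
    by exists (delta_mx k l); rewrite coef_delta.
  have Dsum (I : Type) (s : seq I) (E : I -> Q ⊗ Q) : (forall k, in_tensor D D (E k)) ->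
      in_tensor D D (\sum_(k <- s) E k).
    move=> h; elim: s => [|k s IH]; first by exists [::]; rewrite ?big_nil.
    rewrite big_cons -[E k]scale1r; apply: in_tensorP => // c z [Z ->].
    by exists (c *: Z); rewrite linearZ.
  rewrite /coef raddf_sum; apply: (Dsum) => k; rewrite raddf_sum; apply: (Dsum) => l /=.
  rewrite linearZ /= cy scaler_sumr; apply: (Dsum) => p; rewrite -tensZr.
  exists [:: (y k p, X k l *: y p l)]; last by rewrite big_seq1.
  move=> t; rewrite inE => /eqP -> /=; split=> //.
  by have [Z ->] := Dy p l; exists (X k l *: Z); rewrite linearZ.
- move=> _ [X ->]; rewrite /coef !raddf_sum (big_morph _ tswapD tswap0).
  apply: eq_bigr => k _ /=; rewrite !raddf_sum (big_morph _ tswapD tswap0).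
  apply: eq_bigr => l _ /=; rewrite linearZ /=.
  have := @tswap_linear R Q (X k l) (comul (y k l)) 0.
  by rewrite tswap0 !addr0 ccy.
Qed.

End Abelian.

(** * Simultaneous diagonalization and cyclic vectors *)

Section Diagonalization.
Variable R : realType.
Local Notation C := R[i].

(** A commuting family is triangular in a common unitary basis; stability under adjoints kills the
    other triangle as well. *)
Lemma codiagonalization_star n (N : set 'M[C]_n) : submodule N ->
  (forall A, N A -> N (A ^t*)) -> (forall A A', N A -> N A' -> A *m A' = A' *m A) ->
  exists2 O : 'M[C]_n, O \is unitarymx &
    forall A, N A -> exists d, A = O ^t* *m diag_mx d *m O.
Proof.
move=> sN Nstar Ncom; have [W WN] := submodule_vspace sN.
have [|O uO] := @cotrigonalization C n (vbasis W).
  by move=> A A' hA hA'; apply: Ncom; apply/WN; exact: vbasis_mem.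
move=> /allP trig; exists O => //.
have OO : O *m O ^t* = 1%:M by apply/unitarymxP.
have OO' : O ^t* *m O = 1%:M by apply: mulmx1C.
have trigN A : N A -> forall i j : 'I_n, (i < j)%N -> (O *m A *m O ^t*) i j = 0.
  move=> /WN AW i j ij; rewrite (coord_vbasis AW) mulmx_sumr mulmx_suml summxE.
  rewrite big1// => k _; rewrite -scalemxAr -scalemxAl mxE.
  have /trig : (vbasis W)`_k \in vbasis W by rewrite mem_nth// size_tuple.
  by rewrite /= /similar_to conjymx// => /is_trig_mxP -> //; rewrite mulr0.
move=> A NA; exists (\row_i (O *m A *m O ^t*) i i).
have -> : diag_mx (\row_i (O *m A *m O ^t*) i i) = O *m A *m O ^t*.
  apply/matrixP => i j; rewrite mxE mxE.
  have [->|ne] := eqVneq i j; first by rewrite mulr1n.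
  rewrite mulr0n; case: (ltngtP i j) => [ij|ji|/val_inj/eqP]; last by rewrite (negPf ne).
    by rewrite trigN.
  have := trigN _ (Nstar _ NA) _ _ ji.
  have -> : O *m A ^t* *m O ^t* = (O *m A *m O ^t*) ^t*.
    by rewrite !trmx_mul !map_mxM trmxCK mulmxA.
  by rewrite mxE mxE => /eqP; rewrite conjC_eq0 => /eqP.
by rewrite !mulmxA OO' mul1mx -mulmxA OO' mulmx1.
Qed.

(* A polynomial of degree less than the rank of a diagonal projection cannot vanish
   on its support. *)
Lemma diag_projection_cyclic n r (d : 'rV[C]_n) (c : 'rV[C]_r) :
  (forall i, d 0 i * d 0 i = d 0 i) -> \sum_i d 0 i = r%:R ->
  (forall i : 'I_n, (\sum_(k < r) c 0 k * (i%:R : C) ^+ k) * d 0 i = 0) -> c = 0.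
Proof.
move=> dd dr h; pose p := rVpoly c.
have pE i : p.[i%:R] = \sum_(k < r) c 0 k * (i%:R : C) ^+ k.
  by rewrite /p /rVpoly horner_poly; apply: eq_bigr => k _; rewrite valK.
(* The nodes are the distinct integers i with d_i = 1; there are exactly r of them because the
   idempotents d_i sum to r. *)
pose s := [seq (nat_of_ord i)%:R | i <- enum 'I_n & d 0 i != 0] : seq C.
have us : uniq s.
  rewrite map_inj_uniq; first by rewrite filter_uniq// enum_uniq.
  by move=> i j /eqP; rewrite eqr_nat => /eqP/val_inj.
have ss : size s = r.
  apply/eqP; rewrite -(eqr_nat C) -dr size_map size_filter -sum1_count natr_sum.
  rewrite big_enum_cond /= [in X in _ == X](bigID (fun i => d 0 i != 0))/=.
  rewrite [X in _ == _ + X]big1 ?addr0; last by move=> i; rewrite negbK => /eqP.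
  apply/eqP; apply: eq_bigr => i /mulfI; apply.
  by rewrite mulr1 dd.
have rs : all (root p) s.
  rewrite /s all_map; apply/allP => i; rewrite mem_filter /= => /andP [di _].
  apply/rootP; rewrite pE; have /eqP := h i.
  by rewrite mulf_eq0 (negPf di) orbF => /eqP.
have p0 : p = 0.
  apply/eqP/negPn/negP => p0; have := max_poly_roots p0 rs us.
  by rewrite ss ltnNge size_poly.
by rewrite -[c]rVpolyK -/p p0 linear0.
Qed.

End Diagonalization.

Section AbelianConverse.
Variables (R : realType) (Q : hopf_star_algebra R) (n : nat) (U : 'M[Q]_n).
Local Notation C := R[i].
Hypothesis uU : ucorep U.
Variables (r : nat) (B : 'M[C]_(n, r)) (B' : 'M[C]_(r, n)).
Hypothesis BB : B' *m B = 1%:M.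
Let P := B *m B'.
Hypothesis hP : P ^t* = P.
Hypothesis UP : U *m scmx Q P = scmx Q P *m U.

Let PB : P *m B = B. Proof. by rewrite /P -mulmxA BB mulmx1. Qed.
Let BP : B' *m P = B'. Proof. by rewrite /P mulmxA BB mul1mx. Qed.
Let PP : P *m P = P. Proof. by rewrite {2}/P mulmxA PB. Qed.

Lemma functional_lact_swap (f g : {scalar Q}) x :
  tswap (comul x) = comul x -> f (lact g x) = g (lact f x).
Proof.
move=> e; rewrite /lact -{2}e.
elim/tens_ind: (comul x) => [|s t hs ht|a b].
- by rewrite tswap0 !linear0.
- by rewrite tswapD !linearD /= hs ht.
by rewrite tswap_tens !contractl_tens !scalarZ mulrC.
Qed.

(** Cocommutativity makes the matrices f(W), f a functional, commute, so they are simultaneously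
    diagonal; an operator with distinct eigenvalues in that basis commutes with all of them and has
    a cyclic vector on the range of P. *)
Lemma cocommutative_cyclic_intertwiner (Z : 'M[Q]_r) :
  (forall i j, @cocommutative_part R Q (Z i j)) -> U *m scmx Q B = scmx Q B *m Z ->
  exists (T : 'M[C]_n) (xi : 'rV[C]_r),
    U *m scmx Q T = scmx Q T *m U /\ \det (cyclic_mx xi (B' *m T *m B)) != 0.
Proof.
(* The n by n matrix [W] = U P is used instead of [Z]: the columns of [B] need not be orthonormal,
   so only the f(W) are visibly closed under adjoints. *)
move=> cZ UB; pose W := U *m scmx Q P.
have [cU _] := uU.
have cW i j : tswap (comul (W i j)) = comul (W i j).
  have [[h0 hl _] hc _] := @cocommutative_part_largest R Q; apply: hc.
  have sD : submodule (@cocommutative_part R Q) by split.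
  have -> : W = scmx Q B *m Z *m scmx Q B' by rewrite /W scmxM mulmxA UB.
  rewrite mulmx_sc; apply: submodule_sum => // k _; apply: submoduleZ => //.
  by rewrite mulsc_mx; apply: submodule_sum => // l _; exact: submoduleZ.
have lW (f : {scalar Q}) i j : lact f (W i j) = \sum_m f (W i m) *: W m j.
  transitivity (\sum_m f (U i m) *: W m j).
    rewrite {1}/W mulmx_sc linear_sum; under eq_bigr do rewrite linearZ /= lact_corep// scaler_sumr.
    rewrite exchange_big; apply: eq_bigr => m _ /=; rewrite /W mulmx_sc scaler_sumr.
    by apply: eq_bigr => k _; rewrite !scalerA mulrC.
  have WP m : W m j = \sum_k P m k *: W k j.
    have : W = scmx Q P *m W.
      by rewrite /W mulmxA -UP -mulmxA -scmxM PP.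
    by move=> /matrixP/(_ m j); rewrite mulsc_mx.
  under eq_bigr do rewrite WP scaler_sumr.
  rewrite exchange_big; apply: eq_bigr => k _ /=.
  under eq_bigr do rewrite scalerA.
  rewrite -scaler_suml; congr (_ *: _); rewrite /W mulmx_sc raddf_sum.
  by apply: eq_bigr => m _; rewrite /= scalarZ mulrC.
have fW (f : {scalar Q}) : map_mx f W = map_mx f U *m P.
  by have := map_scalar_sc f 1%:M U P; rewrite scmx1 !mul1mx.
have fW' (f : {scalar Q}) : map_mx f W = P *m map_mx f U.
  have := map_scalar_sc f P U 1%:M; rewrite scmx1 !mulmx1 => <-.
  by rewrite /W UP.
pose N : set 'M[C]_n := [set M | exists f : {scalar Q}, M = map_mx f W].
have sN : submodule N.
  split.
    have lin : scalar (fun _ : Q => 0 : C) by move=> a x y; rewrite mulr0 addr0.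
    by exists (mk_scalar lin); apply/matrixP => i j; rewrite !mxE.
  move=> a _ _ [f ->] [g ->].
  have lin : scalar (fun x : Q => a * f x + g x).
    by move=> c x y; rewrite !linearP /= !mulrDr addrACA mulrCA.
  by exists (mk_scalar lin); apply/matrixP => i j; rewrite !mxE.
have [||O uO ON] := codiagonalization_star sN.
- move=> _ [f ->]; exists (star_functional f).
  by rewrite fW' fW trmx_mul map_mxM star_functionalE// hP.
- move=> _ _ [f ->] [g ->]; apply/matrixP => i j; rewrite mxE.
  transitivity (g (lact f (W i j))).
    rewrite lW raddf_sum; apply: eq_bigr => k _ /=.
    by rewrite scalarZ !mxE.
  rewrite -functional_lact_swap// lW raddf_sum [RHS]mxE; apply: eq_bigr => k _ /=.
  by rewrite scalarZ !mxE.
have OO : O *m O ^t* = 1%:M by apply/unitarymxP.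
have OO' : O ^t* *m O = 1%:M by apply: mulmx1C.
(* [T0] has the distinct eigenvalues 0, ..., n - 1 in the common eigenbasis; [L k] lists their k-th
   powers. *)
pose L k : 'rV[C]_n := \row_(i < n) (i%:R : C) ^+ k.
pose T0 := O ^t* *m diag_mx (L 1%N) *m O.
have T0com A : N A -> T0 *m A = A *m T0.
  move=> /ON [d ->]; rewrite /T0 !mulmxA.
  rewrite -[_ *m O *m O ^t*]mulmxA OO mulmx1 -[_ *m O *m O ^t*]mulmxA OO mulmx1.
  by rewrite -[_ *m diag_mx _ *m diag_mx _]mulmxA diag_mxC !mulmxA.
have NP : N P.
  exists counit; rewrite fW map_counit_corep ?mul1mx//.
have T0P := T0com P NP.
have T0W : scmx Q T0 *m W = W *m scmx Q T0.
  apply/matrixP => i j; apply/eqP; rewrite -subr_eq0; apply/eqP/functional_separates => f.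
  rewrite linearB /=; have := T0com (map_mx f W) (ex_intro _ f erefl).
  have := map_scalar_sc f T0 W 1%:M; rewrite scmx1 !mulmx1 => <-.
  have := map_scalar_sc f 1%:M W T0; rewrite scmx1 !mul1mx => <-.
  by move=> /matrixP/(_ i j); rewrite mxE [RHS]mxE => ->; rewrite subrr.
pose T := P *m T0.
(* All coordinates of the row const_mx 1 are 1, so its Krylov sequence in the eigenbasis is [L k], a
   Vandermonde pattern; the factor B restricts it to the range of P. *)
exists T, (const_mx 1 *m O *m B); split.
  rewrite /T scmxM mulmxA -/W -T0W /W UP mulmxA -!scmxM T0P.
  by [].
have [d eP] := ON P NP.
have dE : diag_mx d = O *m P *m O ^t*.
  by rewrite eP !mulmxA OO mul1mx -mulmxA OO mulmx1.
have OT0 : O *m T0 = diag_mx (L 1%N) *m O.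
  by rewrite /T0 (mulmxA O) (mulmxA O) OO mul1mx.
have TB : T *m B = T0 *m B by rewrite /T -T0P -(mulmxA T0) PB.
have BTB : B *m (B' *m T *m B) = T0 *m B.
  by rewrite -(mulmxA B') TB (mulmxA B) -/P (mulmxA P) -T0P -(mulmxA T0) PB.
have itE k : iter k (mulmxr (B' *m T *m B)) (const_mx 1 *m O *m B) = L k *m O *m B.
  elim: k => [|k IH].
    by congr (_ *m _ *m _); apply/rowP => i; rewrite !mxE expr0.
  rewrite iterS IH /= -(mulmxA (_ *m O)) BTB (mulmxA (_ *m O)) -(mulmxA (L k)) OT0.
  rewrite (mulmxA (L k)); congr (_ *m _ *m _).
  by apply/rowP => i; rewrite mul_mx_diag !mxE expr1 exprSr.
rewrite -unitfE -unitmxE -row_free_unit; apply: inj_row_free => c hc.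
apply: (@diag_projection_cyclic _ n _ d).
- move=> i; have /matrixP/(_ i i) : diag_mx d *m diag_mx d = diag_mx d.
    rewrite dE -{2}(mulmxA O P) -(mulmxA (O *m P)) (mulmxA (O ^t*)) OO' mul1mx.
    by rewrite -(mulmxA O P) (mulmxA P P) PP mulmxA.
  by rewrite mulmx_diag !mxE eqxx !mulr1n.
- rewrite -mxtrace_diag dE mxtrace_mulC mulmxA OO' mul1mx /P mxtrace_mulC BB.
  exact: mxtrace1.
move=> i; pose a : 'rV[C]_n := \row_i \sum_(k < r) c 0 k * (i%:R : C) ^+ k.
have e : a *m O *m B = 0.
  rewrite -[RHS]hc.
  have -> : c *m cyclic_mx (const_mx 1 *m O *m B) (B' *m T *m B) =
      \sum_k c 0 k *: (L k *m O *m B).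
    rewrite mulmx_sum_row; apply: eq_bigr => k _.
    by rewrite row_cyclic_mx itE.
  transitivity ((\sum_k c 0 k *: L k) *m O *m B).
    congr (_ *m _ *m _); apply/rowP => j; rewrite !mxE summxE.
    by apply: eq_bigr => k _; rewrite !mxE.
  rewrite !mulmx_suml; apply: eq_bigr => k _.
  by rewrite -!scalemxAl.
have : a *m diag_mx d = 0.
  rewrite dE /P !mulmxA e !mul0mx//.
by move=> /rowP/(_ i); rewrite mul_mx_diag !mxE.
Qed.

End AbelianConverse.

(** * Regular functions on charts *)

Section RegularFunctions.
Variables (R : realType) (d k : nat).
Local Notation C := R[i].
Local Notation X := 'M[C]_(d, k).
Import -(notations) mpoly.
Local Notation ev p A := (meval (real_coords A) p).

(* Quotients of complex-valued real polynomials by real polynomials without zeros. *)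
Definition regular (f : X -> C) : Prop :=
  exists p1 p2 q : mpoly (d * k + d * k) R, forall A, ev q A != 0 /\
    (ev q A)%:C * f A = (ev p1 A)%:C + 'i * (ev p2 A)%:C.

Lemma regular_ext f g : (forall A, f A = g A) -> regular f -> regular g.
Proof. by move=> /funext ->. Qed.

Lemma regular_const c : regular (fun=> c).
Proof.
exists (mpolyC _ (complex.Re c)), (mpolyC _ (complex.Im c)), 1 => A.
rewrite meval1 !mevalC oner_neq0; split=> //.
by rewrite rmorph1 mul1r -complexE.
Qed.

Lemma regularD f g : regular f -> regular g -> regular (fun A => f A + g A).
Proof.
move=> [p1 [p2 [q h]]] [p1' [p2' [q' h']]].
exists (q' * p1 + q * p1'), (q' * p2 + q * p2'), (q * q') => A.
have [q0 e] := h A; have [q0' e'] := h' A.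
rewrite !mevalD !mevalM mulf_neq0//; split=> //.
rewrite !rmorphD !rmorphM /=.
transitivity ((ev q' A)%:C * ((ev q A)%:C * f A) + (ev q A)%:C * ((ev q' A)%:C * g A)).
  by ring.
by rewrite e e'; ring.
Qed.

Lemma regularM f g : regular f -> regular g -> regular (fun A => f A * g A).
Proof.
move=> [p1 [p2 [q h]]] [p1' [p2' [q' h']]].
exists (p1 * p1' - p2 * p2'), (p1 * p2' + p2 * p1'), (q * q') => A.
have [q0 e] := h A; have [q0' e'] := h' A.
rewrite !mevalB !mevalD !mevalM mulf_neq0//; split=> //.
rewrite !rmorphB !rmorphD !rmorphM /= mulrACA e e'.
have ii : 'i * 'i = -1 :> C by rewrite -expr2 sqr_i.
transitivity ((ev p1 A)%:C * (ev p1' A)%:C + 'i * 'i * ((ev p2 A)%:C * (ev p2' A)%:C) +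
  'i * ((ev p1 A)%:C * (ev p2' A)%:C + (ev p2 A)%:C * (ev p1' A)%:C)); first by ring.
by rewrite ii mulN1r.
Qed.

Lemma regular_conj f : regular f -> regular (fun A => Num.conj (f A)).
Proof.
move=> [p1 [p2 [q h]]]; exists p1, (- p2), q => A.
have [q0 e] := h A; split=> //.
have := congr1 Num.conj e; rewrite !rmorphM rmorphD rmorphM /= mevalN rmorphN /=.
have rc x : Num.conj (x%:C) = x%:C :> C by exact: conjc_real.
have ci : Num.conj 'i = - 'i :> C by rewrite conjCi.
rewrite -[X in X * _ = _]/(Num.conj _) -[X in _ = X + _]/(Num.conj _).
by rewrite -[X in _ = _ + _ * X]/(Num.conj _) !rc ci mulNr mulrN => ->.
Qed.

(** For f = p/q with q real, 1/f is q times the conjugate of p over the squared modulus of p, a real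
    polynomial without zeros because f has none. *)
Lemma regularV f : regular f -> (forall A, f A != 0) -> regular (fun A => (f A)^-1).
Proof.
move=> [p1 [p2 [q h]]] f0.
exists (q * p1), (- (q * p2)), (p1 * p1 + p2 * p2) => A; have [q0 e] := h A.
have ii : 'i * 'i = -1 :> C by rewrite -expr2 sqr_i.
have z0 : (ev p1 A)%:C + 'i * (ev p2 A)%:C != 0 :> C.
  by rewrite -e mulf_neq0// fmorph_eq0.
have nE : ((ev p1 A)%:C + 'i * (ev p2 A)%:C) * ((ev p1 A)%:C - 'i * (ev p2 A)%:C) =
    (ev (p1 * p1 + p2 * p2) A)%:C.
  rewrite mevalD !mevalM rmorphD !rmorphM /=.
  transitivity ((ev p1 A)%:C * (ev p1 A)%:C - 'i * 'i * ((ev p2 A)%:C * (ev p2 A)%:C)).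
    by ring.
  by rewrite ii mulN1r opprK.
split.
  apply/eqP => n0; have : (ev p1 A) ^+ 2 + (ev p2 A) ^+ 2 == 0.
    by rewrite -n0 mevalD !mevalM !expr2.
  rewrite paddr_eq0 ?sqr_ge0// !sqrf_eq0 => /andP [/eqP e1 /eqP e2].
  by move: z0; rewrite e1 e2 rmorph0 mulr0 addr0 eqxx.
have -> : (f A)^-1 = (ev q A)%:C / ((ev p1 A)%:C + 'i * (ev p2 A)%:C).
  by rewrite -e invfM mulrA divff ?mul1r// fmorph_eq0.
rewrite -nE mevalN !mevalM rmorphN !rmorphM /= mulrAC mulrCA divff ?mulr1 => //; ring.
Qed.

Lemma regular_sum (I : Type) (r : seq I) (P : pred I) (F : I -> X -> C) :
  (forall i, regular (F i)) -> regular (fun A => \sum_(i <- r | P i) F i A).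
Proof.
move=> h; elim: r => [|i r IH].
  by apply: regular_ext (regular_const 0) => A; rewrite big_nil.
case Pi : (P i); last by apply: regular_ext IH => A; rewrite big_cons Pi.
by apply: regular_ext (regularD (h i) IH) => A; rewrite big_cons Pi.
Qed.

Lemma regular_prod (I : Type) (r : seq I) (F : I -> X -> C) :
  (forall i, regular (F i)) -> regular (fun A => \prod_(i <- r) F i A).
Proof.
move=> h; elim: r => [|i r IH].
  by apply: regular_ext (regular_const 1) => A; rewrite big_nil.
by apply: regular_ext (regularM (h i) IH) => A; rewrite big_cons.
Qed.

Lemma regular_coord i j : regular (fun A : X => A i j).
Proof.
exists (mpolyX _ (mnm1 (lshift (d * k) (mxvec_index i j)))),
  (mpolyX _ (mnm1 (rshift (d * k) (mxvec_index i j)))), 1 => A.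
rewrite meval1 !mevalXU oner_neq0 rmorph1 mul1r; split=> //.
rewrite /real_coords -[X in fintype.split X]/(unsplit (inl _)) unsplitK.
rewrite -[X in fintype.split X]/(unsplit (inr _)) unsplitK mxvecE.
exact: complexE.
Qed.

Definition regular_mx m n (M : X -> 'M[C]_(m, n)) : Prop :=
  forall i j, regular (fun A => M A i j).

Lemma regular_mxM m n p (M : X -> 'M[C]_(m, n)) (N : X -> 'M[C]_(n, p)) :
  regular_mx M -> regular_mx N -> regular_mx (fun A => M A *m N A).
Proof.
move=> hM hN i j.
apply: (@regular_ext (fun A => \sum_l M A i l * N A l j)) => [A|].
  by rewrite mxE.
by apply: regular_sum => l; exact: regularM.
Qed.

Lemma regular_mx_const m n (M : 'M[C]_(m, n)) : regular_mx (fun=> M).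
Proof. by move=> i j; exact: regular_const. Qed.

Lemma regular_mx_adj m n (M : X -> 'M[C]_(m, n)) :
  regular_mx M -> regular_mx (fun A => (M A) ^t*).
Proof.
move=> hM i j; apply: regular_ext (regular_conj (hM j i)) => A.
by rewrite !mxE.
Qed.

Lemma regular_det n (M : X -> 'M[C]_n) : regular_mx M -> regular (fun A => \det (M A)).
Proof.
move=> hM; apply: regular_sum => s; apply: regularM; first exact: regular_const.
by apply: regular_prod => i; exact: hM.
Qed.

(** Cramer's rule: the entries of the inverse are cofactors divided by a determinant without
    zeros. *)
Lemma regular_invmx n (M : X -> 'M[C]_n) : regular_mx M ->
  (forall A, M A \in unitmx) -> regular_mx (fun A => invmx (M A)).
Proof.
move=> hM uM i j.
apply: (@regular_ext (fun A => (\det (M A))^-1 *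
    ((-1) ^+ (j + i) * \det (row' j (col' i (M A)))))) => [A|].
  by rewrite /invmx uM !mxE.
apply: regularM.
  by apply: regularV => [|A]; [exact: regular_det|rewrite -unitfE -unitmxE].
apply: regularM; first exact: regular_const.
apply: regular_det => a b.
by apply: regular_ext (hM (lift j a) (lift i b)) => A; rewrite !mxE.
Qed.

(** A regular function vanishes exactly where the real and imaginary parts of its numerator do. *)
Lemma regular_zero_set (F : set (X -> C)) : (forall f, F f -> regular f) ->
  real_algebraic_set [set A | forall f, F f -> f A = 0].
Proof.
move=> reg; exists [set p | exists f p1 p2 q, [/\ F f,
  (forall A, ev q A != 0 /\ (ev q A)%:C * f A = (ev p1 A)%:C + 'i * (ev p2 A)%:C)
  & p = p1 \/ p = p2]].
apply/seteqP; split=> A /= hA.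
  move=> p [f [p1 [p2 [q [Ff h pE]]]]]; have [q0 e] := h A.
  move: e; rewrite hA// mulr0 => /esym e0.
  have : (ev p1 A +i* ev p2 A)%C = 0 by rewrite [LHS]complexE.
  by move=> -[h1 h2]; case: pE => ->.
move=> f Ff; have [p1 [p2 [q h]]] := reg f Ff; have [q0 e] := h A.
have h1 : ev p1 A = 0 by apply: hA; exists f, p1, p2, q; split=> //; left.
have h2 : ev p2 A = 0 by apply: hA; exists f, p1, p2, q; split=> //; right.
move: e; rewrite h1 h2 rmorph0 mulr0 addr0 => /eqP; rewrite mulf_eq0 fmorph_eq0.
by rewrite (negPf q0) => /eqP.
Qed.

End RegularFunctions.

(** * Orthogonal projections and chart coordinates *)

Section ColumnProjection.
Variables (R : realType) (n r : nat).
Local Notation C := R[i].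

(** The Moore-Penrose inverse of a matrix of full column rank; [B *m column_pinv B] is the
    orthogonal projection onto the column space. The conjugates in it are the source of real, as
    opposed to complex, polynomials. *)
Definition column_pinv (B : 'M[C]_(n, r)) : 'M[C]_(r, n) :=
  invmx (B ^t* *m B) *m B ^t*.

Lemma column_gram_unit (B : 'M[C]_(n, r)) :
  (forall z : 'cV[C]_r, B *m z = 0 -> z = 0) -> B ^t* *m B \in unitmx.
Proof.
move=> inj; rewrite -unitmx_tr -row_free_unit; apply: inj_row_free => v hv.
have e : B ^t* *m B *m v^T = 0 by rewrite -[LHS]trmxK trmx_mul trmxK hv trmx0.
have [_ _ hpos] := hs_inner_product R n 1.
suff /inj : B *m v^T = 0 by move=> /(congr1 trmx); rewrite trmxK trmx0.
apply/eqP/negPn/negP => /hpos.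
by rewrite /hs trmx_mul map_mxM -mulmxA (mulmxA (B ^t*)) e mulmx0 mxtrace0 ltxx.
Qed.

Lemma column_pinvK (B : 'M[C]_(n, r)) :
  (forall z : 'cV[C]_r, B *m z = 0 -> z = 0) -> column_pinv B *m B = 1%:M.
Proof.
by move=> inj; rewrite /column_pinv -mulmxA mulVmx// column_gram_unit.
Qed.

Lemma column_projection_hermitian (B : 'M[C]_(n, r)) :
  (B *m column_pinv B) ^t* = B *m column_pinv B.
Proof.
rewrite /column_pinv !trmx_mul !map_mxM trmxCK trmx_inv map_invmx -mulmxA.
by rewrite trmx_mul map_mxM trmxCK.
Qed.

End ColumnProjection.

Section ChartColumns.
Variables (R : realType) (d k : nat) (V : vectType R[i]) (n : nat) (e : n.-tuple V).
Variable f : (d + k).-tuple V.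
Local Notation C := R[i].
Hypotheses (he : basis_of fullv e) (hf : basis_of fullv f).

(** Coordinates, in a fixed basis of V, of the basis of the subspace with chart coordinate [A]. They
    are affine in [A], hence regular. *)
Definition chart_columns (A : 'M[C]_(d, k)) : 'M[C]_(n, d) :=
  \matrix_(a, i) coord e a (tnth (chart_gen f A) i).

Lemma vec_chart_columns A z :
  vec e (chart_columns A *m z) = \sum_i z i 0 *: tnth (chart_gen f A) i.
Proof.
rewrite -[RHS](covecK he); congr vec; apply/colP => a.
rewrite !mxE raddf_sum; apply: eq_bigr => i _ /=.
by rewrite mxE linearZ /= mulrC.
Qed.

Lemma chart_columnsP A v :
  v \in grass_space (chart hf A) <-> exists z, v = vec e (chart_columns A *m z).
Proof.
split=> [hv|[z ->]].
  exists (\col_i coord (chart_gen f A) i v).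
  rewrite vec_chart_columns {1}(coord_span hv).
  by apply: eq_bigr => i _; rewrite mxE (tnth_nth 0).
rewrite vec_chart_columns; apply: memv_suml => i _; apply: memvZ.
by apply: memv_span; exact: mem_tnth.
Qed.

Lemma chart_columns_inj A (z : 'cV[C]_d) : chart_columns A *m z = 0 -> z = 0.
Proof.
move=> z0; have fr := elimT (freeP (X := chart_gen f A)) (chart_gen_free A hf).
apply/colP => i; rewrite [RHS]mxE; apply: (fr (fun i => z i 0)).
transitivity (vec e (chart_columns A *m z)).
  by rewrite vec_chart_columns; apply: eq_bigr => j _; rewrite (tnth_nth 0).
by rewrite z0 /vec big1// => j _; rewrite mxE scale0r.
Qed.

Lemma regular_chart_columns : regular_mx chart_columns.
Proof.
move=> a i; apply: (@regular_ext _ _ _ (fun A => coord e a (tnth f (lshift k i)) +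
  \sum_j A i j * coord e a (tnth f (rshift d j)))) => [A|].
  rewrite mxE tnth_mktuple linearD linear_sum; congr (_ + _).
  by apply: eq_bigr => j _; rewrite linearZ.
apply: regularD; first exact: regular_const.
apply: regular_sum => j; apply: regularM; first exact: regular_coord.
exact: regular_const.
Qed.

End ChartColumns.

Lemma regular_column_pinv (R : realType) d k n r (B : 'M[R[i]]_(d, k) -> 'M[R[i]]_(n, r)) :
  regular_mx B -> (forall A z, B A *m z = 0 -> z = (0 : 'cV[R[i]]_r)) ->
  regular_mx (fun A => column_pinv (B A)).
Proof.
move=> hB inj; apply: regular_mxM; last exact: regular_mx_adj.
apply: regular_invmx => [|A]; last by apply: column_gram_unit => z; exact: inj.
by apply: regular_mxM => //; exact: regular_mx_adj.
Qed.

(** * Openness in a chart *)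

Section OpenConditions.
Variables (R : realType) (G : cqg_algebra R) (V : vectType R[i]) (rho : comodule G V).
Variables (n : nat) (e : n.-tuple V) (u : 'M[G]_n).
Local Notation C := R[i].
Hypotheses (he : basis_of fullv e) (uu : ucorep u) (mu : comodule_matrix rho e u).
Variables (d k : nat).
Local Notation X := 'M[C]_(d, k).
Variable P : X -> 'M[C]_n.
Hypotheses (regP : regular_mx P) (hP : forall A, (P A) ^t* = P A).
Variables (Q : X -> hopf_star_algebra R) (q : forall A, hopf_star_morphism G (Q A)).
Hypothesis qP : forall A,
  map_mx (q A) u *m scmx (Q A) (P A) = scmx (Q A) (P A) *m map_mx (q A) u.
Hypothesis univ : forall A (H' : cqg_algebra R) (f : hopf_star_morphism G H'),
  map_mx f u *m scmx H' (P A) = scmx H' (P A) *m map_mx f u ->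
  exists g : hopf_star_morphism (Q A) H', forall x, g (q A x) = f x.
Variables (r : nat) (B : X -> 'M[C]_(n, r)) (B' : X -> 'M[C]_(r, n)).
Hypotheses (regB : regular_mx B) (regB' : regular_mx B').
Hypothesis BB : forall A, B' A *m B A = 1%:M.
Hypothesis hB : forall A, (B A *m B' A) ^t* = B A *m B' A.
Hypothesis qB : forall A, map_mx (q A) u *m scmx (Q A) (B A *m B' A) =
  scmx (Q A) (B A *m B' A) *m map_mx (q A) u.
Variable Y : X -> {vspace V}.
Hypothesis hY : forall A v, v \in Y A <-> exists z, v = vec e (B A *m z).

Let mq A := push_comodule_matrix (q A) mu.

(** Two subspaces are kept apart: [P] projects onto the subspace that defines the isotropy group,
    while [Y], with frame [B], is the one on which the action is tested. Taking for [Y] either W or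
    V covers both statements. *)
Lemma trivial_action_open :
  real_algebraic_set [set A | ~ acts_trivially (comodule_along (q A) rho) (Y A)].
Proof.
pose F := [set f | exists M : X -> 'M[C]_(n, r), [/\ regular_mx M,
  forall A, map_mx (q A) u *m scmx (Q A) (M A) = scmx (Q A) (M A)
  & f = fun A => \det (B' A *m M A)]].
suff -> : [set A | ~ acts_trivially (comodule_along (q A) rho) (Y A)] =
    [set A | forall f, F f -> f A = 0].
  apply: regular_zero_set => _ [M [rM _ ->]].
  by apply: regular_det; exact: regular_mxM.
have trivE A := acts_triviallyE he (mq A) (hY A).
apply/seteqP; split=> A0 /= h.
  move=> _ [M [_ iM ->]]; apply/eqP/negPn/negP => d0; apply: h; apply/trivE.
  have uM : B' A0 *m M A0 \in unitmx by rewrite unitmxE unitfE.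
  (* Invariant vectors need not lie in [Y]; projecting them by B B', which commutes with the action,
     keeps them invariant, and the non-zero determinant lets them span [Y]. *)
  have e1 : map_mx (q A0) u *m scmx (Q A0) (B A0 *m (B' A0 *m M A0)) =
      scmx (Q A0) (B A0 *m (B' A0 *m M A0)).
    by rewrite mulmxA scmxM mulmxA qB -mulmxA iM -scmxM.
  have -> : B A0 = B A0 *m (B' A0 *m M A0) *m invmx (B' A0 *m M A0).
    by rewrite -mulmxA mulmxV// mulmx1.
  by rewrite scmxM mulmxA e1.
(* Each column of B A0 is invariant at A0 and extends to an invariant family; the determinant of B'
   times these families is 1 at A0. *)
move=> /trivE iB; have [|v vP] := choice (P := fun j (v : X -> 'cV[C]_n) =>
    [/\ forall i, regular (fun A => v A i 0), v A0 = col j (B A0)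
     & forall A, map_mx (q A) u *m scmx (Q A) (v A) = scmx (Q A) (v A)]).
  move=> j; apply: (extend_invariant_vector uu (@regular_const R d k)
    (@regularD R d k) (@regularM R d k) regP hP qP univ).
  by rewrite colE scmxM mulmxA iB.
have /h : F (fun A => \det (B' A *m \matrix_(i, j) v j A i 0)).
  exists (fun A => \matrix_(i, j) v j A i 0); split=> // [i j|A].
    have [rv _ _] := vP j; apply: regular_ext (rv i) => A.
    by rewrite mxE.
  apply/matrixP => i j; have [_ _ /(_ A)/colP/(_ i)] := vP j.
  rewrite !mulmx_sc !mxE => e1; rewrite -e1.
  by apply: eq_bigr => l _; rewrite !mxE.
have -> : \matrix_(i, j) v j A0 i 0 = B A0.
  by apply/matrixP => i j; have [_ vj _] := vP j; rewrite mxE vj mxE.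
by rewrite BB det1 => /eqP; rewrite oner_eq0.
Qed.

Lemma regular_cyclic_mx (xi : 'rV[C]_r) (M : X -> 'M[C]_r) : regular_mx M ->
  regular_mx (fun A => cyclic_mx xi (M A)).
Proof.
move=> rM l j.
have reg m : regular_mx (fun A => iter m (mulmxr (M A)) xi).
  by elim: m => [|m IH]; [exact: regular_mx_const|exact: regular_mxM].
by apply: regular_ext (reg l 0 j) => A; rewrite mxE.
Qed.

(** The intertwiner found at one point extends over the chart while [xi] stays constant, so the
    Krylov determinant is a regular function, non-zero at that point; wherever it is non-zero the
    action is abelian. *)
Lemma abelian_action_open : real_algebraic_set
  [set A | ~ factors_through_abelianization (comodule_along (q A) rho) (Y A)].
Proof.
pose F := [set f | exists (T : X -> 'M[C]_n) xi, [/\ regular_mx T,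
  forall A, map_mx (q A) u *m scmx (Q A) (T A) = scmx (Q A) (T A) *m map_mx (q A) u
  & f = fun A => \det (cyclic_mx xi (B' A *m T A *m B A))]].
suff -> : [set A | ~ factors_through_abelianization (comodule_along (q A) rho) (Y A)] =
    [set A | forall f, F f -> f A = 0].
  apply: regular_zero_set => _ [T [xi [rT _ ->]]].
  apply: regular_det; apply: regular_cyclic_mx.
  by apply: regular_mxM => //; exact: regular_mxM.
have abE A := factors_through_abelianizationE he (mq A) (BB A) (hY A).
have uq A : ucorep (map_mx (q A) u) by exact: map_ucorep.
apply/seteqP; split=> A0 /= h.
  move=> _ [T [xi [_ iT ->]]]; apply/eqP/negPn/negP => d0; apply: h; apply/abE.
  exact: (cyclic_intertwiner_cocommutative (uq A0) (BB A0) (qB A0) (iT A0) d0).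
move=> /abE [Z cZ UB].
have [T [xi [iT d0]]] :=
  cocommutative_cyclic_intertwiner (uq A0) (BB A0) (hB A0) (qB A0) cZ UB.
have [M [rM M0 iM]] := extend_intertwiner uu (@regular_const R d k)
  (@regularD R d k) (@regularM R d k) regP hP qP univ iT.
have /h : F (fun A => \det (cyclic_mx xi (B' A *m M A *m B A))) by exists M, xi.
by rewrite M0 => /eqP; rewrite (negPf d0).
Qed.

End OpenConditions.

(** * Density *)

Section CommonChart.
Variables (R : realType) (V : vectType R[i]).
Local Notation C := R[i].

Lemma dim_add_line (X : {vspace V}) v : v \notin X -> \dim (X + <[v]>) = (\dim X).+1.
Proof.
move=> vX; have v0 : v != 0 by apply: contra vX => /eqP ->; exact: mem0v.
rewrite dimv_disjoint_sum ?dim_vline ?v0 ?addn1//.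
apply/eqP; rewrite -subv0; apply/subvP => w; rewrite memv_cap => /andP [wX /vlineP [c wE]].
rewrite memv0 wE scaler_eq0 (negPf v0) orbF; apply: contraNT vX => c0.
by move: wX; rewrite wE => /(memvZ c^-1); rewrite scalerA mulVf// scale1r.
Qed.

Lemma cap_eq0_dim (X Y : {vspace V}) :
  \dim (X + Y) = (\dim X + \dim Y)%N -> (X :&: Y = 0)%VS.
Proof.
move=> h; apply/eqP; rewrite -dimv_eq0; have := dimv_sum_cap X Y.
by rewrite h => /eqP; rewrite -[X in _ == X]addn0 eqn_add2l.
Qed.

(** Grow the complement one line at a time: as long as both sums are proper, some vector lies
    outside both, because two proper subspaces never cover the space. *)
Lemma common_complement d (X Y : {vspace V}) j : \dim X = d -> \dim Y = d ->
  (d + j <= \dim {:V})%N ->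
  exists U : {vspace V}, [/\ \dim U = j, (X :&: U = 0)%VS & (Y :&: U = 0)%VS].
Proof.
move=> dX dY; elim: j => [|j IH] hj.
  by exists 0%VS; rewrite dimv0 !capv0.
have [|U [dU XU YU]] := IH; first by apply: leq_trans hj; rewrite leq_add2l.
have proper (Z : {vspace V}) : \dim Z = d -> (Z :&: U = 0)%VS ->
    exists v, v \notin (Z + U)%VS.
  move=> dZ ZU; apply: contrapT => h; move: hj.
  have -> : (fullv = Z + U :> {vspace V})%VS.
    apply/eqP; rewrite eqEsubv subvf andbT; apply/subvP => v _.
    by apply: contrapT => /negP nv; apply: h; exists v.
  by rewrite dimv_disjoint_sum// dZ dU addnS ltnn.
have [a aX] := proper X dX XU; have [b bY] := proper Y dY YU.
(* If neither [a] nor [b] works alone, each lies in the subspace that the other avoids, so a + b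
   avoids both. *)
have [v [vX vY]] : exists v, v \notin (X + U)%VS /\ v \notin (Y + U)%VS.
  have [aY|aY] := boolP (a \in (Y + U)%VS); last by exists a.
  have [bX|bX] := boolP (b \in (X + U)%VS); last by exists b.
  exists (a + b); split.
    by apply: contra aX => abX; have := memvB abX bX; rewrite addrK.
  by apply: contra bY => abY; have := memvB abY aY; rewrite addrC addKr.
exists (U + <[v]>)%VS.
have vU : v \notin U by apply: contra vX; exact/subvP/addvSr.
rewrite dim_add_line// dU; split=> //; apply: cap_eq0_dim.
  by rewrite addvA !dim_add_line// dimv_disjoint_sum// addnS.
by rewrite addvA !dim_add_line// dimv_disjoint_sum// addnS.
Qed.

Lemma grassmannian_basis d (W : grassmannian d V) :
  exists b : d.-tuple V, basis_of (grass_space W) b.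
Proof.
have := vbasisP (grass_space W); move: (vbasis _).
by rewrite (eqP (grass_dim W)) => b hb; exists b.
Qed.

Lemma in_chart d k (f : (d + k).-tuple V) (hf : basis_of fullv f)
  (W : grassmannian d V) :
  (forall c : 'I_k -> C, \sum_j c j *: tnth f (rshift d j) \in grass_space W ->
     \sum_j c j *: tnth f (rshift d j) = 0) ->
  exists A, W = chart hf A.
Proof.
move=> hW; have [b hb] := grassmannian_basis W.
pose M1 : 'M[C]_d := \matrix_(i, l) coord f (lshift k l) (tnth b i).
pose M2 : 'M[C]_(d, k) := \matrix_(i, l) coord f (rshift d l) (tnth b i).
have fE v : v = \sum_l coord f (lshift k l) v *: tnth f (lshift k l) +
    \sum_j coord f (rshift d j) v *: tnth f (rshift d j).
  rewrite {1}(coord_basis hf (memvf v)) big_split_ord.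
  by congr (_ + _); apply: eq_bigr => l _; rewrite (tnth_nth 0).
have u1 : M1 \in unitmx.
  rewrite -row_free_unit; apply: inj_row_free => v v0.
  pose x := \sum_i v 0 i *: tnth b i.
  have x1 l : coord f (lshift k l) x = 0.
    move/rowP: v0 => /(_ l); rewrite !mxE => h; rewrite -[RHS]h /x linear_sum.
    by apply: eq_bigr => i _; rewrite linearZ /= mxE.
  have xE : x = \sum_j coord f (rshift d j) x *: tnth f (rshift d j).
    rewrite {1}(fE x) big1 ?add0r// => l _.
    by rewrite x1 scale0r.
  have x0 : x = 0.
    rewrite xE; apply: hW; rewrite -xE; apply: memv_suml => i _; apply: memvZ.
    by apply: (basis_mem hb); exact: mem_tnth.
  apply/rowP => i; rewrite [RHS]mxE.
  have fr := elimT (freeP (X := b)) (basis_free hb).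
  apply: (fr (fun i => v 0 i)); rewrite -[RHS]x0; apply: eq_bigr => j _.
  by rewrite (tnth_nth 0).
(* Multiplying the coordinate matrix (M1 | M2) of a basis of W by the inverse of M1 brings it to the
   form (1 | A) of the chart. *)
exists (invmx M1 *m M2); apply: val_inj => /=.
apply/eqP; rewrite eq_sym eqEdim (eqP (grass_dim W)) (eqP (chart_dim _ hf)) leqnn andbT.
apply/span_subvP => x /(tnthP (chart_gen f (invmx M1 *m M2))) [i ->].
have -> : tnth (chart_gen f (invmx M1 *m M2)) i = \sum_l invmx M1 i l *: tnth b l.
  rewrite tnth_mktuple.
  under [RHS]eq_bigr do rewrite (fE (tnth b _)) scalerDr !scaler_sumr.
  rewrite big_split /=; congr (_ + _).
    rewrite exchange_big (bigD1 i)//= [X in _ + X]big1 ?addr0.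
      under eq_bigr do rewrite scalerA.
      rewrite -scaler_suml; have /matrixP/(_ i i) := mulVmx u1.
      rewrite !mxE eqxx => h; rewrite -[LHS]scale1r -[X in X *: _]h; congr (_ *: _).
      by apply: eq_bigr => l _; rewrite mxE.
    move=> a ne; under eq_bigr do rewrite scalerA.
    rewrite -scaler_suml; have /matrixP/(_ i a) := mulVmx u1.
    rewrite !mxE eq_sym (negPf ne) => h.
    rewrite -[RHS](scale0r (tnth f (lshift k a))) -[X in _ = X *: _]h; congr (_ *: _).
    by apply: eq_bigr => l _; rewrite mxE.
  rewrite exchange_big; apply: eq_bigr => j _ /=.
  under [RHS]eq_bigr do rewrite scalerA.
  rewrite -scaler_suml mxE; congr (_ *: _).
  by apply: eq_bigr => l _; rewrite mxE.
apply: memv_suml => l _; apply: memvZ.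
by apply: (basis_mem hb); exact: mem_tnth.
Qed.

Lemma common_chart d (W W' : grassmannian d V) :
  exists k (f : (d + k).-tuple V) (hf : basis_of fullv f) A A',
    W = chart hf A /\ W' = chart hf A'.
Proof.
have dW := eqP (grass_dim W); have dW' := eqP (grass_dim W').
have hd : (d <= \dim {:V})%N by rewrite -dW dimvS// subvf.
have [|U [dU WU W'U]] := @common_complement d W W' (\dim {:V} - d) dW dW'.
  by rewrite subnKC.
exists (\dim U); have [b hb] := grassmannian_basis W.
(* The last vectors of [f] span U, so every W that meets U trivially lies in the chart of [f]. *)
pose f := [tuple of b ++ vbasis U].
have hf : basis_of fullv f.
  have -> : fullv = (grass_space W + U)%VS.
    by apply/eqP; rewrite eq_sym eqEdim subvf dimv_disjoint_sum// dW dU subnKC /=.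
  have dir : directv (grass_space W + U) by apply/directv_addP.
  exact: (cat_basis dir hb (vbasisP U)).
exists f, hf.
have fU (Z : grassmannian d V) : (grass_space Z :&: U = 0)%VS -> forall c : 'I_(\dim U) -> C,
    \sum_j c j *: tnth f (rshift d j) \in grass_space Z ->
    \sum_j c j *: tnth f (rshift d j) = 0.
  move=> ZU c hc; apply/eqP; rewrite -memv0 -ZU memv_cap hc /=.
  apply: memv_suml => j _; apply: memvZ; rewrite tnth_rshift.
  by apply: vbasis_mem; exact: mem_tnth.
have [A eA] := in_chart hf (fU W WU); have [A' eA'] := in_chart hf (fU W' W'U).
by exists A, A'.
Qed.

End CommonChart.

Section Density.
Variables (R : realType) (d : nat) (V : vectType R[i]).
Local Notation C := R[i].
Import -(notations) mpoly.

(** The parameter t is real, so the real and imaginary parts of all coordinates are affine in t. *)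
Lemma real_polynomial_on_line k (p : mpoly (d * k + d * k) R) (A D : 'M[C]_(d, k)) :
  exists phi : {poly R}, forall t, phi.[t] = meval (real_coords (A + t%:C *: D)) p.
Proof.
exists (\sum_(m <- msupp p) (mcoeff m p)%:P *
  \prod_l ((real_coords A l)%:P + (real_coords D l)%:P * 'X) ^+ (m l)) => t.
rewrite horner_sum /meval /mmap; apply: eq_bigr => m _.
rewrite hornerM hornerC; congr (_ * _); rewrite /mmap1 horner_prod.
apply: eq_bigr => l _; rewrite horner_exp !hornerE; congr (_ ^+ _).
rewrite /real_coords; case: fintype.split => a; rewrite linearD linearZ !mxE /=.
  by case: (mxvec A 0 a) (mxvec D 0 a) => [x y] [x' y'] /=; rewrite mul0r subr0 mulrC.
by case: (mxvec A 0 a) (mxvec D 0 a) => [x y] [x' y'] /=; rewrite mul0r addr0 mulrC.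
Qed.

Lemma polynomial_nonzero_near0 (phi : {poly R}) (delta : R) : phi != 0 -> 0 < delta ->
  exists t, [/\ 0 < t, t <= delta & phi.[t] != 0].
Proof.
(* The points delta / (m + 1) are pairwise distinct, and [size phi] of them are already more than
   phi can have as roots. *)
move=> phi0 delta0; pose t (m : nat) := delta / m.+1%:R.
have t_inj : injective t.
  move=> m m' /(mulfI (lt0r_neq0 delta0)) /invr_inj /eqP.
  by rewrite eqr_nat => /eqP [].
apply: contrapT => h.
have := max_poly_roots phi0 (rs := map t (iota 0 (size phi))).
rewrite size_map size_iota ltnn map_inj_uniq// iota_uniq => /(_ _ isT) H.
suff /H : all (root phi) (map t (iota 0 (size phi))) by [].
apply/allP => x /mapP [m _ ->]; apply/negPn/negP => nr; apply: h; exists (t m).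
split=> //; first by rewrite divr_gt0// ltr0n.
by rewrite ler_pdivrMr ?ltr0n// ler_peMr ?ler1n// ltW.
Qed.

Lemma zariski_open_dense (S : set (grassmannian d V)) :
  zariski_open S -> S !=set0 -> dense S.
Proof.
move=> oS [W0 SW0] O [W1 OW1] oO.
have [k [f [hf [A0 [A1 [e0 e1]]]]]] := common_chart W0 W1.
have [P hP] := oS k f hf.
(* [p] is one of the equations of the complement of S that fails at A0; off its zeros one is inside
   S. *)
have [p Pp p0] : exists2 p, P p & meval (real_coords A0) p != 0.
  apply: contrapT => h; suff : (chart hf @^-1` ~` S) A0 by rewrite /= -e0.
  rewrite hP => p Pp; apply/eqP/negPn/negP => p0.
  by apply: h; exists p.
have [D DE] : exists D, D = A0 - A1 by exists (A0 - A1).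
have [phi phiE] := real_polynomial_on_line p A1 D.
have phi0 : phi != 0.
  apply: contraNneq p0 => phi0; have := phiE 1.
  by rewrite phi0 horner0 rmorph1 scale1r DE addrC addrNK => <-.
have oA : open (chart hf @^-1` O : set 'M[(C)^o]_(d, k)) by exact: oO.
have : nbhs (A1 : 'M[(C)^o]_(d, k)) (chart hf @^-1` O).
  by apply: open_nbhs_nbhs; split=> //=; rewrite -e1.
move=> /nbhs_ballP [eps /= eps0 hball].
(* The leading 1 makes [M] positive and strictly larger than every entry of D, even when D = 0. *)
pose M : C := 1 + \sum_i \sum_j `|D i j|.
have M0 : 0 < M.
  by rewrite ltr_pwDl// sumr_ge0// => i _; rewrite sumr_ge0.
have DM i j : `|D i j| < M.
  rewrite /M (bigD1 i)//= (bigD1 j)//= addrCA -!addrA ltrDl.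
  rewrite addrCA ltr_pwDl// addr_ge0// sumr_ge0// => a _.
  by rewrite sumr_ge0.
have eM : 0 < eps / M by rewrite divr_gt0.
(* Radii of balls over the complex numbers are themselves complex numbers; eps / M is positive,
   hence real, and [delta] is that real number. *)
pose delta := complex.Re (eps / M).
have eME : eps / M = delta%:C.
  by rewrite /delta; apply/esym/RRe_real; rewrite ger0_real// ltW.
have delta0 : 0 < delta by rewrite -ltcR -eME.
have [t [t0 td pt]] := polynomial_nonzero_near0 phi0 delta0.
exists (chart hf (A1 + t%:C *: D)); split.
  apply: hball; split=> // i j; rewrite !mxE /ball /= opprD addNKr normrN normrM.
  have t0' : 0 <= t%:C :> C by rewrite lecR ltW.
  rewrite (ger0_norm t0').
  have [D0|D0] := eqVneq (D i j) 0; first by rewrite D0 normr0 mulr0.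
  apply: (@le_lt_trans _ _ (eps / M * `|D i j|)).
    by rewrite ler_wpM2r// eME lecR.
  by rewrite mulrAC ltr_pdivrMr// ltr_pM2l.
apply: contrapT => nS; have : (chart hf @^-1` ~` S) (A1 + t%:C *: D) by [].
by rewrite hP => /(_ p Pp); rewrite -phiE => /eqP; rewrite (negPf pt).
Qed.

End Density.

(** * Assembly of the four statements *)

Theorem theoremA (R : realType) (G : cqg_algebra R) (V : vectType R[i])
  (rho : comodule G V) (d : nat) (hd : (d <= \dim {:V})%N)
  (GW : grassmannian d V -> cqg_algebra R)
  (q : forall W : grassmannian d V, hopf_star_morphism G (GW W))
  (hq : forall W : grassmannian d V, is_isotropy rho W (q W)) :
  [/\ zariski_open_and_dense
        [set W | acts_trivially (comodule_along (q W) rho) W],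
      zariski_open_and_dense
        [set W | acts_trivially (comodule_along (q W) rho) fullv],
      zariski_open_and_dense
        [set W | factors_through_abelianization (comodule_along (q W) rho) W]
    & zariski_open_and_dense
        [set W | factors_through_abelianization (comodule_along (q W) rho) fullv]].
Proof.
have [e [u [he uu mu]]] := comodule_unitary_basis rho.
have conclude S : zariski_open S -> zariski_open_and_dense S.
  by move=> oS; split=> // S0; exact: zariski_open_dense.
(* In a chart the defining property of G_W becomes a matrix condition: [W] is a subcomodule exactly
   when P commutes with the unitary matrix, since P is the orthogonal projection onto W. *)
have setup k (f : (d + k).-tuple V) (hf : basis_of fullv f) :
    let B := chart_columns e f in let B' := fun A => column_pinv (B A) in
    let P := fun A => B A *m B' A in
    [/\ regular_mx B, regular_mx B', forall A, B' A *m B A = 1%:M,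
      forall A, (P A) ^t* = P A & [/\ forall A,
        map_mx (q (chart hf A)) u *m scmx (GW (chart hf A)) (P A) =
        scmx (GW (chart hf A)) (P A) *m map_mx (q (chart hf A)) u
      & forall A (H' : cqg_algebra R) (g : hopf_star_morphism G H'),
        map_mx g u *m scmx H' (P A) = scmx H' (P A) *m map_mx g u ->
        exists g' : hopf_star_morphism (GW (chart hf A)) H',
          forall x, g' (q (chart hf A) x) = g x]].
  move=> B B' P.
  have inj A z := @chart_columns_inj R d k V _ e f he hf A z.
  have BB A : B' A *m B A = 1%:M by apply: column_pinvK => z; exact: inj.
  have rB : regular_mx B by exact: regular_chart_columns.
  have rB' : regular_mx B' by apply: regular_column_pinv => // A z; exact: inj.
  have hP A : (P A) ^t* = P A by exact: column_projection_hermitian.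
  have mg (H' : hopf_star_algebra R) (g : hopf_star_morphism G H') :=
    push_comodule_matrix g mu.
  split=> //; split=> [A|A H' g com].
    have [/(subcomoduleE he (mg _ _) (BB A) (chart_columnsP he hf A)) h _] := hq (chart hf A).
    apply: ucorep_commute_projection => //; first exact: map_ucorep.
    by rewrite {1}/P scmxM mulmxA h /P !scmxM !mulmxA.
  have [_ univ] := hq (chart hf A).
  have [|g' hg' _] := univ H' g; last by exists g'.
  apply/(subcomoduleE he (mg _ _) (BB A) (chart_columnsP he hf A)).
  by rewrite -/(P A) -com -mulmxA -scmxM /P -mulmxA BB mulmx1.
(* For the action on V, the frame and its left inverse are both the identity matrix, while P still
   projects onto W. *)
have full v : v \in fullv <-> exists z, v = vec e (1%:M *m z).
  split=> _; last exact: memvf.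
  by exists (covec e v); rewrite mul1mx covecK.
have h1 : (1%:M *m 1%:M : 'M[R[i]]_(\dim {:V})) ^t* = 1%:M *m 1%:M.
  by rewrite mulmx1 trmx1 map_mx1.
have q1 (Q : hopf_star_algebra R) (g : hopf_star_morphism G Q) :
    map_mx g u *m scmx Q (1%:M *m 1%:M) = scmx Q (1%:M *m 1%:M) *m map_mx g u.
  by rewrite mulmx1 scmx1 mulmx1 mul1mx.
split; apply: conclude => k f hf; have [rB rB' BB hP [qP univ]] := setup k f hf;
  have rP := regular_mxM rB rB';
  have r1 : regular_mx (fun _ : 'M[R[i]]_(d, k) => 1%:M : 'M[R[i]]_(\dim {:V})) by
    exact: regular_mx_const.
- exact: (trivial_action_open he uu mu rP hP qP univ rB' BB qP (chart_columnsP he hf)).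
- exact: (trivial_action_open he uu mu rP hP qP univ r1 (fun=> mulmx1 _)
    (fun A => q1 _ (q (chart hf A))) (Y := fun=> fullv) (fun=> full)).
- exact: (abelian_action_open he uu mu rP hP qP univ rB rB' BB hP qP
    (chart_columnsP he hf)).
- exact: (abelian_action_open he uu mu rP hP qP univ r1 r1 (fun=> mulmx1 _) (fun=> h1)
    (fun A => q1 _ (q (chart hf A))) (Y := fun=> fullv) (fun=> full)).
Qed.
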